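(* Let $d\ge 1$ and let $W\subset\mathbb{R}^d$ be a compact convex set with $\mathrm{Vol}(W)=1$. For $t>0$ let $\eta_t$ be a homogeneous Poisson point process on $W$ with intensity $t$. Let $(r_t)_{t>0}$ be a monotone decreasing family of positive numbers with $r_t\to 0$ as $t\to\infty$, and let $\rho_t:=t r_t^d$. Let $D_t$ be the dimension of the Vietoris--Rips complex or of the Čech complex built on $\eta_t$ with distance parameter $r_t$ (the statement holds for each of the two). Assume $\rho_t/t^{-\alpha}\to\infty$ as $t\to\infty$ for all $\alpha>0$. Let $\kappa_d$ be the volume of the $d$-dimensional unit ball and $H(x)=1+x\ln x-x$. Then $D_t/k_t$ satisfies a large deviations principle with speed $m_t$ and good rate function $I(x)$, where: (i) if $\rho_t/\ln(t)\to 0$: $$k_t=\frac{\ln(t)}{\ln(\ln(t)/\rho_t)},\qquad m_t=\ln(t),\qquad I(x)=\begin{cases}x-1,&\text{if }x\ge 1,\\ \infty,&\text{otherwise;}\end{cases}$$ (ii) if $\rho_t/\ln(t)\to B\in(0,\infty)$: $$k_t=\beta\cdot\frac{\kappa_d}{2^d}\rho_t,\qquad m_t=\frac{\kappa_d}{2^d}\rho_t,\qquad I(x)=\begin{cases}H(\beta x)-H(\beta),&\text{if }x\ge 1,\\ \infty,&\text{otherwise,}\end{cases}$$ where $\beta>1$ is the unique number satisfying $H(\beta)=(B\cdot\kappa_d2^{-d})^{-1}$; (iii) if $\rho_t/\ln(t)\to\infty$: $$k_t=\frac{\kappa_d}{2^d}\rho_t,\qquad m_t=\frac{\kappa_d}{2^d}\rho_t,\qquad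 I(x)=\begin{cases}H(x),&\text{if }x\ge 1,\\ \infty,&\text{otherwise.}\end{cases}$$
   Context: For a finite point set $X\subset\mathbb{R}^d$ and $r>0$: the Vietoris--Rips complex $\mathcal{V}(X,r)$ has as its $k$-faces the sets of $k+1$ distinct points $\{x_0,\dots,x_k\}\subset X$ with $\|x_i-x_j\|\le r$ for all $i,j$; the Čech complex $\mathcal{C}(X,r)$ has as its $k$-faces the sets of $k+1$ distinct points $\{x_0,\dots,x_k\}\subset X$ for which there is $y\in\mathbb{R}^d$ with $\|x_i-y\|\le r/2$ for all $i$. Here $\|\cdot\|$ is the Euclidean norm. The dimension $D_t$ of $\mathcal{V}(\eta_t,r_t)$ or $\mathcal{C}(\eta_t,r_t)$ is the largest $k$ such that the complex has a $k$-face (with $D_t=-1$ if $\eta_t$ is empty). A homogeneous Poisson point process on $W$ with intensity $t$: the number of points in a Borel set $A\subset W$ is Poisson distributed with parameter $t\,\mathrm{Vol}(A)$, and the numbers of points in disjoint sets are independent. Large deviations principle (LDP): a family $(\mathbb{P}_t)_{t>0}$ of probability measures on a topological space $\mathcal{X}$ with $\sigma$-field $\mathcal{B}$ (here $\mathcal{X}=\mathbb{R}$ with its Borel $\sigma$-field) satisfies an LDP with speed $s_t\to\infty$ and good rate function $I:\mathcal{X}\to[0,\infty]$ if the level sets $\{x:I(x)\le\alpha\}$ are compact for all $\alpha\in[0,\infty)$, and for all $B\in\mathcal{B}$, $$-\inf_{x\in\mathrm{int}\,B}I(x)\le\liminf_{t\to\infty}s_t^{-1}\ln(\mathbb{P}_t(B))\le\limsup_{t\to\infty}s_t^{-1}\ln(\mathbb{P}_t(B))\le-\inf_{x\in\mathrm{cl}\,B}I(x),$$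 where $\mathrm{int}$ and $\mathrm{cl}$ denote interior and closure. A family of random variables satisfies an LDP if their distributions do. *)

(* Defs.v *)
From HB Require Import structures.
From mathcomp Require Import all_boot all_order all_algebra finmap.
From mathcomp Require Import all_classical all_reals all_analysis.

Set Implicit Arguments.
Unset Strict Implicit.
Unset Printing Implicit Defensive.

Import Order.TTheory GRing.Theory Num.Theory.
Import numFieldNormedType.Exports.

Local Open Scope classical_set_scope.
Local Open Scope ring_scope.

(* The library norm on ['rV[R]_d] is the sup norm. *)
Definition enorm (R : realType) (d : nat) (x : 'rV[R]_d) : R :=
  Num.sqrt (\sum_(i < d) x ord0 i ^+ 2).

(* d-dimensional Lebesgue measure, as the iterated product
   [lebesgue_measure \x vol d]: the measure of a Borel set is the integral of
   the measures of its sections. It is only meaningful on Borel sets. *)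
Fixpoint vol (R : realType) (d : nat) : set 'rV[R]_d -> \bar R :=
  match d with
  | 0 => fun A => (\1_A 0)%:E
  | d'.+1 => fun A =>
      (\int[@lebesgue_measure R]_x
         vol [set y : 'rV[R]_d' | A (row_mx (x%:M : 'M[R]_1) y)])%E
  end.

Definition borel (T : topologicalType) : set (set T) := <<s @open T >>.

Definition unit_ball_volume (R : realType) (d : nat) : R :=
  fine (vol [set x : 'rV[R]_d | enorm x <= 1]).

Section complexes.
Variables (R : realType) (d : nat).
Implicit Types (X s : {fset 'rV[R]_d}) (r : R).

Definition vietoris_rips X r : set {fset 'rV[R]_d} :=
  [set s | [/\ s != fset0, (s `<=` X)%fset &
    forall x y, x \in s -> y \in s -> enorm (x - y) <= r]].

Definition cech X r : set {fset 'rV[R]_d} :=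
  [set s | [/\ s != fset0, (s `<=` X)%fset &
    exists y : 'rV[R]_d, forall x, x \in s -> enorm (x - y) <= r / 2]].

(* For a complex [K] on the vertex set [X]: a k-face has k + 1 vertices, and
   the maximum over no face is 0, so that the empty complex has dimension -1. *)
Definition complex_dim X (K : set {fset 'rV[R]_d}) : int :=
  (\max_(s <- fpowerset X | s \in K) #|` s|)%:Z - 1.

End complexes.

Inductive complex_kind := VietorisRips | Cech.

Definition complex (R : realType) (d : nat) (c : complex_kind) :
    {fset 'rV[R]_d} -> R -> set {fset 'rV[R]_d} :=
  match c with
  | VietorisRips => @vietoris_rips R d
  | Cech => @cech R d
  end.

Definition npoints (R : realType) (d : nat)
    (X : {fset 'rV[R]_d}) (A : set 'rV[R]_d) : nat :=
  #|` [fset x in X | x \in A]%fset|.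

(* A Poisson process with intensity [t] on [W] is almost surely a finite set of
   distinct points, so it is represented by a random finite set. The second
   argument of [poisson_prob] is not used by the library definition; for rate 0
   [poisson_prob] is the Dirac mass at 0. *)
Record poisson_process (R : realType) (d : nat) (disp : measure_display)
    (Omega : measurableType disp) (P : probability Omega R)
    (W : set 'rV[R]_d) (t : R) (eta : Omega -> {fset 'rV[R]_d}) : Prop := {
  pp_support : forall w x, x \in eta w -> W x ;
  pp_measurable : forall A, borel A -> A `<=` W ->
    measurable_fun setT (fun w => npoints (eta w) A) ;
  pp_poisson : forall A, borel A -> A `<=` W -> forall S : set nat,
    P [set w | S (npoints (eta w) A)] = poisson_prob (t * fine (vol A)) 0%N S ;
  pp_independent : forall (n : nat) (A : 'I_n -> set 'rV[R]_d),
    (forall i, borel (A i) /\ A i `<=` W) ->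
    trivIset setT A -> forall S : 'I_n -> set nat,
    P [set w | forall i, S i (npoints (eta w) (A i))] =
      (\prod_(i < n) P [set w | S i (npoints (eta w) (A i))])%E }.

Section large_deviations.
Variable R : realType.
Local Open Scope ereal_scope.

Record good_rate_function (I : R -> \bar R) : Prop := {
  rate_ge0 : forall x, 0 <= I x ;
  rate_compact : forall a : R, (0 <= a)%R -> compact [set x | I x <= a%:E] }.

Record ldp (mu : R -> set R -> \bar R) (s : R -> R) (I : R -> \bar R) : Prop := {
  ldp_speed : s t @[t --> +oo%R] --> +oo%R ;
  ldp_rate : good_rate_function I ;
  ldp_lower : forall B : set R, measurable B ->
    - ereal_inf (I @` B°) <=
      limf_einf (fun t => ((s t)^-1)%:E * lne (mu t B)) +oo%R ;
  ldp_upper : forall B : set R, measurable B ->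
    limf_esup (fun t => ((s t)^-1)%:E * lne (mu t B)) +oo%R <=
      - ereal_inf (I @` closure B) }.

Definition ldp_rv (disp : measure_display) (Omega : R -> measurableType disp)
    (P : forall t, probability (Omega t) R) (X : forall t, Omega t -> R)
    (s : R -> R) (I : R -> \bar R) : Prop :=
  (forall t, (0 < t)%R -> measurable_fun setT (X t)) /\
  ldp (fun t => pushforward (P t) (X t)) s I.

End large_deviations.

Definition H (R : realType) (x : R) : R := 1 + x * ln x - x.

Definition rate_from1 (R : realType) (f : R -> R) (x : R) : \bar R :=
  if 1 <= x then (f x)%:E else +oo%E.

(* Main.v *)
From HB Require Import structures.
Require Import Defs.
From mathcomp Require Import all_boot all_order all_algebra finmap.
From mathcomp Require Import all_classical all_reals all_analysis.
From mathcomp Require Import measurable_realfun.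
From mathcomp Require Import ring lra zify.
Set Implicit Arguments.
Unset Strict Implicit.
Unset Printing Implicit Defensive.
Import Order.TTheory GRing.Theory Num.Theory.
Import numFieldNormedType.Exports.
Local Open Scope classical_set_scope.
Local Open Scope ring_scope.

(** The dimension is one less than the largest number of points that form a face. Write
    [lam t] for the rate [kappa / 2 ^+ d * rho t], which is the expected number of points in a
    ball of diameter [r t] inside the window, and [q t] for [t / rho t], the order of the number
    of disjoint balls of this size in the window. The probability that one Poisson variable of
    rate [lam] is at least [n] is about [expR (- lam * H (n / lam))] for [n] above [lam], so the
    expected number of balls with [n] points has a logarithm of about
    [ln (q t) - lam t * H (n / lam t)]. The theorem says that the largest face behaves like the
    maximum over these balls, for both complexes.

    For lower bounds, the points in a ball of diameter [r t] form a face of the Cech complex,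
    hence of the Vietoris-Rips complex. A convex set of positive volume contains a cube
    ([convex_contains_cube]), in which one packs of the order of [q t] disjoint balls with
    independent numbers of points ([max_face_lt_le]).

    For upper bounds, a face of either complex has diameter at most [r t], and the
    isodiametric inequality says that a ball has the greatest volume for its diameter. To
    take only finitely many sets into account, space is cut into cubes whose side is a small
    fraction of [r t]. The cubes met by a face have a union of almost the same diameter,
    and up to a constant there are only [q t] such unions; the union bound and the Chernoff
    bound give [max_face_tail_le]. So the isodiametric inequality is needed only for unions of
    grid cubes ([isodiametric_cubes]). It follows from a Brunn-Minkowski inequality for finite sets
    of integer vectors ([discrete_brunn_minkowski]), which is proved by induction on the
    dimension with an inequality of Prekopa and Leindler on the integers.

    With [n = x * k_t], the logarithm above divided by the speed tends to minus the rate
    function. In the sparse regime [ln (q t)] is about [ln t] and the cost of [n] points about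
    [x * ln t] ([sparse_ldp]). If [rho t] is of the order of [ln t], then [ln (q t)] is about
    [lam t * H beta], and [H (beta * x) - H beta] remains; if [rho t] is larger, then
    [ln (q t)] is negligible and [H x] remains ([dense_ldp] treats both). For [x > 1] the
    expected number of balls is small and has the order of the probability that there is one. For
    [x < 1] the probability of staying below [x * k_t] is superexponentially small: in the
    first two regimes because the expected number of balls is exponentially large
    ([below_of_log_expected]), in the last one because the number of points is
    exponentially unlikely to be too small in one ball and would have to be so in all of them
    ([concentrated_below]). Such asymptotics of the tails yield the large deviations principle
    ([ldp_rv_of_tails]).

    That the dimension is a random variable at all follows from [max_face_approx], which expresses
    it by numbers of points in countably many Borel sets. *)

(** * Euclidean norm *)

Section enorm_theory.
Variables (R : realType) (d : nat).
Implicit Types (x y z : 'rV[R]_d).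

Lemma enorm_ge0 x : 0 <= enorm x. Proof. exact: sqrtr_ge0. Qed.

Lemma enorm_sqr x : enorm x ^+ 2 = \sum_(i < d) x ord0 i ^+ 2.
Proof. by rewrite sqr_sqrtr// sumr_ge0// => i _; rewrite sqr_ge0. Qed.

Lemma enormN x : enorm (- x) = enorm x.
Proof. by congr Num.sqrt; apply: eq_bigr => i _; rewrite mxE sqrrN. Qed.

Lemma enormB x y : enorm (x - y) = enorm (y - x).
Proof. by rewrite -enormN opprB. Qed.

Lemma enormZ (a : R) x : enorm (a *: x) = `|a| * enorm x.
Proof.
rewrite /enorm -sqrtr_sqr -sqrtrM ?sqr_ge0//; congr Num.sqrt.
by rewrite mulr_sumr; apply: eq_bigr => i _; rewrite mxE exprMn.
Qed.

Lemma enorm_cauchy_schwarz x y :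
  \sum_(i < d) x ord0 i * y ord0 i <= enorm x * enorm y.
Proof.
set C := \sum_(_ < _) _.
have [/eqP y0|yn0] := boolP (enorm y == 0).
  have h i : y ord0 i = 0.
    have := enorm_sqr y; rewrite y0 expr0n /= => /esym/eqP.
    rewrite psumr_eq0 => [/allP/(_ i)|j _]; last exact: sqr_ge0.
    by rewrite mem_index_enum => /(_ isT); rewrite sqrf_eq0 => /eqP.
  by rewrite y0 mulr0 /C big1// => i _; rewrite h mulr0.
set B := enorm y ^+ 2; have Bgt0 : 0 < B by rewrite exprn_gt0// lt_def yn0 enorm_ge0.
have : 0 <= \sum_(i < d) (x ord0 i * B - C * y ord0 i) ^+ 2.
  by apply: sumr_ge0 => i _; exact: sqr_ge0.
have -> : \sum_(i < d) (x ord0 i * B - C * y ord0 i) ^+ 2 =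
    B * (enorm x ^+ 2 * B - C ^+ 2).
  transitivity (\sum_(i < d) (B ^+ 2 * x ord0 i ^+ 2 - C * B *+ 2 * (x ord0 i * y ord0 i)
     + C ^+ 2 * y ord0 i ^+ 2)); first by apply: eq_bigr => i _; ring.
  rewrite big_split/= sumrB -!mulr_sumr -!enorm_sqr -/C -/B; ring.
rewrite pmulr_rge0// subr_ge0 -exprMn => h.
apply: le_trans (ler_norm _) _; rewrite -ler_sqr ?nnegrE ?mulr_ge0 ?enorm_ge0//.
by rewrite real_normK ?num_real.
Qed.

Lemma ler_enormD x y : enorm (x + y) <= enorm x + enorm y.
Proof.
rewrite -ler_sqr ?nnegrE ?addr_ge0 ?enorm_ge0// sqrrD !enorm_sqr.
rewrite (eq_bigr (fun i => x ord0 i ^+ 2 + (x ord0 i * y ord0 i) *+ 2 + y ord0 i ^+ 2)).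
  by rewrite 2!big_split/= sumrMnl lerD2r lerD2l lerMn2r/= enorm_cauchy_schwarz.
by move=> i _; rewrite mxE sqrrD.
Qed.

Lemma enorm_triangle z x y : enorm (x - y) <= enorm (x - z) + enorm (z - y).
Proof. by apply: le_trans (ler_enormD _ _); rewrite addrA subrK. Qed.

Lemma coord_le_enorm x i : `|x ord0 i| <= enorm x.
Proof.
rewrite -sqrtr_sqr ler_sqrt ?sumr_ge0// => [|j _]; last exact: sqr_ge0.
by rewrite (bigD1 i)//= lerDl sumr_ge0// => j _; exact: sqr_ge0.
Qed.

Lemma enorm_le_coord x (M : R) : (forall i, `|x ord0 i| <= M) -> enorm x <= d%:R * M.
Proof.
move=> xM; have [d0|d0] := posnP d.
  have i_F (i : 'I_d) : False by have := ltn_ord i; rewrite {2}d0.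
  by rewrite /enorm big1 ?sqrtr0 ?d0 ?mul0r// => i; case: (i_F i).
have M0 : 0 <= M by apply: le_trans (xM (Ordinal d0)).
rewrite -ler_sqr ?nnegrE ?enorm_ge0 ?mulr_ge0// enorm_sqr.
apply: (@le_trans _ _ (\sum_(i < d) M ^+ 2)).
  by apply: ler_sum => i _; rewrite -[leLHS]real_normK ?num_real// ler_sqr ?nnegrE.
rewrite sumr_const card_ord exprMn -[leLHS]mulr_natl ler_wpM2r ?sqr_ge0// -natrX ler_nat.
by rewrite leq_pmull.
Qed.

End enorm_theory.

Lemma enorm_continuous (R : realType) (d : nat) : continuous (@enorm R d).
Proof.
move=> x; apply: continuous_comp; last exact: sqrt_continuous.
apply: (@continuous_big _ _ _ _ _ _ _ _ (fun i (x : 'rV[R]_d) => x ord0 i ^+ 2)).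
  by move=> z; exact: add_continuous.
move=> i _ z; apply: (@continuous_comp _ _ _ (fun x : 'rV[R]_d => x ord0 i) (fun y => y ^+ 2)).
  exact: coord_continuous.
exact: exprn_continuous.
Qed.

Lemma closed_enorm_ball (R : realType) (d : nat) (v : 'rV[R]_d) (r : R) :
  closed [set x | enorm (x - v) <= r].
Proof.
have -> : [set x | enorm (x - v) <= r] = (fun x => enorm (x - v)) @^-1` [set y | y <= r] by [].
apply: preimage_closed; [|exact: closed_le].
move=> x _; apply: (@continuous_comp _ _ _ (fun x : 'rV[R]_d => x - v)); last exact: enorm_continuous.
by apply: continuousB => //; exact: cst_continuous.
Qed.

(** * Borel sets and volume *)

Lemma forall_ordS d (Q : 'I_d.+1 -> Prop) :
  (forall i, Q i) <-> Q ord0 /\ forall i, Q (lift ord0 i).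
Proof.
split=> [h|[h0 hS] i]; first by split=> [|i]; exact: h.
by case: (unliftP ord0 i) => [j|] ->.
Qed.

(** The row over which [vol] integrates, typed with [d.+1] coordinates instead of [1 + d]:
    [hcat0] and [hcatS] then spare the splitting of ['I_(1 + d)]. *)
Definition hcat (K : pzRingType) d (x : K) (y : 'rV[K]_d) : 'rV[K]_d.+1 :=
  row_mx (x%:M : 'M[K]_1) y.

Lemma hcat0 (K : pzRingType) d x (y : 'rV[K]_d) : hcat x y ord0 ord0 = x.
Proof.
have h : (row_mx (x%:M : 'M[K]_1) y : 'rV[K]_(1 + d)) ord0 (lshift d ord0) = x.
  by rewrite row_mxEl mxE eqxx.
by rewrite -[RHS]h; congr (row_mx _ _ _ _); exact: val_inj.
Qed.

Lemma hcatS (K : pzRingType) d x (y : 'rV[K]_d) i : hcat x y ord0 (lift ord0 i) = y ord0 i.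
Proof.
rewrite -[RHS](row_mxEr (x%:M : 'M[K]_1) y ord0 i).
by congr (row_mx _ _ _ _); exact: val_inj.
Qed.

Section borel_vol.
Variable R : realType.
Notation T d := (g_sigma_algebraType (@open 'rV[R]_d)).

Lemma open_borel (d : nat) (A : set 'rV[R]_d) : open A -> borel A.
Proof. exact: sub_sigma_algebra. Qed.

Lemma closed_borel (d : nat) (A : set 'rV[R]_d) : closed A -> borel A.
Proof.
move=> cA; rewrite -(setCK A); apply: (@measurableC _ (T d)).
by apply: open_borel; exact: closed_openC.
Qed.

Definition ratr_row d (q : 'rV[rat]_d) : 'rV[R]_d := map_mx ratr q.

Lemma rat_approx_row d (x : 'rV[R]_d) (e : R) : 0 < e ->
  exists q : 'rV[rat]_d, ball (ratr_row q) e x.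
Proof.
move=> e0.
have h i : exists q : rat, ball (ratr q : R) e (x ord0 i).
  have /rat_in_itvoo[q] : x ord0 i - e < x ord0 i + e by lra.
  rewrite in_itv/= => /andP[q1 q2]; exists q.
  by rewrite /ball/= ltr_norml; apply/andP; split; lra.
exists (\row_i (projT1 (cid (h i)))); split=> // i j; rewrite !mxE/=.
by case: cid => q /=; rewrite (ord1 i).
Qed.

(** Open sets are countable unions of balls with rational centres and radii, so the
    measurability of a map into ['rV_d] can be tested on balls. *)
Lemma open_bigcup_ball d (A : set 'rV[R]_d) : open A ->
  A = \bigcup_(p in [set p : 'rV[rat]_d * nat | ball (ratr_row p.1) p.2.+1%:R^-1 `<=` A])
    ball (ratr_row p.1) p.2.+1%:R^-1.
Proof.
move=> oA; apply/seteqP; split=> [x Ax|x [p /= pA]]; last exact: pA.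
have /nbhs_ballP[e /= e0 eA] : nbhs x A by exact: open_nbhs_nbhs.
have [n ne] : exists n, n.+1%:R^-1 < e / 2.
  have e20 : 0 < e / 2 by rewrite divr_gt0.
  have [n _ /(_ n)] := near_infty_natSinv_lt (PosNum e20).
  by move=> /(_ (leqnn n)); exists n.
have [q qx] := @rat_approx_row d x n.+1%:R^-1 ltac:(by rewrite invr_gt0).
exists (q, n) => //= z qz; apply: eA.
rewrite [e]splitr; apply: (@ball_triangle _ _ (ratr_row q)).
  by apply: ball_sym; apply: le_ball qx; exact: ltW.
by apply: le_ball qz; exact: ltW.
Qed.

(** For the sup norm the preimage of a ball is a product of two balls. *)
Lemma measurable_row_mx d :
  measurable_fun [set: measurableTypeR R * T d]
    ((fun p => row_mx (p.1%:M : 'M[R]_1) p.2) : _ -> T d.+1).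
Proof.
apply: (@measurability _ _ (measurableTypeR R * T d)%type (T d.+1) _ _ (@open 'rV[R]_d.+1)) => //.
move=> _ [A oA <-]; rewrite setTI (open_bigcup_ball oA) preimage_bigcup bigcup_mkcond.
apply: countable_bigcupT_measurable => // -[q n]; case: ifPn => // _ /=.
move: n.+1%:R^-1 (ratr_row q : 'rV[R]_(1 + d)) => e z.
have -> : (fun p : R * 'rV[R]_d => row_mx (p.1%:M : 'M[R]_1) p.2) @^-1` (ball z e) =
    ball (z ord0 (lshift d ord0)) e `*` ball (rsubmx z) e.
  apply/seteqP; split=> -[x y] /=.
    move=> [e0 h]; split.
      by have := h ord0 (lshift d ord0); rewrite row_mxEl mxE eqxx.
    by split=> // i j; have := h i (rshift 1 j); rewrite row_mxEr mxE.
  move=> [hx [e0 hy]]; split=> // i j; rewrite (ord1 i); case: (split_ordP j) => k ->.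
    by rewrite row_mxEl mxE (ord1 k) eqxx.
  by rewrite row_mxEr; have := hy ord0 k; rewrite mxE.
apply: measurableX.
  by apply: measurable_realfun.open_measurable; exact: ball_open.
by apply: open_borel; exact: ball_open.
Qed.

(** A product measure takes a bundled sigma-finite measure as its right factor, whereas the
    induction in [vol_measure] yields a measure with a proof of sigma-finiteness. *)
Lemma sigma_finite_measure_of disp (X : measurableType disp) (m : {measure set X -> \bar R}) :
  sigma_finite setT m ->
  exists m' : {sigma_finite_measure set X -> \bar R}, m' = m :> (set X -> \bar R).
Proof.
move=> h; pose H1 := @isSFinite.Build _ _ _ (Measure.sort m) (sfinite_measure_sigma_finite h).
pose H2 := @isSigmaFinite.Build _ _ _ (Measure.sort m) h.
by exists (HB.pack_for {sigma_finite_measure set X -> \bar R} (Measure.sort m) H1 H2).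
Qed.

Lemma pushforward_measure_of d d' (X : measurableType d) (Y : measurableType d')
    (m : {measure set X -> \bar R}) (f : X -> Y) : measurable_fun setT f ->
  exists m' : {measure set Y -> \bar R}, m' = pushforward m f :> (set Y -> \bar R).
Proof.
by move=> mf; exists (measure_function_pushforward__canonical__measure_function_Measure m mf).
Qed.

Definition box d (n : nat) : set 'rV[R]_d := [set x | forall i, `|x ord0 i| <= n%:R].

Lemma closed_box d n : closed (@box d n).
Proof.
have -> : @box d n = \bigcap_(i in setT) (fun x => `|x ord0 i|) @^-1` [set y | y <= n%:R].
  by apply/seteqP; split=> [x h i _|x h i]; [exact: h|exact: (h i)].
apply: closed_bigI => i _; apply: preimage_closed; [|exact: closed_le].
move=> x _; apply: (@continuous_comp _ _ _ (fun x : 'rV[R]_d => x ord0 i)).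
  exact: coord_continuous.
exact: norm_continuous.
Qed.

(** The iterated integral [vol] is a genuine measure on Borel sets: in one more dimension it is
    the image of a product measure, so Tonelli's theorem gives the measurability of the
    measures of the sections. *)
Lemma vol_measure d : exists mu : {sigma_finite_measure set (T d) -> \bar R},
  (forall A : set 'rV[R]_d, borel A -> mu A = vol A) /\ (forall n, (mu (@box d n) < +oo)%E).
Proof.
elim: d => [|d [mu [muE mufin]]].
  exists (@dirac _ (T 0) (0 : 'rV[R]_0) R); split=> [A _|n].
    by rewrite /= diracE indicE.
  by rewrite /= diracE ltry.
pose psi : measurableTypeR R * T d -> T d.+1 := fun p => row_mx (p.1%:M : 'M[R]_1) p.2.
have mpsi : measurable_fun setT psi := @measurable_row_mx d.
pose nu := pushforward (@lebesgue_measure R \x mu)%E psi.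
have nuE A : borel A -> nu A = vol A.
  move=> bA; rewrite /nu /pushforward /product_measure1 /=; apply: eq_integral => x _ /=.
  rewrite -muE.
    by congr (mu _); apply/seteqP; split=> y /=; rewrite /xsection/= inE.
  rewrite (_ : mkset _ = xsection (psi @^-1` A) x).
    by apply: (@measurable_xsection _ _ (measurableTypeR R) (T d) (psi @^-1` A) x);
      rewrite -[_ @^-1` _]setTI; exact: mpsi.
  by apply/seteqP; split=> y /=; rewrite /xsection/= inE.
have nufin n : (nu (@box d.+1 n) < +oo)%E.
  rewrite /nu /pushforward (_ : _ @^-1` _ = `[- n%:R, n%:R]%classic `*` @box d n).
    rewrite product_measure1E//; last by apply: closed_borel; exact: closed_box.
    by rewrite lte_mul_pinfty//= lebesgue_measure_itv/=; case: ifPn; rewrite ?ltry.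
  apply/seteqP; split=> -[x y] /=; rewrite /box/= forall_ordS.
    by rewrite [psi _]/(hcat x y) hcat0 in_itv/= -ler_norml => -[? h]; split=> // i; rewrite -(hcatS x).
  by rewrite [psi _]/(hcat x y) hcat0 in_itv/= -ler_norml => -[? h]; split=> // i; rewrite hcatS.
have snu : sigma_finite setT nu.
  exists (@box d.+1) => [|n]; last by split=> //; apply: closed_borel; exact: closed_box.
  apply/esym/seteqP; split=> // x _.
  exists (Num.truncn (enorm x)).+1 => // i /=.
  by apply: le_trans (coord_le_enorm _ _) _; rewrite ltW// truncnS_gt.
have [m mE] := @pushforward_measure_of _ _ _ _ (@lebesgue_measure R \x mu)%E psi mpsi.
have [|nu' nu'E] := @sigma_finite_measure_of _ _ m; first by rewrite mE.
by exists nu'; rewrite nu'E mE.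
Qed.

Lemma borelE d (A : set 'rV[R]_d) : borel A = @measurable _ (T d) A.
Proof. by []. Qed.

Lemma borelI d (A B : set 'rV[R]_d) : borel A -> borel B -> borel (A `&` B).
Proof. exact: (@measurableI _ (T d)). Qed.

Lemma borelD d (A B : set 'rV[R]_d) : borel A -> borel B -> borel (A `\` B).
Proof. exact: (@measurableD _ (T d)). Qed.

Lemma vol_ge0 d (A : set 'rV[R]_d) : borel A -> (0 <= vol A)%E.
Proof. by have [mu [muE _]] := vol_measure d; move=> bA; rewrite -muE. Qed.

Lemma le_vol d (A B : set 'rV[R]_d) : borel A -> borel B -> A `<=` B -> (vol A <= vol B)%E.
Proof.
have [mu [muE _]] := vol_measure d; move=> bA bB AB; rewrite -!muE//.
by apply: le_measure => //; rewrite inE.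
Qed.

Lemma vol_split d (A B : set 'rV[R]_d) : borel A -> borel B -> A `<=` B ->
  vol B = (vol A + vol (B `\` A))%E.
Proof.
have [mu [muE _]] := vol_measure d; move=> bA bB AB; rewrite -!muE//; last exact: borelD.
rewrite -measureU ?setDUK//; first by exact: (@measurableD _ (T d)).
by rewrite setDE setIA setIC setIA setICl set0I.
Qed.

Lemma sum_vol_le d (I : eqType) (s : seq I) (F : I -> set 'rV[R]_d) (B : set 'rV[R]_d) :
  uniq s -> borel B -> (forall i, i \in s -> borel (F i) /\ F i `<=` B) ->
  (forall i j, i \in s -> j \in s -> F i `&` F j !=set0 -> i = j) ->
  (\sum_(i <- s) vol (F i) <= vol B)%E.
Proof.
elim: s B => [|i s IH] B; first by rewrite big_nil => _ bB _ _; exact: vol_ge0.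
rewrite big_cons => /= /andP[iNs us] bB FB trF.
have [bFi FiB] := FB i (mem_head _ _).
rewrite (vol_split bFi bB FiB); apply: leeD => //; apply: IH => //.
- exact: borelD.
- move=> j js; have [bFj FjB] := FB j (mem_behead (s := i :: s) js); split=> // x Fjx.
  split; first exact: FjB.
  move=> Fix; move: iNs; suff -> : i = j by rewrite js.
  by apply: trF; rewrite ?mem_head ?in_cons ?js ?orbT//; exists x.
- by move=> j k js ks; apply: trF; rewrite in_cons ?js ?ks orbT.
Qed.

Lemma vol_box_fin d n (A : set 'rV[R]_d) : borel A -> A `<=` box n -> vol A \is a fin_num.
Proof.
have [mu [muE mufin]] := vol_measure d; move=> bA AB.
rewrite ge0_fin_numE ?vol_ge0//; apply: le_lt_trans (mufin n).
rewrite muE; last by apply: closed_borel; exact: closed_box.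
by apply: le_vol => //; apply: closed_borel; exact: closed_box.
Qed.

Definition hsection d (A : set 'rV[R]_d.+1) (x : R) : set 'rV[R]_d := [set y | A (hcat x y)].

Lemma volS d (A : set 'rV[R]_d.+1) :
  vol A = (\int[@lebesgue_measure R]_x vol (hsection A x))%E.
Proof. by []. Qed.

Lemma hsectionE d (A : set 'rV[R]_d.+1) x :
  hsection A x =
  xsection ((fun p : R * 'rV[R]_d => row_mx (p.1%:M : 'M[R]_1) p.2) @^-1` A) x.
Proof. by apply/seteqP; split=> y /=; rewrite /xsection/= inE. Qed.

Lemma measurable_row_preimage d (A : set 'rV[R]_d.+1) : borel A ->
  measurable ((fun p : measurableTypeR R * T d => row_mx (p.1%:M : 'M[R]_1) p.2) @^-1` A).
Proof. by move=> bA; rewrite -[_ @^-1` _]setTI; exact: measurable_row_mx. Qed.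

Lemma borel_hsection d (A : set 'rV[R]_d.+1) x : borel A -> borel (hsection A x).
Proof.
move=> bA; rewrite hsectionE borelE.
by apply: (@measurable_xsection _ _ (measurableTypeR R) (T d)); exact: measurable_row_preimage.
Qed.

Lemma measurable_vol_hsection d (A : set 'rV[R]_d.+1) : borel A ->
  measurable_fun [set: measurableTypeR R] (fun x => vol (hsection A x) : \bar R).
Proof.
have [mu [muE _]] := vol_measure d; move=> bA.
rewrite (_ : (fun _ => _) = mu \o xsection ((fun p : measurableTypeR R * T d =>
   row_mx (p.1%:M : 'M[R]_1) p.2) @^-1` A)).
  by apply: measurable_fun_xsection; exact: measurable_row_preimage.
by apply/funext => x /=; rewrite -hsectionE muE//; exact: borel_hsection.
Qed.

(** Lebesgue measure is determined by its values on intervals, where the identity is a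
    computation. *)
Lemma lebesgue_affine (c a : R) (A : set (measurableTypeR R)) : 0 < c -> measurable A ->
  lebesgue_measure ((fun x => c^-1 * (x - a)) @^-1` A) = (c%:E * lebesgue_measure A)%E.
Proof.
move=> c0 mA.
pose phi : measurableTypeR R -> measurableTypeR R := fun x => c^-1 * (x - a).
have mphi : measurable_fun setT phi.
  by apply: measurable_funM => //; apply: measurable_funB => //.
have [m mE] := pushforward_measure_of (@lebesgue_measure R) mphi.
have ci0 : 0 <= c^-1 by rewrite invr_ge0 ltW.
have : lebesgue_measure A = mscale (NngNum ci0) m A.
  apply: lebesgue_measure_unique => // _ [[x y] _ <-] /=.
  rewrite /mscale/= mE /pushforward /=.
  rewrite (_ : _ @^-1` _ = `](a + c * x), (a + c * y)]%classic); last first.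
    apply/seteqP; split=> z /=; rewrite !in_itv/= /phi !ltr_pdivlMl// !ler_pdivrMl//; lra.
  rewrite !lebesgue_measure_itv/= !lte_fin ltrD2l ltr_pM2l//; case: ifPn => _; last by rewrite mule0.
  by rewrite -!EFinD -EFinM; congr EFin; field; rewrite gt_eqF.
rewrite /mscale/= mE => ->.
by rewrite muleA -EFinM mulfV ?gt_eqF// mul1e.
Qed.

Lemma integral_affine (F : measurableTypeR R -> \bar R) (c a : R) : 0 < c ->
  measurable_fun setT F -> (forall x, 0 <= F x)%E ->
  (\int[@lebesgue_measure R]_x F (c^-1 * (x - a))%R =
   c%:E * \int[@lebesgue_measure R]_x F x)%E.
Proof.
move=> c0 mF F0.
pose phi : measurableTypeR R -> measurableTypeR R := fun x => c^-1 * (x - a).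
have mphi : measurable_fun setT phi.
  by apply: measurable_funM => //; apply: measurable_funB => //.
transitivity (\int[pushforward (@lebesgue_measure R) phi]_x F x)%E.
  by rewrite ge0_integral_pushforward.
have c0' := ltW c0.
rewrite (@eq_measure_integral _ _ _ setT (mscale (NngNum c0') (@lebesgue_measure R))).
  by rewrite ge0_integral_mscale.
by move=> A mA _; exact: lebesgue_affine.
Qed.

(** By induction on the dimension, with a change of variables in the outer integral. *)
Lemma vol_affine d (c : R) (v : 'rV[R]_d) (A : set 'rV[R]_d) : 0 < c -> borel A ->
  vol [set x | A (c^-1 *: (x - v))] = ((c ^+ d)%:E * vol A)%E.
Proof.
move=> c0; elim: d v A => [|d IH] v A bA.
  by rewrite /= expr0 mul1e; congr EFin; rewrite /= !indicE; congr (_%:R); congr (_ \in _);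
     apply/seteqP; split => x /=; rewrite [_ *: _]thinmx0 [x]thinmx0.
have E n (u w : 'rV[R]_n) i : (c^-1 *: (u - w)) ord0 i = c^-1 * (u ord0 i - w ord0 i).
  by rewrite !mxE.
rewrite volS.
pose v' : 'rV[R]_d := \row_i v ord0 (lift ord0 i).
transitivity (\int[@lebesgue_measure R]_x
    ((c ^+ d)%:E * vol (hsection A (c^-1 * (x - v ord0 ord0)))))%E.
  apply: eq_integral => x _; rewrite -(IH v'); last exact: borel_hsection.
  congr vol; apply/seteqP; split=> y /=; rewrite /hsection/= (_ : hcat _ (_ *: _) =
    c^-1 *: (hcat x y - v))//;
    apply/rowP; apply/forall_ordS; rewrite hcat0 E hcat0; split=> // i;
    by rewrite hcatS !E hcatS mxE.
rewrite (@integral_affine (fun x => (c ^+ d)%:E * vol (hsection A x))%E)//.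
- rewrite ge0_integralZl//.
  + by rewrite muleA -EFinM -exprS.
  + exact: measurable_vol_hsection.
  + by move=> x _; apply: vol_ge0; exact: borel_hsection.
  + by rewrite lee_fin exprn_ge0// ltW.
- apply: measurable_funeM; exact: measurable_vol_hsection.
- by move=> x; rewrite mule_ge0 ?lee_fin ?exprn_ge0 ?(ltW c0)//; apply: vol_ge0; exact: borel_hsection.
Qed.

(** Half-open, so that the cubes of a grid are disjoint. *)
Definition cube d (a : 'rV[R]_d) (h : R) : set 'rV[R]_d :=
  [set x | forall i, a ord0 i <= x ord0 i < a ord0 i + h].

Lemma borel_cube d (a : 'rV[R]_d) h : borel (cube a h).
Proof.
have bcoord i : borel [set x : 'rV[R]_d | a ord0 i <= x ord0 i < a ord0 i + h].
  rewrite (_ : [set x | _] = (fun x : 'rV[R]_d => x ord0 i) @^-1` [set y | a ord0 i <= y] `\`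
    (fun x : 'rV[R]_d => x ord0 i) @^-1` [set y | a ord0 i + h <= y]).
    apply: borelD; apply: closed_borel; apply: preimage_closed;
      by [move=> ? _; exact: coord_continuous|exact: closed_ge].
  apply/seteqP; split=> x /=; first by move=> /andP[-> /lt_geF ->].
  by move=> [-> /negP]; rewrite ltNge.
rewrite (_ : cube a h = \bigcap_(i in setT) [set x | a ord0 i <= x ord0 i < a ord0 i + h]).
  apply: (@fin_bigcap_measurable _ (T d)) => // i _; exact: bcoord.
by apply/seteqP; split=> [x xa i _|x xa i]; exact: xa.
Qed.

Lemma vol_set0 d : vol (set0 : set 'rV[R]_d) = 0%E.
Proof.
have [mu [muE _]] := vol_measure d; rewrite -muE ?measure0//.
by rewrite borelE; exact: measurable0.
Qed.

Lemma vol_cube d (a : 'rV[R]_d) h : 0 <= h -> vol (cube a h) = (h ^+ d)%:E.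
Proof.
move=> h0; elim: d a => [|d IH] a.
  by rewrite /= expr0 indicE mem_set// => -[].
rewrite volS.
pose I := `[a ord0 ord0, a ord0 ord0 + h[%classic.
have mI : measurable (I : set (measurableTypeR R)) by exact: measurable_itv.
pose a' : 'rV[R]_d := \row_i a ord0 (lift ord0 i).
transitivity (\int[@lebesgue_measure R]_x ((h ^+ d)%:E * (\1_I x)%:E))%E.
  apply: eq_integral => x _; rewrite indicE.
  have [/set_mem|/negP] := boolP (x \in I).
    rewrite /I/= in_itv/= => xI; rewrite mule1 -(IH a'); congr vol.
    apply/seteqP; split=> y; rewrite /hsection/cube/= forall_ordS hcat0.
      by move=> [_ yA] i; move: (yA i); rewrite hcatS mxE.
    by move=> yA; split=> // i; move: (yA i); rewrite hcatS mxE.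
  rewrite inE /I/= in_itv/= => xI; rewrite mule0 -(vol_set0 d); congr vol.
  by apply/seteqP; split=> y //; rewrite /hsection/cube/= forall_ordS hcat0 => -[].
rewrite ge0_integralZl//; last by rewrite lee_fin exprn_ge0.
  rewrite integral_indic ?setIT// /I/= lebesgue_measure_itv/= lte_fin ltrDl.
  have [h1|h1] := ltP 0 h; first by rewrite -EFinD -EFinM addrAC subrr add0r exprSr.
  by rewrite mule0 (_ : h = 0) ?exprS ?mul0r//; apply/eqP; rewrite eq_le h0 h1.
by apply/measurable_EFinP; exact: measurable_indic.
Qed.

Definition eball d (v : 'rV[R]_d) (r : R) : set 'rV[R]_d := [set x | enorm (x - v) <= r].

Lemma borel_eball d (v : 'rV[R]_d) r : borel (eball v r).
Proof. by apply: closed_borel; exact: closed_enorm_ball. Qed.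

Lemma unit_ballE d : [set x : 'rV[R]_d | enorm x <= 1] = eball 0 1.
Proof. by apply/seteqP; split=> x; rewrite /eball/= subr0. Qed.

Lemma vol_unit_ball d : vol [set x : 'rV[R]_d | enorm x <= 1] = (unit_ball_volume R d)%:E.
Proof.
rewrite /unit_ball_volume fineK//; apply: (@vol_box_fin _ 1).
  by rewrite unit_ballE; exact: borel_eball.
by move=> x /= x1 i; apply: le_trans x1; exact: coord_le_enorm.
Qed.

Lemma unit_ball_volume_gt0 d : 0 < unit_ball_volume R d.
Proof.
have e0 : 0 < d.+1%:R^-1 :> R by rewrite invr_gt0.
rewrite -lte_fin -vol_unit_ball; apply: (@lt_le_trans _ _ (vol (cube (0 : 'rV[R]_d) d.+1%:R^-1))).
  by rewrite vol_cube ?ltW// lte_fin exprn_gt0.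
apply: le_vol.
- exact: borel_cube.
- by rewrite unit_ballE; exact: borel_eball.
move=> x /= xc; apply: (@le_trans _ _ (d%:R * d.+1%:R^-1)).
  apply: enorm_le_coord => i; have := xc i; rewrite mxE add0r => /andP[x0 x1].
  by rewrite ger0_norm// ltW.
by rewrite ler_pdivrMr ?mul1r ?ler_nat.
Qed.

Lemma vol_eball d (v : 'rV[R]_d) r : 0 < r ->
  vol (eball v r) = (unit_ball_volume R d * r ^+ d)%:E.
Proof.
move=> r0; rewrite (_ : eball v r = [set x | [set x | enorm x <= 1] (r^-1 *: (x - v))]).
  rewrite (@vol_affine _ _ _ [set x | enorm x <= 1])//.
    by rewrite vol_unit_ball -EFinM mulrC.
  by rewrite unit_ballE; exact: borel_eball.
apply/seteqP; split=> x; rewrite /eball/= enormZ gtr0_norm ?invr_gt0//;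
  by rewrite ler_pdivrMl// mulr1.
Qed.

Lemma convex_setP d (A : set 'rV[R]_d) : convex_set A ->
  forall (x y : 'rV[R]_d) s, 0 <= s <= 1 -> A x -> A y -> A (s *: x + (1 - s) *: y).
Proof.
move=> cA x y s /andP[s0 s1] Ax Ay.
pose l : {i01 R} := Itv01 s0 s1.
by have /set_mem := cA x y l (mem_set Ax) (mem_set Ay).
Qed.

(** Otherwise [F] would vanish outside one point, and its integral would be zero. *)
Lemma two_positive_points (F : R -> \bar R) : measurable_fun [set: measurableTypeR R] F ->
  (forall x, 0 <= F x)%E -> (0 < \int[@lebesgue_measure R]_x F x)%E ->
  exists x y : R, [/\ x < y, (0 < F x)%E & (0 < F y)%E].
Proof.
move=> mF F0 intF; apply: contrapT => nex.
suff F_ae0 : exists x0, forall x, x != x0 -> F x = 0%E.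
  have [x0 Fx0] := F_ae0.
  move: intF; rewrite (ae_eq_integral (cst 0%E))// ?integral0 ?ltxx//.
  exists [set x0]; split => //; first exact: lebesgue_measure_set1.
  move=> x /= /not_implyP[_ /eqP Fx]; apply: contrapT => /eqP xx0.
  by move: Fx; rewrite Fx0 ?eqxx.
have [[x0 Fx0]|no] := pselect (exists x0, (0 < F x0)%E); last first.
  exists 0 => x _; apply/eqP; rewrite eq_le F0 andbT leNgt; apply/negP => Fx.
  by apply: no; exists x.
exists x0 => x xx0; apply/eqP; rewrite eq_le F0 andbT leNgt; apply/negP => Fx; apply: nex.
by move: xx0; rewrite neq_lt => /orP[xx0|xx0]; [exists x, x0|exists x0, x].
Qed.

(** A convex set of positive volume has two sections of positive volume, which by induction
    contain cubes; sliding one cube linearly to the other stays inside the set, and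
    the middle part of this tube contains a smaller cube. *)
Lemma convex_contains_cube d (A : set 'rV[R]_d) : borel A -> convex_set A -> (0 < vol A)%E ->
  exists (a : 'rV[R]_d) (h : R), 0 < h /\
    [set x : 'rV[R]_d | forall i, `|x ord0 i - a ord0 i| <= h] `<=` A.
Proof.
move=> bA /convex_setP; elim: d A bA => [|d IH] A bA cA.
  rewrite /= indicE; have [/set_mem A0 _|] := boolP (0 \in A); last by rewrite ltxx.
  by exists 0, 1; split=> // x _; rewrite [x]thinmx0.
rewrite volS => /two_positive_points[||x1 [x2 [x12 F1 F2]]].
- exact: measurable_vol_hsection.
- by move=> x; apply: vol_ge0; exact: borel_hsection.
have cS x : forall y z s, 0 <= s <= 1 -> hsection A x y -> hsection A x z ->
    hsection A x (s *: y + (1 - s) *: z).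
  move=> y z s s01 Ay Az; rewrite /hsection/=.
  rewrite (_ : hcat x _ = s *: hcat x y + (1 - s) *: hcat x z); first exact: cA.
  have E n (u w : 'rV[R]_n) i : (s *: u + (1 - s) *: w) ord0 i =
    s * u ord0 i + (1 - s) * w ord0 i by rewrite !mxE.
  by apply/rowP/forall_ordS; rewrite E !hcat0; split=> [|i]; [ring|rewrite E !hcatS E].
have [a1 [h1 [h10 A1]]] := IH _ (borel_hsection x1 bA) (cS x1) F1.
have [a2 [h2 [h20 A2]]] := IH _ (borel_hsection x2 bA) (cS x2) F2.
pose h := Num.min h1 h2; pose M := enorm (a1 - a2) + 1.
have M0 : 0 < M by rewrite ltr_wpDl ?enorm_ge0.
have h0 : 0 < h by rewrite lt_min h10 h20.
have D0 : 0 < x2 - x1 by rewrite subr_gt0.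
pose e := Num.min (h / 2) (Num.min ((x2 - x1) * h / (2 * M)) ((x2 - x1) / 2)).
exists (hcat ((x1 + x2) / 2) (2^-1 *: (a1 + a2))), e; split.
  by rewrite !lt_min !divr_gt0 ?mulr_gt0.
move=> z /= /forall_ordS[]; rewrite hcat0 => z0 zS.
pose x := z ord0 ord0; pose y : 'rV[R]_d := \row_i z ord0 (lift ord0 i).
have -> : z = hcat x y.
  by apply/rowP/forall_ordS; rewrite hcat0; split=> // i; rewrite hcatS mxE.
pose s := (x2 - x) / (x2 - x1).
have xE : x = s * x1 + (1 - s) * x2 by rewrite /s; field; rewrite gt_eqF.
have sE : s - 2^-1 = ((x1 + x2) / 2 - x) / (x2 - x1) by rewrite /s; field; rewrite gt_eqF.
have s_e : `|s - 2^-1| <= e / (x2 - x1).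
  by rewrite sE normrM distrC normfV (gtr0_norm D0) ler_pM2r ?invr_gt0.
have s01 : 0 <= s <= 1.
  have : `|s - 2^-1| <= 2^-1.
    apply: le_trans s_e _; rewrite ler_pdivrMr// mulrC.
    by rewrite /e !ge_min lexx !orbT.
  rewrite ler_norml; lra.
have sM : `|s - 2^-1| * M <= h / 2.
  apply: le_trans (ler_wpM2r (ltW M0) s_e) _.
  rewrite mulrAC ler_pdivrMr// -ler_pdivlMr// (_ : _ / M = (x2 - x1) * h / (2 * M)).
    by rewrite /e !ge_min lexx !orbT.
  by field; rewrite gt_eqF.
pose w : 'rV[R]_d := y - (s *: a1 + (1 - s) *: a2).
have wh i : `|w ord0 i| <= h.
  have -> : w ord0 i = (z ord0 (lift ord0 i) - (2^-1 *: (a1 + a2)) ord0 i) +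
       (2^-1 - s) * (a1 - a2) ord0 i by rewrite /w /y !mxE; field.
  rewrite [h]splitr (le_trans (ler_normD _ _))// lerD//.
    by have := zS i; rewrite hcatS => /le_trans -> //; rewrite /e ge_min lexx.
  apply: le_trans sM; rewrite normrM distrC ler_wpM2l//.
  by apply: le_trans (coord_le_enorm _ _) _; rewrite lerDl.
have -> : hcat x y = s *: hcat x1 (a1 + w) + (1 - s) *: hcat x2 (a2 + w).
  have E n (u u' : 'rV[R]_n) i : (s *: u + (1 - s) *: u') ord0 i =
    s * u ord0 i + (1 - s) * u' ord0 i by rewrite !mxE.
  apply/rowP/forall_ordS; rewrite E !hcat0; split=> // i; rewrite E !hcatS.
  by rewrite /w !mxE; ring.
apply: cA => //.
  by apply: A1 => i; rewrite /= mxE addrAC subrr add0r (le_trans (wh i))// /h ge_min lexx.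
by apply: A2 => i; rewrite /= mxE addrAC subrr add0r (le_trans (wh i))// /h ge_min lexx orbT.
Qed.

End borel_vol.

(** * A discrete Brunn-Minkowski inequality *)

Lemma seq_has_max (K : realDomainType) (s : seq K) (x0 : K) : x0 \in s ->
  exists2 m, m \in s & forall x, x \in s -> x <= m.
Proof.
elim: s x0 => // y [|z s] IH x0 _.
  by exists y; rewrite ?mem_head// => x; rewrite inE => /eqP ->.
have [m ms mmax] := IH z (mem_head _ _).
have [ym|my] := leP y m.
  by exists m; [exact: mem_behead|] => x; rewrite in_cons => /predU1P[->//|]; exact: mmax.
exists y; rewrite ?mem_head// => x; rewrite in_cons => /predU1P[->//|/mmax xm].
exact: le_trans xm (ltW my).
Qed.

Lemma seq_has_min (K : realDomainType) (s : seq K) (x0 : K) : x0 \in s ->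
  exists2 m, m \in s & forall x, x \in s -> m <= x.
Proof.
move=> x0s; have [|m ms mmax] := @seq_has_max _ [seq - x | x <- s] (- x0); first exact: map_f.
exists (- m); first by case/mapP: ms => x xs ->; rewrite opprK.
by move=> x xs; rewrite lerNl; apply: mmax; exact: map_f.
Qed.

Section level_sets.
Variable R : realDomainType.
Implicit Types s t : seq R.

(** Layer-cake comparison: the greatest term of [s] is dominated by some term of [t], and
    removing this pair of terms keeps the hypothesis on the counts. *)
Lemma sum_le_of_count s t : all (fun x => 0 <= x) s -> all (fun x => 0 <= x) t ->
  (forall l : R, 0 < l -> (count (fun x => (l <= x)%R) s <= count (fun x => (l <= x)%R) t)%N) ->
  \sum_(x <- s) x <= \sum_(x <- t) x.
Proof.
have [n] := ubnP (size s); elim: n s t => // n IH s t.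
case: s => [|x0 s0] sn s_ge0 t_ge0 h.
  by rewrite big_nil big_seq sumr_ge0// => x xt; exact: (allP t_ge0).
set s := x0 :: s0 in sn s_ge0 h *.
have [m ms mmax] := seq_has_max (mem_head x0 s0).
have [m0|m0] := leP m 0.
  apply: (@le_trans _ _ 0).
    by rewrite big_seq sumr_le0// => x xs; apply: le_trans m0; exact: mmax.
  by rewrite big_seq sumr_ge0// => x xt; exact: (allP t_ge0).
have /hasP[y yt my] : has (fun x => m <= x) t.
  rewrite has_count; apply: leq_trans (h _ m0); rewrite -has_count.
  by apply/hasP; exists m.
rewrite (perm_big _ (perm_to_rem ms)) (perm_big _ (perm_to_rem yt)) !big_cons.
apply: lerD => //; apply: IH.
- by rewrite size_rem.
- by apply/allP => x /mem_rem; exact: (allP s_ge0).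
- by apply/allP => x /mem_rem; exact: (allP t_ge0).
move=> l l0; have [lm|lm] := leP l m.
  have := h l l0; rewrite (permP (perm_to_rem ms)) (permP (perm_to_rem yt)) /=.
  by rewrite lm (le_trans lm my) !add1n ltnS.
rewrite (_ : count _ _ = 0%N)//; apply/eqP; rewrite -leqn0 leqNgt -has_count.
by apply/hasP => -[x /mem_rem /mmax xm lx]; have := lt_le_trans lm lx; rewrite ltNge xm.
Qed.

End level_sets.

(** The translate of [A] by the least element of [B] lies to the left of the translate of
    [B] by one more than the greatest element of [A]. *)
Lemma card_sumset_int (A B C : {fset int}) : A != fset0 -> B != fset0 ->
  (forall a b, a \in A -> b \in B -> a + b \in C /\ a + b + 1 \in C) ->
  (#|` A| + #|` B| <= #|` C|)%N.
Proof.
move=> /fset0Pn[a0 a0A] /fset0Pn[b0 b0B] h.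
have [am amA amax] := seq_has_max a0A; have [bm bmB bmin] := seq_has_min b0B.
pose U : {fset int} := [fset (x + bm)%R | x in A]%fset.
pose V : {fset int} := [fset (am + y + 1)%R | y in B]%fset.
have cU : #|` U| = #|` A| by apply: card_imfset => x y; exact: addIr.
have cV : #|` V| = #|` B| by apply: card_imfset => x y /addIr /addrI.
have UV : (U `&` V)%fset = fset0.
  apply/eqP; rewrite -fsubset0; apply/fsubsetP => z; rewrite inE => /andP[].
  move=> /imfsetP[x /= xA ->] /imfsetP[y /= yB].
  have := amax x xA; have := bmin y yB; lia.
rewrite -cU -cV -cardfsUI UV cardfs0 addn0; apply: fsubset_leq_card.
rewrite fsubUset; apply/andP; split; apply/fsubsetP => z /imfsetP[x /= xX ->].
  by have [] := h x bm xX bmB.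
by have [] := h am x amA xX.
Qed.

Lemma card_fset_filter (K : choiceType) (X : {fset K}) (P : pred K) :
  #|` [fset x in X | P x]%fset| = count P X.
Proof. by rewrite card_fset_sum1 -sum1_count -big_fset_condE. Qed.

Section prekopa.
Variable R : rcfType.

(** Divided by their maxima, [f] and [g] have nonempty level sets at exactly the levels up
    to one, so [card_sumset_int] bounds the level sets of the normalized [h] from below, and
    [sum_le_of_count] passes from level sets to sums. The inequality of arithmetic and
    geometric means then turns the sum of the two normalized totals into their product. *)
Lemma prekopa_leindler_int (X Y Z : {fset int}) (f g h : int -> R) :
  (forall x, 0 <= f x) -> (forall x, 0 <= g x) -> (forall x, 0 <= h x) ->
  (forall x y z, x \in X -> y \in Y -> z = x + y \/ z = x + y + 1 ->
     z \in Z /\ f x * g y <= h z ^+ 2) ->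
  4 * (\sum_(x <- X) f x) * (\sum_(y <- Y) g y) <= (\sum_(z <- Z) h z) ^+ 2.
Proof.
move=> f0 g0 h0 fgh.
have sumf0 : 0 <= \sum_(x <- X) f x by apply: sumr_ge0.
have sumg0 : 0 <= \sum_(y <- Y) g y by apply: sumr_ge0.
have trivf : \sum_(x <- X) f x <= 0 ->
    4 * (\sum_(x <- X) f x) * (\sum_(y <- Y) g y) <= (\sum_(z <- Z) h z) ^+ 2.
  by move=> f_le0; rewrite (_ : \sum_(x <- X) f x = 0) ?mulr0 ?mul0r ?sqr_ge0//;
    apply/eqP; rewrite eq_le f_le0.
have trivg : \sum_(x <- Y) g x <= 0 ->
    4 * (\sum_(x <- X) f x) * (\sum_(y <- Y) g y) <= (\sum_(z <- Z) h z) ^+ 2.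
  by move=> g_le0; rewrite (_ : \sum_(x <- Y) g x = 0) ?mulr0 ?sqr_ge0//; apply/eqP; rewrite eq_le g_le0.
have [X0|/fset0Pn[x0 x0X]] := eqVneq X fset0.
  by apply: trivf; rewrite X0 big_seq_fset0.
have [Y0|/fset0Pn[y0 y0Y]] := eqVneq Y fset0.
  by apply: trivg; rewrite Y0 big_seq_fset0.
have [_ /mapP[xm xmX ->] Fmax] := seq_has_max (map_f f x0X).
have [_ /mapP[ym ymY ->] Gmax] := seq_has_max (map_f g y0Y).
have {}Fmax x : x \in X -> f x <= f xm by move=> xX; apply: Fmax; exact: map_f.
have {}Gmax x : x \in Y -> g x <= g ym by move=> xX; apply: Gmax; exact: map_f.
have [F_le0|Fgt0] := leP (f xm) 0.
  by apply: trivf; rewrite big_seq sumr_le0// => x xX; apply: le_trans F_le0; exact: Fmax.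
have [G_le0|Ggt0] := leP (g ym) 0.
  by apply: trivg; rewrite big_seq sumr_le0// => x xX; apply: le_trans G_le0; exact: Gmax.
set F := f xm in Fmax Fgt0; set G := g ym in Gmax Ggt0.
pose K := Num.sqrt (F * G).
have Kgt0 : 0 < K by rewrite sqrtr_gt0 mulr_gt0.
have K2 : K ^+ 2 = F * G by rewrite sqr_sqrtr// ltW// mulr_gt0.
have main : (\sum_(x <- X) f x) / F + (\sum_(y <- Y) g y) / G <= (\sum_(z <- Z) h z) / K.
  rewrite !mulr_suml.
  have := @sum_le_of_count R ([seq f x / F | x <- X] ++ [seq g y / G | y <- Y])
    [seq h z / K | z <- Z].
  rewrite big_cat !big_map; apply.
  - rewrite all_cat; apply/andP; split; apply/allP => _ /mapP[x _ ->]; by rewrite divr_ge0// ltW.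
  - by apply/allP => _ /mapP[x _ ->]; rewrite divr_ge0// ltW.
  move=> l l0; rewrite count_cat !count_map.
  have [l1|l1] := ltP 1 l.
    rewrite (eq_in_count (a2 := pred0)) ?count_pred0; last first.
      move=> x xX /=; apply/negbTE; rewrite -ltNge ltr_pdivrMr//; apply: le_lt_trans (Fmax _ xX) _.
      by rewrite -ltr_pdivrMr ?divff// gt_eqF.
    rewrite (eq_in_count (a2 := pred0)) ?count_pred0// => x xX /=.
    apply/negbTE; rewrite -ltNge ltr_pdivrMr//; apply: le_lt_trans (Gmax _ xX) _.
    by rewrite -ltr_pdivrMr ?divff// gt_eqF.
  rewrite -!card_fset_filter; apply: card_sumset_int.
  - by apply/fset0Pn; exists xm; rewrite !inE /= xmX/= divff ?gt_eqF.
  - by apply/fset0Pn; exists ym; rewrite !inE /= ymY/= divff ?gt_eqF.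
  have key x y z : x \in X -> l <= f x / F -> y \in Y -> l <= g y / G ->
      z = x + y \/ z = x + y + 1 -> (z \in Z) && (l <= h z / K).
    rewrite !ler_pdivlMr// => xX lx yY ly zE; have [-> fg] := fgh _ _ _ xX yY zE.
    rewrite /= -ler_sqr ?nnegrE ?mulr_ge0 ?(ltW l0) ?(ltW Kgt0)//.
    apply: le_trans fg; rewrite exprMn K2.
    have -> : l ^+ 2 * (F * G) = (l * F) * (l * G) by ring.
    by apply: ler_pM => //; rewrite mulr_ge0 ?ltW.
  move=> x y; rewrite !inE /= => /andP[xX lx] /andP[yY ly].
  by split; apply: (key x y) => //; [left|right].
set SF := \sum_(x <- X) f x in sumf0 main *; set SG := \sum_(x <- Y) g x in sumg0 main *.
set SH := \sum_(x <- Z) h x in main *.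
have u0 : 0 <= SF / F by exact: divr_ge0 sumf0 (ltW Fgt0).
have v0 : 0 <= SG / G by exact: divr_ge0 sumg0 (ltW Ggt0).
have : (SF / F + SG / G) ^+ 2 <= (SH / K) ^+ 2.
  by rewrite ler_sqr ?nnegrE ?addr_ge0//; apply: le_trans main; rewrite addr_ge0.
have : 4 * (SF / F) * (SG / G) <= (SF / F + SG / G) ^+ 2.
  by have := sqr_ge0 (SF / F - SG / G); rewrite sqrrB sqrrD; lra.
move=> /le_trans /[apply]; rewrite [leRHS]exprMn exprVn K2 ler_pdivlMr ?mulr_gt0//.
by rewrite (_ : _ * (F * G) = 4 * SF * SG)//; field; rewrite !gt_eqF.
Qed.

End prekopa.

Definition htail (K : pzRingType) d (v : 'rV[K]_d.+1) : 'rV[K]_d := \row_i v ord0 (lift ord0 i).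

Lemma hcat_htail (K : pzRingType) d (v : 'rV[K]_d.+1) : hcat (v ord0 ord0) (htail v) = v.
Proof. by apply/rowP/forall_ordS; rewrite hcat0; split=> // i; rewrite hcatS mxE. Qed.

Lemma htail_hcat (K : pzRingType) d x (v : 'rV[K]_d) : htail (hcat x v) = v.
Proof. by apply/rowP => i; rewrite /htail; rewrite mxE hcatS. Qed.

Definition fsection d (A : {fset 'rV[int]_d.+1}) (x : int) : {fset 'rV[int]_d} :=
  [fset htail a | a in [fset a : 'rV[int]_d.+1 in A | a ord0 ord0 == x]]%fset.

Definition heads d (A : {fset 'rV[int]_d.+1}) : {fset int} :=
  [fset (a : 'rV[int]_d.+1) ord0 ord0 | a in A]%fset.

Lemma mem_fsection d (A : {fset 'rV[int]_d.+1}) x y : (y \in fsection A x) = (hcat x y \in A).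
Proof.
apply/imfsetP/idP => [[a /=]|xyA].
  by rewrite !inE => /andP[aA /eqP <-] ->; rewrite hcat_htail.
by exists (hcat x y); rewrite ?htail_hcat// !inE /= xyA hcat0 eqxx.
Qed.

Lemma card_fsection d (A : {fset 'rV[int]_d.+1}) :
  #|` A| = (\sum_(x <- heads A) #|` fsection A x|)%N.
Proof.
rewrite card_fset_sum1 (partition_big_imfset _ (fun a : 'rV[int]_d.+1 => a ord0 ord0))/=.
apply: eq_bigr => x _; rewrite card_in_imfset /=.
  by rewrite card_fset_sum1 big_fset_condE.
move=> a b; rewrite !inE => /andP[_ /eqP ax] /andP[_ /eqP bx] ab.
by rewrite -(hcat_htail a) -(hcat_htail b) ax bx ab.
Qed.

(** The Brunn-Minkowski inequality in multiplicative form, with numbers of points in the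
    role of volumes; the extra summand in [{0, 1}^d] accounts for the sizes of the cubes
    that the points stand for. By induction on the dimension the numbers of points of the
    slices satisfy the hypothesis of [prekopa_leindler_int]. *)
Lemma discrete_brunn_minkowski (R : rcfType) d (A B C : {fset 'rV[int]_d}) :
  (forall a b c : 'rV[int]_d, a \in A -> b \in B ->
    (forall i, c ord0 i = a ord0 i + b ord0 i \/ c ord0 i = a ord0 i + b ord0 i + 1) ->
    c \in C) ->
  (4 ^ d * #|` A| * #|` B| <= #|` C| ^ 2)%N.
Proof.
elim: d A B C => [|d IH] A B C ABC.
  have single (S : {fset 'rV[int]_0}) : (#|` S| <= 1)%N.
    apply: (@leq_trans #|` [fset (0 : 'rV[int]_0)]%fset|); last by rewrite cardfs1.
    apply: fsubset_leq_card.
    by apply/fsubsetP => x _; rewrite inE [x]thinmx0 eqxx.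
  have [A0|/fset0Pn[a aA]] := eqVneq A fset0; first by rewrite A0 cardfs0 muln0.
  have [B0|/fset0Pn[b bB]] := eqVneq B fset0; first by rewrite B0 cardfs0 muln0.
  have c0 : 0 \in C by apply: (ABC a b) => // -[].
  have C1 : (0 < #|` C|)%N by rewrite cardfs_gt0; apply/fset0Pn; exists 0.
  have := single A; have := single B; rewrite expn0; nia.
pose w (S : {fset 'rV[int]_d.+1}) x : R := (#|` fsection S x|)%:R.
have sumw S : \sum_(x <- heads S) w S x = (#|` S|)%:R by rewrite card_fsection natr_sum.
have w0 S x : 0 <= w S x by rewrite /w.
have p0 : 0 <= 2 ^+ d :> R by rewrite exprn_ge0.
have head S x : x \in heads S -> exists y, hcat x y \in S.
  by move=> /imfsetP[a /= aS ->]; exists (htail a); rewrite hcat_htail.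
(* the factors [2 ^+ d] absorb the constant [4 ^ d] of the inequality for the slices *)
have := @prekopa_leindler_int R (heads A) (heads B) (heads C)
  (fun x => 2 ^+ d * w A x) (fun x => 2 ^+ d * w B x) (w C).
rewrite -!mulr_sumr !sumw => PL.
rewrite -(ler_nat R) (natrX _ #|` C|) natrM natrM (natrX _ 4).
rewrite (_ : _ * _ * _ = 4 * (2 ^+ d * #|` A|%:R) * (2 ^+ d * #|` B|%:R)); last first.
  by rewrite exprS (_ : 4 ^+ d = 2 ^+ d * 2 ^+ d)//; [ring|rewrite -exprMn; congr (_ ^+ _); ring].
apply: PL => [x|x|x|x y z /head[u xuA] /head[v yvB] zE]; rewrite ?mulr_ge0//.
have key (a b s : 'rV[int]_d) : hcat x a \in A -> hcat y b \in B ->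
    (forall i, s ord0 i = a ord0 i + b ord0 i \/ s ord0 i = a ord0 i + b ord0 i + 1) ->
    hcat z s \in C.
  move=> aA bB abs; apply: (ABC (hcat x a) (hcat y b)) => //.
  by apply/forall_ordS; rewrite !hcat0; split=> // i; rewrite !hcatS.
split.
  apply/imfsetP; exists (hcat z (u + v)); rewrite ?hcat0//=.
  by apply: (key u v) => // i; left; rewrite mxE.
rewrite (_ : _ * _ = 4 ^+ d * w A x * w B y); last first.
  by rewrite (_ : 4 ^+ d = 2 ^+ d * 2 ^+ d)//; [ring|rewrite -exprMn; congr (_ ^+ _); ring].
rewrite /w -(natrX _ 4) -natrM -natrM -natrX ler_nat; apply: IH => a b s.
by rewrite !mem_fsection; exact: key.
Qed.

(** * The isodiametric inequality for unions of grid cubes *)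

Section grid.
Variables (R : realType) (d : nat).
Implicit Types (h D : R) (z a b c : 'rV[int]_d) (x y : 'rV[R]_d).

Definition gridpt h z : 'rV[R]_d := \row_i (h * (z ord0 i)%:~R).

Definition gridcube h z : set 'rV[R]_d := cube (gridpt h z) h.

Definition gridindex h x : 'rV[int]_d := \row_i Num.floor (x ord0 i / h).

Lemma gridcubeP h z x : 0 < h -> gridcube h z x <-> gridindex h x = z.
Proof.
move=> h0; split=> [zx|<- i].
  apply/rowP => i; rewrite mxE; apply: floor_def; have := zx i; rewrite mxE.
  rewrite ler_pdivlMr// ltr_pdivrMr// intrD mulrDl mul1r.
  by rewrite mulrC.
rewrite !mxE; have := floor_itv (x ord0 i / h).
by rewrite intrD ler_pdivlMr// ltr_pdivrMr// mulrDl mul1r mulrC.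
Qed.

Lemma mem_gridcube h x : 0 < h -> gridcube h (gridindex h x) x.
Proof. by move=> h0; apply/gridcubeP. Qed.

(** The cubes are closed because the differences formed in [isodiametric_cubes] can reach
    the upper faces of a cube. *)
Definition near_cubes h D a b := forall x y,
  (forall i, h * (a ord0 i)%:~R <= x ord0 i <= h * (a ord0 i)%:~R + h) ->
  (forall i, h * (b ord0 i)%:~R <= y ord0 i <= h * (b ord0 i)%:~R + h) ->
  enorm (x - y) <= D.

(** A union of cubes of diameter at most [D] has at most the volume of a ball of diameter
    [D]. As for convex bodies, the proof passes to the difference set: the grid cubes with
    index in [A - A + {-1, 0}^d] consist of differences of points of the union, hence lie in
    the ball of radius [D], and by [discrete_brunn_minkowski] there are at least [2 ^ d *
    #|A|] of them. *)
Lemma isodiametric_cubes h D (A : {fset 'rV[int]_d}) : 0 < h -> 0 < D ->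
  (forall a b, a \in A -> b \in A -> near_cubes h D a b) ->
  #|` A|%:R * h ^+ d <= unit_ball_volume R d * (D / 2) ^+ d.
Proof.
move=> h0 D0 AD.
pose B : {fset 'rV[int]_d} := [fset (- a)%R | a in A]%fset.
have cardB : #|` B| = #|` A| by apply: card_imfset => x y /oppr_inj.
pose addb (p : 'rV[int]_d * 'rV[int]_d) (e : {ffun 'I_d -> bool}) : 'rV[int]_d :=
  \row_i (p.1 ord0 i + p.2 ord0 i + (e i)%:R).
pose s := [seq addb p e | p <- [seq (a, b) | a <- A, b <- B], e <- enum {: {ffun 'I_d -> bool}}].
pose C : {fset 'rV[int]_d} := [fset c in s]%fset.
have ABC : (4 ^ d * #|` A| * #|` B| <= #|` C| ^ 2)%N.
  apply: (discrete_brunn_minkowski R) => a b c aA bB abc.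
  rewrite !inE; apply/allpairsP; exists ((a, b), [ffun i => c ord0 i != a ord0 i + b ord0 i]).
  split=> /=; [exact: allpairs_f|by rewrite mem_enum|].
  apply/rowP => i; rewrite mxE ffunE /=; case: (abc i) => ->; rewrite ?eqxx ?addr0//.
  by rewrite -[X in _ != X]addr0 (inj_eq (addrI _)).
have AC : (2 ^ d * #|` A| <= #|` C|)%N.
  rewrite -leq_sqr expnMn -expnM (mulnC d) expnM.
  by move: ABC; rewrite cardB -mulnA mulnn.
pose shift c : 'rV[int]_d := \row_i (c ord0 i - 1).
have vC : (\sum_(c <- C) vol (gridcube h (shift c)) <= vol (eball (0 : 'rV[R]_d) D))%E.
  apply: sum_vol_le.
  - exact: fset_uniq.
  - exact: borel_eball.
  - move=> c; rewrite !inE => /allpairsP[[p e]] /= [/allpairsP[[a b] /= [aA /imfsetP[b' /= b'A bE] ->]] _ cE].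
    split; first exact: borel_cube.
    move=> q qc; rewrite /eball/= subr0.
    (* position of [q] relative to the corner of its cube, up to the reflection in [b] *)
    pose u i := q ord0 i - h * (a ord0 i)%:~R + h * (b' ord0 i)%:~R - h * (e i)%:R + h.
    have u01 i : 0 <= u i < h.
      have := qc i; rewrite !mxE cE /u mxE /= bE mxE !intrD !rmorphN /=.
      by case: (e i) => /=; lra.
    pose x : 'rV[R]_d := \row_i (h * (a ord0 i)%:~R + (if e i then u i else 0)).
    pose y : 'rV[R]_d := \row_i (h * (b' ord0 i)%:~R + (if e i then 0 else h - u i)).
    have -> : q = x - y.
      by apply/rowP => i; rewrite !mxE /u; case: (e i) => /=; lra.
    apply: (AD a b') => // i; rewrite mxE; have := u01 i; case: (e i); lra.
  - move=> c c' _ _ [x [xc xc']].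
    have E : shift c = shift c' by rewrite -(iffLR (gridcubeP _ _ h0) xc) -(iffLR (gridcubeP _ _ h0) xc').
    apply/rowP => i; move/rowP: E => /(_ i); rewrite !mxE.
    exact: addIr.
have cD : 0 < h ^+ d by rewrite exprn_gt0.
have : #|` C|%:R * h ^+ d <= unit_ball_volume R d * D ^+ d.
  rewrite -lee_fin -(vol_eball 0 D0); apply: le_trans vC.
  under eq_bigr do rewrite (vol_cube _ (ltW h0)).
  by rewrite sumEFin lee_fin big_const_seq count_predT iter_addr_0 mulr_natl.
rewrite exprMn exprVn mulrA ler_pdivlMr ?exprn_gt0//; apply: le_trans.
by rewrite mulrAC ler_pM2r// mulrC -natrX -natrM ler_nat.
Qed.

End grid.

(** * Poisson tails *)

Section poisson_tails.
Variable R : realType.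
Implicit Types (la s c x th : R) (n k : nat) (S : set nat).

Local Notation pois la := (poisson_prob la 0%N).

Lemma poisson_pmf_tilt la s k : 0 < la -> 0 < s ->
  s ^+ k * poisson_pmf la k = expR (la * (s - 1)) * poisson_pmf (la * s) k.
Proof.
move=> la0 s0; rewrite /poisson_pmf la0 mulr_gt0//.
rewrite (_ : - la = la * (s - 1) + - (la * s)); last by ring.
by rewrite expRD exprMn; ring.
Qed.

(** Exponential tilting: weighting the Poisson law by [s ^+ k] gives, up to a constant, the
    Poisson law of rate [la * s], whose mass is at most one. Both Chernoff bounds are
    instances. *)
Lemma poisson_tilt_le la s c S : 0 <= la -> 0 < s -> 0 < c ->
  (forall k, S k -> c <= s ^+ k) ->
  (pois la S <= (expR (la * (s - 1)) / c)%:E)%E.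
Proof.
move=> la0 s0 c0 Sc.
move: la0; rewrite le_eqVlt => /predU1P[<-|la0].
  rewrite mul0r expR0 div1r /poisson_prob ltxx diracE.
  have [/set_mem S0|_] := boolP (0%N \in S); last by rewrite lee_fin invr_ge0 ltW.
  by rewrite lee_fin -[leLHS]invr1 lef_pV2 ?posrE//; have := Sc _ S0; rewrite expr0.
have ls0 : 0 < la * s by rewrite mulr_gt0.
have mass : (pois (la * s) S <= 1)%E by apply: probability_le1.
have C0 : 0 <= expR (la * (s - 1)) / c by rewrite divr_ge0 ?expR_ge0 ?ltW.
apply: (@le_trans _ _ ((expR (la * (s - 1)) / c)%:E * pois (la * s) S)%E); last first.
  by rewrite -[leRHS]mule1 lee_wpmul2l// lee_fin.
rewrite /poisson_prob la0 ls0.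
have pmf0 (l : R) k : (0 <= (poisson_pmf l k)%:E)%E by rewrite lee_fin poisson_pmf_ge0.
rewrite -(set_mem_set S) -!nneseries_esum// -nneseriesZl//.
apply: lee_nneseries => // k /set_mem Sk; rewrite -EFinM lee_fin.
rewrite mulrAC -poisson_pmf_tilt// ler_pdivlMr//.
by rewrite mulrC ler_wpM2r ?poisson_pmf_ge0//; exact: Sc.
Qed.

Lemma poisson_upper_tail la th n : 0 <= la -> 0 <= th ->
  (pois la [set k | (n <= k)%N] <= (expR (la * (expR th - 1) - th * n%:R))%:E)%E.
Proof.
move=> la0 th0; rewrite expRD expRN.
apply: poisson_tilt_le; rewrite ?expR_gt0// => k /= nk.
by rewrite -expRM_natr ler_expR ler_wpM2l// ler_nat.
Qed.

Lemma poisson_lower_tail la x : 0 <= la -> 0 < x -> x <= 1 ->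
  (pois la [set k | (k%:R <= x * la)%R] <= (expR (- (la * H x)))%:E)%E.
Proof.
move=> la0 x0 x1.
have -> : - (la * H x) = la * (x - 1) + - (ln x * (x * la)) by rewrite /H; ring.
rewrite expRD expRN; apply: poisson_tilt_le; rewrite ?expR_gt0// => k /= kx.
rewrite -[in leRHS](lnK x0) -expRM_natr ler_expR; apply: ler_wnM2l => //.
exact: ln_le0.
Qed.

(** Stirling's bound up to a power of [n]; the induction step amounts to [(1 - 1 / m) ^+ m
    <= expR (- 1)]. *)
Lemma fact_le n : (0 < n)%N -> (n`!)%:R <= n%:R ^+ n.+1 * expR (1 - n%:R) :> R.
Proof.
elim: n => // -[|n] IH _; first by rewrite expr1n subrr expR0 mulr1.
rewrite factS natrM.
set m := n.+1 in IH *.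
have m0 : 0 < m%:R :> R by rewrite ltr0n.
have m10 : 0 < m.+1%:R :> R by rewrite ltr0n.
apply: (@le_trans _ _ (m.+1%:R * (m%:R ^+ m.+1 * expR (1 - m%:R)))).
  by rewrite ler_pM2l//; exact: IH.
rewrite [in leRHS]exprS -mulrA ler_pM2l//.
have -> : 1 - m.+1%:R = (1 - m%:R) + (-1) :> R by rewrite -[m.+1]addn1 natrD; ring.
rewrite (expRD _ (- 1)) [leRHS]mulrCA [leLHS]mulrC ler_pM2l ?expR_gt0// -ler_pdivrMl ?exprn_gt0//.
rewrite mulrC -expr_div_n.
have -> : m%:R / m.+1%:R = 1 + - m.+1%:R^-1 :> R.
  by rewrite -[in LHS](addrK 1 m%:R) -natr1 mulrDl divff ?gt_eqF// mulNr mul1r.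
apply: (@le_trans _ _ (expR (- m.+1%:R^-1) ^+ m.+1)).
  rewrite lerXn2r ?nnegrE ?expR_ge0 ?expR_ge1Dx// subr_ge0 invf_le1// ler1n//.
by rewrite -expRM_natr mulNr mulVf ?gt_eqF.
Qed.

(** The mass at the single point [n] has the right exponential order. *)
Lemma poisson_tail_ge la n : 0 < la -> (0 < n)%N ->
  ((expR (- la + n%:R * ln la - n.+1%:R * ln n%:R + n%:R - 1))%:E
     <= pois la [set k | (n <= k)%N])%E.
Proof.
move=> la0 n0; apply: (@le_trans _ _ (pois la [set n])); last first.
  by apply: le_measure; rewrite ?inE// => k /= ->.
have n0R : 0 < n%:R :> R by rewrite ltr0n.
rewrite /poisson_prob la0 esum_set1 ?lee_fin ?poisson_pmf_ge0// /poisson_pmf la0.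
rewrite (_ : expR _ = la ^+ n * (n%:R ^+ n.+1 * expR (1 - n%:R))^-1 * expR (- la)).
  rewrite ler_pM2r ?expR_gt0// ler_pM2l ?exprn_gt0// lef_pV2 ?posrE ?mulr_gt0 ?expR_gt0 ?exprn_gt0 ?ltr0n ?fact_gt0//.
  exact: fact_le.
have powE (y : R) k : 0 < y -> y ^+ k = expR (ln y * k%:R) by move=> y0; rewrite expRM_natr lnK.
rewrite (powE _ _ la0) (powE _ _ n0R) -expRD -expRN -!expRD.
by congr expR; ring.
Qed.

End poisson_tails.

(** * Faces and their measurability *)

Section faces.
Variables (R : realType) (d : nat).
Implicit Types (X s : {fset 'rV[R]_d}) (r e : R) (c : complex_kind) (A : set 'rV[R]_d).

(** The error [e] makes it possible to recognise faces from rational approximations of their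
    vertices. *)
Definition compatible c r e (p : pred 'rV[R]_d) : Prop :=
  match c with
  | VietorisRips => forall x y, p x -> p y -> enorm (x - y) <= r + e
  | Cech => exists y, forall x, p x -> enorm (x - y) <= r / 2 + e
  end.

Lemma compatible_le c r e e' (p p' : pred 'rV[R]_d) : e <= e' -> {subset p' <= p} ->
  compatible c r e p -> compatible c r e' p'.
Proof.
move=> ee' pp'; case: c => /= [h x y xp yp|[y h]].
  by apply: le_trans (h _ _ (pp' _ xp) (pp' _ yp)) _; rewrite lerD2l.
by exists y => x xp; apply: le_trans (h _ (pp' _ xp)) _; rewrite lerD2l.
Qed.

Lemma compatible_approx c r e e' (p p' : pred 'rV[R]_d) :
  (forall x, p' x -> exists2 y, p y & enorm (x - y) <= e') ->
  compatible c r e p -> compatible c r (e + 2 * e') p'.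
Proof.
move=> pp'; case: c => /= [h x y /pp'[x' px' xx'] /pp'[y' py' yy']|[y h]].
  apply: le_trans (enorm_triangle x' _ _) _.
  have := enorm_triangle y' x' y; have := h _ _ px' py'; rewrite (enormB y'); lra.
exists y => x /pp'[x' px' xx'].
apply: le_trans (enorm_triangle x' _ _) _; have := h _ px'.
have := le_trans (enorm_ge0 _) xx'; lra.
Qed.

Lemma in_complexE c X r s : (s \in complex c X r) <->
  [/\ s != fset0, (s `<=` X)%fset & compatible c r 0 (mem s)].
Proof.
rewrite inE; case: c => /=; split.
- by move=> [s0 sX h]; split=> // x y xs ys; rewrite addr0; exact: h.
- by move=> [s0 sX h]; split=> // x y xs ys; have := h x y xs ys; rewrite addr0.
- by move=> [s0 sX [y h]]; split=> //; exists y => x xs; rewrite addr0; exact: h.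
- by move=> [s0 sX [y h]]; split=> //; exists y => x xs; have := h x xs; rewrite addr0.
Qed.

Lemma compatible_Cech_VR r (p : pred 'rV[R]_d) :
  compatible Cech r 0 p -> compatible VietorisRips r 0 p.
Proof.
move=> [y h] x z xp zp; apply: le_trans (enorm_triangle y _ _) _.
by have := h _ xp; have := h _ zp; rewrite (enormB z); lra.
Qed.

(** One more than the dimension: a number of points rather than an integer. *)
Definition max_face c X r : nat := \max_(s <- fpowerset X | s \in complex c X r) #|` s|.

Lemma leq_max_face c X r n : (0 < n)%N -> (n <= max_face c X r)%N <->
  exists s, [/\ (s `<=` X)%fset, (n <= #|` s|)%N & compatible c r 0 (mem s)].
Proof.
move=> n0; split=> [|[s [sX ns sc]]].
  rewrite /max_face; set l := fpowerset X; rewrite -big_filter => h.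
  have : has (fun s => (n <= #|` s|)%N) [seq s <- l | s \in complex c X r].
    apply: contraLR h; rewrite -ltnNge => /hasPn h.
    by rewrite big_seq; elim/big_ind : _ => // [x y|s /h]; [rewrite gtn_max => -> ->|rewrite ltnNge].
  move=> /hasP[s]; rewrite mem_filter => /andP[/in_complexE[_ sX sc] _] ns.
  by exists s.
rewrite /max_face; have sin : s \in fpowerset X by rewrite fpowersetE.
have scx : s \in complex c X r.
  by apply/in_complexE; split=> //; rewrite -cardfs_gt0 (leq_trans n0).
by apply: leq_trans ns _; rewrite (big_rem s)//= scx leq_maxl.
Qed.

Lemma max_face_Cech_le X r : (max_face Cech X r <= max_face VietorisRips X r)%N.
Proof.
have [->//|n0] := posnP (max_face Cech X r).
apply/leq_max_face => //; have /(leq_max_face _ _ _ n0)[s [sX ns sc]] := leqnn (max_face Cech X r).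
by exists s; split=> //; exact: compatible_Cech_VR.
Qed.

Lemma npoints_ge X A s : (s `<=` X)%fset -> (forall x, x \in s -> A x) -> (#|` s| <= npoints X A)%N.
Proof.
move=> /fsubsetP sX sA; apply: fsubset_leq_card; apply/fsubsetP => x xs.
by rewrite !inE /= sX//= mem_set//; exact: sA.
Qed.

Lemma npointsS X A (B : set 'rV[R]_d) : A `&` [set` X] `<=` B -> (npoints X A <= npoints X B)%N.
Proof.
move=> AB; apply: npoints_ge => [|x]; first by apply/fsubsetP => x; rewrite !inE => /andP[].
by rewrite !inE => /andP[xX /set_mem Ax]; apply: AB.
Qed.

(** For the Cech complex, centres for smaller and smaller errors stay in a compact ball, and
    a cluster point of them is a centre without error. *)
Lemma compatible_lim c r s : s != fset0 ->
  (forall m, compatible c r (m.+1%:R^-1) (mem s)) -> compatible c r 0 (mem s).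
Proof.
move=> /fset0Pn[x0 x0s].
have small e : 0 < e -> exists m : nat, m.+1%:R^-1 < e :> R.
  move=> e0; have [m _ /(_ m)] := near_infty_natSinv_lt (PosNum e0).
  by move=> /(_ (leqnn m)); exists m.
case: c => /= [h x y xs ys|h].
  rewrite addr0; apply/ler_addgt0Pr => e /small[m me].
  by apply: le_trans (h m x y xs ys) _; rewrite lerD2l ltW.
pose F m : set 'rV[R]_d := [set y | forall x, x \in s -> enorm (x - y) <= r / 2 + m.+1%:R^-1].
pose y m := sval (cid (h m)).
have yF m : F m (y m) by rewrite /y; case: cid.
pose K : set 'rV[R]_d := eball x0 (r / 2 + 1).
have Kc : compact K.
  apply: bounded_closed_compact; last exact: closed_enorm_ball.
  exists (enorm x0 + (r / 2 + 1)); split; first exact: num_real.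
  move=> M hM z zK; have zx : enorm (z - x0) <= r / 2 + 1 by exact: zK.
  have zM : enorm z <= M.
    have := enorm_triangle x0 z 0; rewrite !subr0 => zx0.
    by apply: le_trans zx0 _; apply: le_trans (ltW hM); rewrite addrC lerD2l.
  rewrite /= /Num.norm/= mx_normrE; apply: bigmax_le => [|[i j] _ /=].
    exact: le_trans (enorm_ge0 _) zM.
  by rewrite (ord1 i); exact: le_trans (coord_le_enorm _ _) zM.
have yK : (y @ \oo) K.
  exists 0%N => // m _; rewrite /K/= /eball/= enormB; apply: le_trans (yF m _ x0s) _.
  by rewrite lerD2l invf_le1// ler1n.
have [z [_ zy]] := Kc (y @ \oo) _ yK.
exists z => x xs; rewrite addr0; apply/ler_addgt0Pr => e /small[m me].
have Fz : closure [set y | enorm (y - x) <= r / 2 + m.+1%:R^-1] z.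
  move=> V Vz; apply: zy => //; exists m => // k /= mk.
  rewrite enormB; apply: le_trans (yF k _ xs) _; rewrite lerD2l.
  by rewrite lef_pV2 ?posrE// ler_nat.
have := @closed_enorm_ball R d x (r / 2 + m.+1%:R^-1) z Fz.
by rewrite /= enormB => /le_trans; apply; rewrite lerD2l ltW.
Qed.

(** Expresses the size of the largest face by countably many numbers of points in fixed
    Borel sets, which makes it measurable. Conversely, if approximate faces exist at all
    scales, then one of the finitely many subsets of [X] is approximately compatible at all
    scales, and [compatible_lim] applies. *)
Lemma max_face_approx c X r n : (0 < n)%N -> (n <= max_face c X r)%N <->
  forall m : nat, exists2 q : seq 'rV[rat]_d,
    compatible c r (2 * m.+1%:R^-1) (mem [seq ratr_row R p | p <- q]) &
    (n <= npoints X [set x | exists2 p, p \in q & (enorm (x - ratr_row R p) <= m.+1%:R^-1)%R])%N.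
Proof.
move=> n0; rewrite leq_max_face//; split=> [[s [sX ns sc]] m|h].
  have me : 0 < m.+1%:R^-1 :> R by rewrite invr_gt0.
  have ap x : exists q : 'rV[rat]_d, enorm (x - ratr_row R q) <= m.+1%:R^-1.
    have e0 : 0 < m.+1%:R^-1 / d.+1%:R :> R by rewrite divr_gt0.
    have [q [_ qx]] := rat_approx_row x e0; exists q.
    apply: (@le_trans _ _ (d%:R * (m.+1%:R^-1 / d.+1%:R))).
      apply: enorm_le_coord => i; rewrite 2!mxE distrC.
      by have := qx ord0 i; rewrite /ball/= mxE => /ltW.
    by rewrite mulrA ler_pdivrMr// [leLHS]mulrC ler_pM2l// ler_nat.
  pose a x := sval (cid (ap x)).
  have aP x : enorm (x - ratr_row R (a x)) <= m.+1%:R^-1 by rewrite /a; case: cid.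
  exists [seq a x | x <- s].
    rewrite -[2 * _]add0r; apply: compatible_approx sc => _ /mapP[_ /mapP[x xs ->] ->].
    by exists x => //; rewrite enormB.
  apply: leq_trans ns _; apply: npoints_ge => // x xs.
  by exists (a x); [exact: map_f|exact: aP].
apply: contrapT => nex.
have bad s : exists m0 : nat, (s `<=` X)%fset -> (n <= #|` s|)%N ->
    forall m, (m0 <= m)%N -> ~ compatible c r (4 * m.+1%:R^-1) (mem s).
  have [[sX ns]|nS] := pselect ((s `<=` X)%fset /\ (n <= #|` s|)%N); last first.
    by exists 0%N => sX ns; exfalso; apply: nS.
  have [m0 hm0] : exists m0 : nat, ~ compatible c r (m0.+1%:R^-1) (mem s).
    apply: contrapT => hm; apply: nex; exists s; split=> //.
    apply: compatible_lim; first by rewrite -cardfs_gt0 (leq_trans n0).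
    by move=> m; apply: contrapT => hc; apply: hm; exists m.
  exists (4 * m0.+1)%N => _ _ m m0m; apply: contra_not hm0; apply: compatible_le => //.
  rewrite -[m0.+1%:R^-1]mul1r ler_pdivlMr// mulrAC ler_pdivrMr// mul1r -natrM ler_nat.
  exact: leq_trans m0m _.
pose m0 s := sval (cid (bad s)).
have m0P s m : (s `<=` X)%fset -> (n <= #|` s|)%N -> (m0 s <= m)%N ->
    ~ compatible c r (4 * m.+1%:R^-1) (mem s).
  by rewrite /m0; case: cid => /= k hk sX ns; exact: hk.
pose m := (\max_(s <- fpowerset X) m0 s)%N.
have [q qc qn] := h m.
pose s := [fset x in X | x \in [set x | exists2 p, p \in q & enorm (x - ratr_row R p) <= m.+1%:R^-1]]%fset.
have sX : (s `<=` X)%fset by apply/fsubsetP => x; rewrite !inE => /andP[].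
apply: (m0P s m) => //.
  by rewrite /m (big_rem s) ?fpowersetE//= leq_maxl.
rewrite (_ : 4 * _ = 2 * m.+1%:R^-1 + 2 * m.+1%:R^-1 :> R); last by ring.
apply: compatible_approx qc => x; rewrite !inE => /andP[_ /set_mem[p pq xp]].
by exists (ratr_row R p) => //; exact: map_f.
Qed.

End faces.

(** * Covering faces by cubes, and packing balls *)

Section cube_covers.
Variables (R : realType) (d : nat).


Lemma measure_bigcup_seq_le (dT : measure_display) (X : measurableType dT)
    (mu : {measure set X -> \bar R}) (I : eqType) (s : seq I) (F : I -> set X) :
  (forall i, measurable (F i)) ->
  (mu (\bigcup_(i in [set` s]) F i) <= \sum_(i <- s) mu (F i))%E.
Proof.
move=> mF; elim: s => [|i s IH].
  by rewrite big_nil (_ : \bigcup_(i in _) _ = set0) ?measure0//; apply/seteqP; split=> x //= [].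
rewrite big_cons (_ : \bigcup_(j in _) F j = F i `|` \bigcup_(j in [set` s]) F j).
  apply: le_trans (measureU2 _ _ _) _; [exact: mF| |exact: leeD].
  by apply: fin_bigcup_measurable => //; exact: finite_seq.
apply/seteqP; split=> x /=.
  move=> [j /=]; rewrite in_cons => /predU1P[-> Fx|js Fx]; [by left|right].
  by exists j.
move=> [Fx|[j /= js Fx]]; [exists i => //=; exact: mem_head|exists j => //=].
by rewrite in_cons js orbT.
Qed.

Lemma vol_bigcup_seq_le (I : eqType) (s : seq I) (F : I -> set 'rV[R]_d) :
  (forall i, borel (F i)) ->
  (vol (\bigcup_(i in [set` s]) F i) <= \sum_(i <- s) vol (F i))%E.
Proof.
have [mu [muE _]] := @vol_measure R d; move=> bF; rewrite -muE.
  apply: (le_trans (@measure_bigcup_seq_le _ _ mu _ s F bF)).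
  by apply: lee_sum => i _; rewrite -muE//; exact: bF.
apply: (@fin_bigcup_measurable _ (g_sigma_algebraType (@open 'rV[R]_d))) => [|i _].
  exact: finite_seq.
exact: bF.
Qed.

Lemma floor_bound (y : R) (K : nat) : `|y| < K%:R -> - K%:Z <= Num.floor y <= K%:Z.
Proof.
rewrite ltr_norml => /andP[y1 y2]; have /andP[f1 f2] := floor_itv y.
have : (Num.floor y)%:~R < (K%:Z)%:~R :> R by exact: le_lt_trans f1 y2.
have : (- K%:Z)%:~R < (Num.floor y + 1)%:~R :> R by rewrite rmorphN /=; exact: lt_trans y1 f2.
by rewrite !ltr_int; lia.
Qed.

Lemma floor_sub_bound (x y : R) (K : nat) : `|x - y| <= K%:R ->
  - K.+1%:Z <= Num.floor x - Num.floor y <= K.+1%:Z.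
Proof.
rewrite ler_norml => /andP[y1 y2]; have /andP[f1 f2] := floor_itv y; have /andP[g1 g2] := floor_itv x.
have : (Num.floor x - Num.floor y)%:~R < (K.+1%:Z)%:~R :> R.
  by move: f2; rewrite -[K.+1]addn1 PoszD !intrD rmorphN /= => f2; lra.
have : (- K.+1%:Z)%:~R < (Num.floor x - Num.floor y)%:~R :> R.
  by move: g2; rewrite -[K.+1]addn1 PoszD rmorphN !intrD rmorphN /= => g2; lra.
by rewrite !ltr_int; lia.
Qed.

(** The grid indices in a box, encoded by a finite type so that the union bound is a finite
    sum. *)
Definition centered (K : nat) (f : {ffun 'I_d -> 'I_K.*2.+1}) : 'rV[int]_d :=
  \row_i ((f i)%:Z - K%:Z).

Lemma centered_surj K (z : 'rV[int]_d) : (forall i, - K%:Z <= z ord0 i <= K%:Z) ->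
  exists f : {ffun 'I_d -> 'I_K.*2.+1}, centered f = z.
Proof.
move=> zK; exists [ffun i => inord (absz (z ord0 i + K%:Z)%R)].
apply/rowP => i; rewrite [RHS](_ : _ = z ord0 i)// mxE ffunE inordK; have := zK i; lia.
Qed.

(** A shape [p.2] placed at an anchor [p.1]. Only the number of anchors depends on the
    distance parameter; for a fixed ratio of mesh and distance the number of shapes is a
    constant. *)
Definition cubes_at K M (p : {ffun 'I_d -> 'I_K.*2.+1} * {set {ffun 'I_d -> 'I_M.*2.+1}}) :
    {fset 'rV[int]_d} := [fset (centered p.1 + centered g)%R | g in p.2]%fset.

Definition cubes_union h (A : {fset 'rV[int]_d}) : set 'rV[R]_d :=
  \bigcup_(z in [set` A]) gridcube h z.

Lemma borel_cubes_union h A : borel (cubes_union h A).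
Proof.
apply: (@fin_bigcup_measurable _ (g_sigma_algebraType (@open 'rV[R]_d))) => [|z _].
  exact: finite_seq.
exact: borel_cube.
Qed.

(** Moving both points inside their cubes changes their distance by at most twice the
    diameter of a cube. *)
Lemma near_cubes_index h r (x y : 'rV[R]_d) : 0 < h -> enorm (x - y) <= r ->
  near_cubes h (r + 2 * (d%:R * h)) (gridindex h x) (gridindex h y).
Proof.
move=> h0 xy p q hp hq.
have near (u v : 'rV[R]_d) : (forall i, h * (gridindex h u ord0 i)%:~R <= v ord0 i <=
    h * (gridindex h u ord0 i)%:~R + h) -> enorm (u - v) <= d%:R * h.
  move=> uv; apply: enorm_le_coord => i; rewrite !mxE.
  have := uv i; have := mem_gridcube u h0 i; rewrite !mxE ler_norml; lra.
have := enorm_triangle x p q; have := enorm_triangle y x q.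
have := near _ _ hp; have := near _ _ hq; rewrite (enormB p x); lra.
Qed.

End cube_covers.

Section process.
Variables (R : realType) (d : nat) (W : set 'rV[R]_d) (bW : borel W).
Variables (disp : measure_display) (Omega : measurableType disp) (P : probability Omega R).
Variables (t : R) (eta : Omega -> {fset 'rV[R]_d}).
Hypothesis pp : poisson_process P W t eta.

Lemma npoints_window w (A : set 'rV[R]_d) : npoints (eta w) A = npoints (eta w) (A `&` W).
Proof.
apply/eqP; rewrite eqn_leq; apply/andP; split; apply: npointsS => x /= [].
  by move=> Ax xw; split=> //; exact: (pp_support pp) xw.
by move=> [].
Qed.

Lemma measurable_npoints (A : set 'rV[R]_d) : borel A ->
  measurable_fun setT (fun w => npoints (eta w) A).
Proof.
move=> bA; rewrite (_ : (fun w => _) = (fun w => npoints (eta w) (A `&` W))).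
  by apply: (pp_measurable pp); [exact: borelI|exact: subIsetr].
by apply/funext => w; exact: npoints_window.
Qed.

Lemma measurable_npoints_ge (A : set 'rV[R]_d) (S : set nat) : borel A ->
  measurable [set w | S (npoints (eta w) A)].
Proof.
by move=> bA; have := measurable_npoints bA measurableT (I : measurable S); rewrite setTI.
Qed.

Lemma measurable_max_face c r : measurable_fun setT (fun w => max_face c (eta w) r).
Proof.
have mge n : measurable [set w | (n <= max_face c (eta w) r)%N].
  have [->|n0] := posnP n; first by rewrite (_ : [set _ | _] = setT)//; apply/seteqP; split.
  pose U m (q : seq 'rV[rat]_d) : set 'rV[R]_d :=
    [set x | exists2 p, p \in q & enorm (x - ratr_row R p) <= m.+1%:R^-1].
  have bU m q : borel (U m q).
    rewrite (_ : U m q = \bigcup_(p in [set` q]) eball (ratr_row R p) m.+1%:R^-1).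
      apply: (@fin_bigcup_measurable _ (g_sigma_algebraType (@open 'rV[R]_d))).
        exact: finite_seq.
      by move=> p _; exact: borel_eball.
    by apply/seteqP; split=> x [p pq xp]; exists p.
  pose E m q := [set w | compatible c r (2 * m.+1%:R^-1) (mem [seq ratr_row R p | p <- q]) /\
     (n <= npoints (eta w) (U m q))%N].
  rewrite (_ : [set w | _] = \bigcap_m \bigcup_q E m q); last first.
    apply/seteqP; split=> w /=.
      by move=> /(max_face_approx _ _ _ n0) h m _; have [q qc qn] := h m; exists q.
    move=> h; apply/(max_face_approx _ _ _ n0) => m.
    by have [q _ [qc qn]] := h m I; exists q.
  apply: bigcapT_measurable => m; apply: countable_bigcupT_measurable => // q.
  rewrite /E; have [qc|nqc] := pselect (compatible c r (2 * m.+1%:R^-1) (mem [seq ratr_row R p | p <- q])).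
    rewrite (_ : [set w | _] = [set w | [set k | (n <= k)%N] (npoints (eta w) (U m q))]).
      exact: measurable_npoints_ge.
    by apply/seteqP; split=> w /= => [[]|].
  by rewrite (_ : [set w | _] = set0)//; apply/seteqP; split=> w //= [].
have meq k : measurable [set w | max_face c (eta w) r = k].
  rewrite (_ : [set w | _] = [set w | (k <= max_face c (eta w) r)%N] `\`
      [set w | (k.+1 <= max_face c (eta w) r)%N]); first exact: measurableD.
  apply/seteqP; split=> w /=; first by move=> ->; split=> //; rewrite ltnn.
  by move=> [h1 /negP]; rewrite -leqNgt => h2; apply/eqP; rewrite eqn_leq h1 h2.
move=> _ S _; rewrite setTI (_ : _ @^-1` S = \bigcup_(k in S) [set w | max_face c (eta w) r = k]).
  exact: bigcup_measurable.
apply/seteqP; split=> [w Sw|w [k Sk /= E]]; first by exists (max_face c (eta w) r).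
by rewrite /= E.
Qed.

Lemma measurable_max_face_in c r (S : set nat) : measurable [set w | S (max_face c (eta w) r)].
Proof.
by have := @measurable_max_face c r measurableT S (I : measurable S); rewrite setTI.
Qed.

(** The anchor is the cube of one vertex; in each coordinate the other vertices are at most
    [m] mesh sizes away from this one. *)
Lemma max_face_cubes (L m n : nat) r w : W `<=` box L -> 0 < r -> (0 < m)%N -> (0 < n)%N ->
  (n <= max_face VietorisRips (eta w) r)%N ->
  exists p : {ffun 'I_d -> 'I_(Num.truncn (L%:R / (r / m%:R))).+1.*2.+1} *
             {set {ffun 'I_d -> 'I_m.+1.*2.+1}},
    {in cubes_at p &, forall a b, near_cubes (r / m%:R) (r + 2 * (d%:R * (r / m%:R))) a b} /\
    (n <= npoints (eta w) (cubes_union (r / m%:R) (cubes_at p) `&` W))%N.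
Proof.
move=> WL r0 m0 n0 /(leq_max_face _ _ _ n0)[s [sX ns sc]].
set h := r / m%:R; have mR : 0 < m%:R :> R by rewrite ltr0n.
have h0 : 0 < h by rewrite divr_gt0.
have sW x : x \in s -> W x by move=> xs; apply: (pp_support pp (w := w)); exact: (fsubsetP sX).
have /fset0Pn[x0 x0s] : s != fset0 by rewrite -cardfs_gt0 (leq_trans n0).
set K := (Num.truncn (L%:R / h)).+1.
have [a aE] : exists a : {ffun 'I_d -> 'I_K.*2.+1}, centered a = gridindex h x0.
  apply: (centered_surj (K := K)) => i; rewrite mxE; apply: floor_bound.
  rewrite normrM normfV (gtr0_norm h0); apply: le_lt_trans (_ : L%:R / h < _).
    by rewrite ler_pM2r ?invr_gt0//; exact: WL (sW _ x0s) i.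
  exact: truncnS_gt.
pose S : {set {ffun 'I_d -> 'I_m.+1.*2.+1}} :=
  [set g | gridindex h x0 + centered g \in [fset gridindex h x | x in s]%fset]%SET.
have idx x : x \in s -> gridindex h x \in cubes_at (a, S).
  move=> xs.
  have [g gE] : exists g : {ffun 'I_d -> 'I_m.+1.*2.+1}, centered g = gridindex h x - gridindex h x0.
    apply: (centered_surj (K := m.+1)) => i; rewrite !mxE; apply: floor_sub_bound.
    rewrite -mulrBl normrM normfV (gtr0_norm h0) ler_pdivrMr// /h mulrCA divff ?gt_eqF// mulr1.
    have := sc x x0 xs x0s; rewrite addr0; apply: le_trans.
    by have := coord_le_enorm (x - x0) i; rewrite !mxE.
  have E : gridindex h x = centered a + centered g by rewrite aE gE addrC subrK.
  apply/imfsetP; exists g => //=; rewrite inE -aE -E.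
  by apply/imfsetP; exists x.
exists (a, S); split.
  have back z : z \in cubes_at (a, S) -> exists2 x, x \in s & z = gridindex h x.
    by move=> /imfsetP[g /=]; rewrite inE -aE => /imfsetP[x /= xs ->] ->; exists x.
  move=> z z' /back[x xs ->] /back[y ys ->]; apply: near_cubes_index => //.
  by have := sc x y xs ys; rewrite addr0.
apply: leq_trans ns _; apply: npoints_ge => // x xs; split; last exact: sW.
by exists (gridindex h x); [exact: idx|exact: mem_gridcube].
Qed.

(** By [isodiametric_cubes] the number of points is Poisson with at most the rate of a ball
    of diameter [D]. *)
Lemma npoints_tail_le (n : nat) th h D (A : {fset 'rV[int]_d}) :
  0 <= t -> 0 <= th -> 0 < h -> 0 < D -> {in A &, forall a b, near_cubes h D a b} ->
  (P [set w | (n <= npoints (eta w) (cubes_union h A `&` W))%N] <=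
   (expR (t * (unit_ball_volume R d * (D / 2) ^+ d) * (expR th - 1) - th * n%:R))%:E)%E.
Proof.
move=> t0 th0 h0 D0 AD; set U := cubes_union h A `&` W.
have bU : borel U by apply: borelI => //; exact: borel_cubes_union.
rewrite [leLHS](pp_poisson pp bU (@subIsetr _ _ _) [set k | (n <= k)%N]).
have volU : (vol U <= (#|` A|%:R * h ^+ d)%:E)%E.
  apply: (@le_trans _ _ (vol (cubes_union h A))).
    by apply: le_vol => //; [exact: borel_cubes_union|exact: subIsetl].
  apply: le_trans (vol_bigcup_seq_le _ _) _; first by move=> z; exact: borel_cube.
  under eq_bigr do rewrite (vol_cube _ (ltW h0)).
  by rewrite sumEFin lee_fin big_const_seq count_predT iter_addr_0 mulr_natl.
have fvol : fine (vol U) <= unit_ball_volume R d * (D / 2) ^+ d.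
  apply: le_trans (isodiametric_cubes h0 D0 AD).
  rewrite -lee_fin fineK// ge0_fin_numE ?vol_ge0//.
  exact: le_lt_trans volU (ltry _).
have fvol0 : 0 <= fine (vol U) by rewrite fine_ge0// vol_ge0.
apply: (le_trans (poisson_upper_tail n (mulr_ge0 t0 fvol0) th0)).
rewrite lee_fin ler_expR lerD2r; apply: ler_wpM2r; last exact: ler_wpM2l.
by rewrite subr_ge0 -expR0 ler_expR.
Qed.

(** Union bound over all anchors and shapes. The exponent involves the rate of a ball whose
    diameter exceeds [r] only by the contribution of the mesh. *)
Lemma max_face_tail_le (L m n : nat) r th : W `<=` box L -> 0 <= t -> 0 < r -> (0 < m)%N ->
  (0 < n)%N -> 0 <= th ->
  (P [set w | (n <= max_face VietorisRips (eta w) r)%N] <=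
   (((Num.truncn (L%:R / (r / m%:R))).+1.*2.+1 ^ d * 2 ^ (m.+1.*2.+1 ^ d))%N%:R *
   expR (t * (unit_ball_volume R d * ((r + 2 * (d%:R * (r / m%:R))) / 2) ^+ d) * (expR th - 1)
     - th * n%:R))%:E)%E.
Proof.
move=> WL t0 r0 m0 n0 th0.
set K := (Num.truncn _).+1; set h := r / m%:R; set D := r + _; set E := expR _.
have h0 : 0 < h by rewrite divr_gt0// ltr0n.
have D0 : 0 < D by rewrite ltr_wpDr// !mulr_ge0// ltW.
pose I := ({ffun 'I_d -> 'I_K.*2.+1} * {set {ffun 'I_d -> 'I_m.+1.*2.+1}})%type.
pose good (p : I) := `[< {in cubes_at p &, forall a b, near_cubes h D a b} >].
(* shapes that are not small enough have to be dropped before the measures are summed *)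
pose F (p : I) := if good p then
  [set w | (n <= npoints (eta w) (cubes_union h (cubes_at p) `&` W))%N] else set0.
have mF p : measurable (F p).
  rewrite /F; case: ifP => // _.
  apply: (@measurable_npoints_ge _ [set k | (n <= k)%N]); apply: borelI => //.
  exact: borel_cubes_union.
apply: (@le_trans _ _ (P (\bigcup_(p in [set` enum {: I}]) F p))).
  apply: le_measure; rewrite ?inE.
  - exact: (@measurable_max_face_in _ _ [set k | (n <= k)%N]).
  - by apply: fin_bigcup_measurable => //; exact: finite_seq.
  move=> w /= /(max_face_cubes WL r0 m0 n0)[p [pg np]].
  by exists p; [rewrite /= mem_enum|rewrite /F /good asboolT].
apply: le_trans (measure_bigcup_seq_le _ _ mF) _.
apply: (@le_trans _ _ (\sum_(p <- enum {: I}) E%:E)%E).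
  apply: lee_sum => p _; rewrite /F; case: ifPn => [/asboolP pg|_].
    exact: npoints_tail_le.
  by rewrite measure0 lee_fin expR_ge0.
rewrite sumEFin lee_fin big_const_seq count_predT iter_addr_0 -cardE mulr_natl.
have cardS (X : finType) : #|{: {set X}}| = (2 ^ #|X|)%N.
  by rewrite -[LHS]cardsT -powersetT card_powerset cardsT.
by rewrite card_prod cardS !card_ffun !card_ord.
Qed.

(** The spacing [2 * r] exceeds the diameter [r] of the balls, and [N%:R * r <= l] keeps the
    balls inside the cube of centre [a]. *)
Definition packing_center (a : 'rV[R]_d) (l r : R) N (f : {ffun 'I_d -> 'I_N}) : 'rV[R]_d :=
  \row_i (a ord0 i - l + r + 2 * r * (f i)%:R).

Definition packing_ball (a : 'rV[R]_d) (l r : R) N (f : {ffun 'I_d -> 'I_N}) : set 'rV[R]_d :=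
  eball (packing_center a l r f) (r / 2).

Lemma packing_ball_sub (a : 'rV[R]_d) l r N (f : {ffun 'I_d -> 'I_N}) : 0 < r -> N%:R * r <= l ->
  [set x : 'rV[R]_d | forall i, `|x ord0 i - a ord0 i| <= l] `<=` W -> packing_ball a l r f `<=` W.
Proof.
move=> r0 Nl lW x xf; apply: lW => i /=.
have := le_trans (coord_le_enorm _ i) xf; rewrite !mxE !ler_norml.
have : (f i)%:R + 1 <= N%:R :> R by rewrite natr1 ler_nat.
have : 0 <= (f i)%:R :> R by [].
move: (nat_of_ord (f i))%:R => u u0 uN.
have : r * u + r <= l by apply: le_trans Nl; rewrite -[X in _ + X]mulr1 -mulrDr mulrC ler_pM2r.
have : 0 <= r * u by rewrite mulr_ge0// ltW.
by rewrite -mulrA; move: (r * u) => v; lra.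
Qed.

Lemma packing_disjoint (a : 'rV[R]_d) l r N (f g : {ffun 'I_d -> 'I_N}) : 0 < r ->
  packing_ball a l r f `&` packing_ball a l r g !=set0 -> f = g.
Proof.
move=> r0 [x [xf xg]]; apply/ffunP => i; apply/val_inj/eqP => /=.
have := le_trans (coord_le_enorm _ i) xf; have := le_trans (coord_le_enorm _ i) xg.
rewrite !mxE !ler_norml -!mulrA => gi fi.
have [fg|fg|//] := ltngtP (f i) (g i); exfalso.
  have : (f i)%:R + 1 <= (g i)%:R :> R by rewrite natr1 ler_nat.
  rewrite -(ler_pM2l r0) mulrDr mulr1; lra.
have : (g i)%:R + 1 <= (f i)%:R :> R by rewrite natr1 ler_nat.
rewrite -(ler_pM2l r0) mulrDr mulr1; lra.
Qed.

Lemma npoints_eball_le_max_face w (v : 'rV[R]_d) r :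
  (npoints (eta w) (eball v (r / 2)) <= max_face Cech (eta w) r)%N.
Proof.
have [->//|n0] := posnP (npoints (eta w) (eball v (r / 2))).
apply/leq_max_face => //.
exists [fset x in eta w | x \in eball v (r / 2)]%fset; split=> //.
  by apply/fsubsetP => x; rewrite !inE => /andP[].
by exists v => x; rewrite !inE => /andP[_ /set_mem]; rewrite addr0.
Qed.

(** The points in one ball of radius [r / 2] form a face of the Cech complex, and the
    numbers of points in the [N ^ d] disjoint balls are independent. *)
Lemma max_face_lt_le (a : 'rV[R]_d) l r N n : 0 < r -> N%:R * r <= l ->
  [set x : 'rV[R]_d | forall i, `|x ord0 i - a ord0 i| <= l] `<=` W ->
  (P [set w | (max_face Cech (eta w) r < n)%N] <=
   ((fine (poisson_prob (t * (unit_ball_volume R d * (r / 2) ^+ d)) 0%N [set k | (k < n)%N]))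
     ^+ (N ^ d))%:E)%E.
Proof.
move=> r0 Nl lW.
pose I := {ffun 'I_d -> 'I_N}; pose B (i : 'I_(#|{: I}|)) := packing_ball a l r (enum_val i).
set p := fine _.
have cardI : #|{: I}| = (N ^ d)%N by rewrite card_ffun !card_ord.
have BW i : borel (B i) /\ B i `<=` W.
  by split; [exact: borel_eball|exact: packing_ball_sub].
have Btriv : trivIset setT B.
  by move=> i j _ _ /(packing_disjoint r0); exact: enum_val_inj.
have PB i : P [set w | [set k | (k < n)%N] (npoints (eta w) (B i))] = p%:E.
  rewrite (pp_poisson pp _ (BW i).2); last exact: (BW i).1.
  rewrite /B /packing_ball vol_eball ?divr_gt0//= /p fineK//.
  exact: fin_num_measure.
have := pp_independent pp (A := B) BW Btriv (fun=> [set k | (k < n)%N]).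
under eq_bigr do rewrite PB.
rewrite prodEFin big_const card_ord iter_mulr_1 [in X in _ = X -> _]cardI => <-.
apply: le_measure; rewrite ?inE.
- exact: (@measurable_max_face_in _ _ [set k | (k < n)%N]).
- rewrite (_ : [set w | _] = \bigcap_(i in setT) [set w | [set k | (k < n)%N] (npoints (eta w) (B i))]).
    apply: fin_bigcap_measurable => // i _; apply: measurable_npoints_ge; exact: (BW i).1.
  by apply/seteqP; split=> w h i; [move=> _; exact: h|exact: (h i Logic.I)].
by move=> w /= wn i; exact: leq_ltn_trans (npoints_eball_le_max_face _ _ _) wn.
Qed.

End process.

(** * From tail asymptotics to a large deviations principle *)

Lemma limf_esup_le (R : realType) (f : R -> \bar R) (y : \bar R) :
  (\forall t \near +oo, (f t <= y)%E) -> (limf_esup f +oo%R <= y)%E.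
Proof.
move=> fy; rewrite limf_esupE; apply: le_trans (_ : ereal_sup (f @` [set t | (f t <= y)%E]) <= y)%E.
  by apply: ereal_inf_lbound; exists [set t | (f t <= y)%E].
by apply: ge_ereal_sup => _ [t /= ty <-].
Qed.

Lemma limf_einf_ge (R : realType) (f : R -> \bar R) (y : \bar R) :
  (\forall t \near +oo, (y <= f t)%E) -> (y <= limf_einf f +oo%R)%E.
Proof.
move=> fy; rewrite limf_einfE; apply: (@le_trans _ _ (ereal_inf (f @` [set t | (y <= f t)%E]))).
  by apply: le_ereal_inf_tmp => _ [t /= ty <-].
by apply: ereal_sup_ubound; exists [set t | (y <= f t)%E].
Qed.

Section ldp_from_tails.
Variable R : realType.

Lemma expRN1_le_half : expR (- 1) <= 2^-1 :> R.
Proof.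
rewrite expRN lef_pV2 ?posrE ?expR_gt0//.
by have := expR_ge1Dx (1 : R); lra.
Qed.

Lemma lne_scaled_le (s y : R) (p : \bar R) : 0 < s -> (0 <= p)%E ->
  (p <= (expR (- (s * y)))%:E)%E -> ((s^-1)%:E * lne p <= (- y)%:E)%E.
Proof.
move=> s0 p0 py.
have : (lne p <= (- (s * y))%:E)%E.
  by rewrite -[(- (s * y))%:E](expeRK) lee_lne// in_itv/= ?leey ?andbT ?lee_fin ?expR_ge0.
move=> h; apply: le_trans (lee_wpmul2l _ h) _; first by rewrite lee_fin invr_ge0 ltW.
by rewrite -EFinM lee_fin mulrN mulrA mulVf ?gt_eqF// mul1r.
Qed.

Lemma lne_scaled_ge (s y : R) (p : \bar R) : 0 < s -> (0 <= p)%E ->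
  ((expR (- (s * y)))%:E <= p)%E -> ((- y)%:E <= (s^-1)%:E * lne p)%E.
Proof.
move=> s0 p0 py.
have : ((- (s * y))%:E <= lne p)%E.
  by rewrite -[(- (s * y))%:E](expeRK) lee_lne// in_itv/= ?leey ?andbT ?lee_fin ?expR_ge0.
move=> h; apply: le_trans (lee_wpmul2l _ h); last by rewrite lee_fin invr_ge0 ltW.
by rewrite -EFinM lee_fin mulrN mulrA mulVf ?gt_eqF// mul1r.
Qed.

Variables (disp : measure_display) (Omega : R -> measurableType disp).
Variables (P : forall t, probability (Omega t) R) (X : forall t, Omega t -> R).
Variables (s J : R -> R).
Hypothesis mX : forall t : R, 0 < t -> measurable_fun setT (@X t).
Hypothesis s_oo : s t @[t --> +oo] --> +oo.
Hypothesis J_incr : forall x y, 1 <= x -> x < y -> J x < J y.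
Hypothesis J1 : J 1 = 0.
Hypothesis J_cont : forall x, 0 < x -> {for x, continuous J}.
Hypothesis J_oo : forall M, exists2 x, 1 <= x & M <= J x.
Hypothesis upper : forall x e, 1 < x -> 0 < e ->
  \forall t \near +oo, (P t [set w | (x <= X w)%R] <= (expR (- (s t * (J x - e))))%:E)%E.
Hypothesis lower : forall x e, 1 < x -> 0 < e ->
  \forall t \near +oo, ((expR (- (s t * (J x + e))))%:E <= P t [set w | (x <= X w)%R])%E.
Hypothesis below : forall x M, x < 1 ->
  \forall t \near +oo, (P t [set w | (X w <= x)%R] <= (expR (- (s t * M)))%:E)%E.

Let J_le x y : 1 <= x -> x <= y -> J x <= J y.
Proof.
by move=> x1; rewrite le_eqVlt => /predU1P[->//|xy]; exact/ltW/J_incr.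
Qed.

Let J_ge0 x : 1 <= x -> 0 <= J x.
Proof. by move=> x1; rewrite -J1; exact: J_le. Qed.

Let s_large M : \forall t \near +oo, M <= s t.
Proof. by have := s_oo => /cvgryPge /(_ M). Qed.

Lemma good_rate_from1 : good_rate_function (rate_from1 J).
Proof.
split=> [x|a a0]; first by rewrite /rate_from1; case: ifP => // x1; rewrite lee_fin J_ge0.
have E : [set x | (rate_from1 J x <= a%:E)%E] = [set x | 1 <= x /\ J x <= a].
  apply/seteqP; split=> x; rewrite /rate_from1/=; case: ifP => // x1; rewrite ?lee_fin//.
    by move=> [].
  by move=> [].
have [M M1 aM] := J_oo (a + 1).
apply: (@subclosed_compact _ _ `[1, M]%classic); last 2 first.
- exact: segment_compact.
- move=> x; rewrite E /= in_itv/= => -[x1 xa]; rewrite x1/= leNgt; apply/negP => /(J_incr M1) Mx.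
  by have := lt_le_trans Mx xa; lra.
rewrite E => x xcl.
have x1 : 1 <= x.
  by apply: (@closed_ge R 1) => V /xcl[y [[y1 _] Vy]]; exists y.
split=> //; rewrite leNgt; apply/negP => ax.
have [|y [[_ ya] /= ay]] := xcl [set y | a < J y]; last by have := lt_le_trans ay ya; rewrite ltxx.
have x0 : 0 < x by exact: lt_le_trans x1.
exact: (cvgr_gt _ (J_cont x0)).
Qed.

Let mge (t x : R) : 0 < t ->
  measurable [set w : Omega t | (x <= X w)%R] /\ measurable [set w : Omega t | (X w <= x)%R].
Proof.
move=> t0; have mXt := mX t0; split.
  rewrite (_ : [set w | _] = @X t @^-1` `[x, +oo[%classic); first by rewrite -[_ @^-1` _]setTI; exact: mXt.
  by apply/seteqP; split=> w /=; rewrite in_itv/= andbT.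
rewrite (_ : [set w | _] = @X t @^-1` `]-oo, x]%classic); first by rewrite -[_ @^-1` _]setTI; exact: mXt.
by apply/seteqP; split=> w /=; rewrite in_itv.
Qed.

(** The probability of a short interval to the right of [x] is the difference of two tails,
    and the second one is negligible because [J] is strictly increasing. *)
Let lower_bound_interior (B : set R) (x : R) : measurable B -> B° x -> 1 <= x ->
  ((- J x)%:E <= limf_einf (fun t => ((s t)^-1)%:E * lne (pushforward (P t) (@X t) B)) +oo%R)%E.
Proof.
move=> mB /nbhs_ballP[dl /= dl0 dB] x1; have x0 : 0 < x by exact: lt_le_trans x1.
apply/lee_addgt0Pr => e e0.
have e20 : 0 < e / 2 by rewrite divr_gt0.
(* two points between [x] and the boundary of the ball, the first with almost the rate of [x] *)
have [y [xy Jy yd]] : exists y, [/\ x < y, J y < J x + e / 2 & y < x + dl].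
  have /nbhs_ballP[rad /= rad0 radJ] : \forall z \near x, J z < J x + e / 2.
    by apply: (cvgr_lt _ (J_cont x0)); rewrite ltrDl.
  have m0 : 0 < Num.min rad dl by rewrite lt_min rad0 dl0.
  have m1 : Num.min rad dl <= rad by rewrite ge_min lexx.
  have m2 : Num.min rad dl <= dl by rewrite ge_min lexx orbT.
  exists (x + Num.min rad dl / 2); split; [lra| |lra].
  by apply: radJ; rewrite /ball/= ltr_norml; apply/andP; split; lra.
pose y' := (y + (x + dl)) / 2.
have yy' : y < y' by rewrite /y'; lra.
have y'd : y' < x + dl by rewrite /y'; lra.
have y1 : 1 < y by exact: le_lt_trans xy.
have JJ : J y < J y' by apply: J_incr => //; exact: ltW.
pose eta := Num.min (e / 4) ((J y' - J y) / 4).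
have eta0 : 0 < eta by rewrite lt_min !divr_gt0// subr_gt0.
have etae : eta <= e / 4 by rewrite /eta ge_min lexx.
have etaJ : eta <= (J y' - J y) / 4 by rewrite /eta ge_min lexx orbT.
suff : ((- (J x + e))%:E <= limf_einf (fun t => ((s t)^-1)%:E * lne (pushforward (P t) (@X t) B)) +oo%R)%E.
  move=> h; apply: le_trans (leeD2r _ h); rewrite -EFinD lee_fin; lra.
apply: limf_einf_ge.
have L := lower y1 eta0; have U := upper (lt_trans y1 yy') eta0.
have S1 := s_large (eta^-1); have S2 := s_large (4 / e).
near=> t.
have t0 : 0 < t by near: t; exact: nbhs_pinfty_gt.
have st1 : eta^-1 <= s t by near: t.
have st2 : 4 / e <= s t by near: t.
have s0 : 0 < s t by apply: lt_le_trans st1; rewrite invr_gt0.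
have se1 : 1 <= s t * eta by rewrite -ler_pdivrMr// div1r.
have se2 : 1 <= s t * (e / 4) by rewrite -ler_pdivrMr ?divr_gt0// invf_div mul1r.
rewrite /pushforward; apply: lne_scaled_ge => //.
have [my1 _] := mge y t0; have [my'1 _] := mge y' t0.
have mBX : measurable (@X t @^-1` B) by rewrite -[_ @^-1` _]setTI; exact: mX.
have sub : (P t [set w | (y <= X w)%R] <= P t (@X t @^-1` B) + P t [set w | (y' <= X w)%R])%E.
  apply: le_trans (measureU2 _ mBX my'1); apply: le_measure; rewrite ?inE//; first exact: measurableU.
  move=> w /= yX; have [y'X|Xy'] := leP y' (X w); [by right|left; apply: dB].
  by rewrite /ball/= ltr_norml; apply/andP; split; lra.
have Lt : ((expR (- (s t * (J y + eta))))%:E <= P t [set w | (y <= X w)%R])%E by near: t.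
have Ut : (P t [set w | (y' <= X w)%R] <= (expR (- (s t * (J y' - eta))))%:E)%E by near: t.
have {sub} := le_trans Lt (le_trans sub (leeD2l _ Ut)).
rewrite -leeBlDr// -EFinB; apply: le_trans; rewrite lee_fin.
have -> : expR (- (s t * (J y' - eta))) = expR (- (s t * (J y + eta))) * expR (- (s t * (J y' - J y - 2 * eta))).
  by rewrite -expRD; congr expR; ring.
rewrite -[X in X - _]mulr1 -mulrBr.
have h1 : expR (- (s t * (J y' - J y - 2 * eta))) <= 2^-1.
  apply: le_trans expRN1_le_half; rewrite ler_expR lerN2.
  by apply: le_trans se1 _; rewrite ler_pM2l//; lra.
have h2 : 2^-1 <= 1 - expR (- (s t * (J y' - J y - 2 * eta))) by lra.
apply: le_trans (ler_wpM2l (expR_ge0 _) h2).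
apply: le_trans (ler_wpM2l (expR_ge0 _) expRN1_le_half).
rewrite -expRD ler_expR.
have -> : - (s t * (J x + e)) = - (s t * (J y + eta)) - s t * (e / 4) - s t * (J x + e * 3 / 4 - J y - eta) by field.
have : 0 <= s t * (J x + e * 3 / 4 - J y - eta) by apply: mulr_ge0; lra.
lra.
Unshelve. all: by end_near.
Qed.

(** The half-line on the left of [1] is negligible at every exponential scale. *)
Let two_tails_le (B : set R) x0 x1 e : measurable B -> 1 < x0 -> x1 < 1 -> 0 < e ->
  (forall b, B b -> b <= x1 \/ x0 <= b) ->
  \forall t \near +oo, (((s t)^-1)%:E * lne (pushforward (P t) (@X t) B) <= (- (J x0 - e))%:E)%E.
Proof.
move=> mB x01 x11 e0 Bx; have e20 : 0 < e / 2 by rewrite divr_gt0.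
have U := upper x01 e20; have Z := below (J x0) x11; have S1 := s_large (2 / e).
near=> t.
have t0 : 0 < t by near: t; exact: nbhs_pinfty_gt.
have st1 : 2 / e <= s t by near: t.
have s0 : 0 < s t by apply: lt_le_trans st1; rewrite divr_gt0.
have se1 : 1 <= s t * (e / 2) by rewrite -ler_pdivrMr ?divr_gt0// invf_div mul1r.
have mBX : measurable (@X t @^-1` B) by rewrite -[_ @^-1` _]setTI; exact: mX.
have [mx0 _] := mge x0 t0; have [_ mx1] := mge x1 t0.
rewrite /pushforward; apply: lne_scaled_le => //.
have Ut : (P t [set w | (x0 <= X w)%R] <= (expR (- (s t * (J x0 - e / 2))))%:E)%E by near: t.
have Zt : (P t [set w | (X w <= x1)%R] <= (expR (- (s t * J x0)))%:E)%E by near: t.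
apply: (@le_trans _ _ (P t [set w | (X w <= x1)%R] + P t [set w | (x0 <= X w)%R])%E).
  apply: le_trans (measureU2 _ mx1 mx0); apply: le_measure; rewrite ?inE//; first exact: measurableU.
  by move=> w /= /Bx.
apply: le_trans (leeD Zt Ut) _; rewrite -EFinD lee_fin.
have h1 : expR (- (s t * J x0)) <= expR (- (s t * (J x0 - e / 2))).
  by rewrite ler_expR lerN2 ler_pM2l//; lra.
have -> : expR (- (s t * (J x0 - e))) = expR (- (s t * (J x0 - e / 2))) * expR (s t * (e / 2)).
  by rewrite -expRD; congr expR; field.
have h2 : 2 <= expR (s t * (e / 2)) by apply: le_trans (expR_ge1Dx _); lra.
apply: le_trans (ler_wpM2l (expR_ge0 _) h2); lra.
Unshelve. all: by end_near.
Qed.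

(** The bound is trivial if [1] belongs to the closure of [B]. Otherwise [B] keeps a
    positive distance from [1], and only the infimum of its part on the right of [1]
    matters. *)
Let upper_bound_closure (B : set R) : measurable B ->
  (limf_esup (fun t => ((s t)^-1)%:E * lne (pushforward (P t) (@X t) B)) +oo%R <=
   - ereal_inf (rate_from1 J @` closure B))%E.
Proof.
move=> mB; have [cl1|ncl1] := pselect (closure B 1).
  apply: (@le_trans _ _ 0%E).
    apply: limf_esup_le; near=> t.
    have s0 : 0 < s t by near: t; exact: cvgry_gt.
    have t0 : 0 < t by near: t; exact: nbhs_pinfty_gt.
    have mBX : measurable (@X t @^-1` B) by rewrite -[_ @^-1` _]setTI; exact: mX.
    rewrite pmule_rle0 ?lte_fin ?invr_gt0// lne_le0; exact: probability_le1.
  rewrite leeNr oppe0; apply: ereal_inf_lbound; exists 1 => //.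
  by rewrite /rate_from1 lexx J1.
have [dl dl0 dlB] : exists2 dl, 0 < dl & forall b, closure B b -> b <= 1 - dl \/ 1 + dl <= b.
  have : nbhs (1 : R) (~` closure B) by apply: open_nbhs_nbhs; split=> //; exact/closed_openC/closed_closure.
  move=> /nbhs_ballP[dl /= dl0 dlB]; exists dl => // b clb.
  have [bd|bd] := leP b (1 - dl); [by left|right].
  rewrite leNgt; apply/negP => bd'; apply: (dlB b _ clb).
  by rewrite /ball/= ltr_norml; apply/andP; split; lra.
pose A := [set b | closure B b /\ 1 <= b].
have [A0|A0] := pselect (A !=set0); last first.
  set y := limf_esup _ _; suff -> : y = -oo%E by rewrite leNye.
  suff : forall M : R, (y <= M%:E)%E.
    case: y => [r|/(_ 0)|//]; last by rewrite leye_eq.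
    by move=> /(_ (r - 1)); rewrite lee_fin => h; exfalso; lra.
  move=> M; have [x x1 Mx] := J_oo (1 - M).
  have x2 : 1 < x + 1 by lra.
  have Mx2 : 1 - M <= J (x + 1) by apply: le_trans Mx _; apply: J_le => //; lra.
  have dl1 : 1 - dl < 1 by lra.
  apply: limf_esup_le; apply: filterS (two_tails_le mB x2 dl1 ltr01 _) => [t|b Bb].
    by move=> /le_trans; apply; rewrite lee_fin; lra.
  left; have clb : closure B b by exact: subset_closure.
  have [//|b1] := dlB b clb; exfalso; apply: A0; exists b; split=> //; lra.
have hinfA : has_inf A by split=> //; exists 1 => b [].
pose x0 := inf A.
have x0_lb b : A b -> x0 <= b by move=> Ab; apply: ge_inf => //; case: hinfA.
have x0cl : closure B x0.
  rewrite (closure_id (closure B)).1; last exact: closed_closure.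
  move=> V /nbhs_ballP[e /= e0 eV].
  have [b Ab be] := inf_adherent e0 hinfA.
  exists b; split; first by case: Ab.
  apply: eV; rewrite /ball/= ltr_norml; apply/andP; split; have := x0_lb _ Ab; lra.
have x01 : 1 < x0.
  apply: (@lt_le_trans _ _ (1 + dl)); first lra.
  apply: lb_le_inf => // b [clb b1]; have [|//] := dlB b clb; lra.
apply: (@le_trans _ _ (- J x0)%:E); last first.
  rewrite EFinN leeN2; apply: ereal_inf_lbound; exists x0 => //.
  by rewrite /rate_from1 (ltW x01).
apply/lee_addgt0Pr => e e0; rewrite -EFinD; apply: limf_esup_le.
rewrite (_ : - J x0 + e = - (J x0 - e)); last by ring.
apply: (@two_tails_le B x0 (1 - dl) e) => //; first lra.
move=> b Bb; have clb : closure B b by exact: subset_closure.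
have [|b1] := dlB b clb; [by left|right].
by apply: x0_lb; split=> //; lra.
Unshelve. all: by end_near.
Qed.

(** The hypotheses give the exact exponential rate of all half-lines on the right of [1] and
    a superexponential bound on the left; since [J] is increasing from [J 1 = 0], half-lines
    determine the rate of all Borel sets. *)
Lemma ldp_rv_of_tails : ldp_rv P X s (rate_from1 J).
Proof.
split; first exact: mX.
split=> // [|B mB]; first exact: good_rate_from1.
rewrite leeNl; apply: le_ereal_inf_tmp => _ [x Bx <-].
rewrite /rate_from1; case: ifP => [x1|_]; last by rewrite leey.
by rewrite leeNl -EFinN; exact: lower_bound_interior.
Qed.

End ldp_from_tails.

(** * Tails of the dimension from a union bound and independent trials *)

Section tails_of_counts.
Variable R : realType.
Variables (disp : measure_display) (Omega : R -> measurableType disp).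
Variables (P : forall t, probability (Omega t) R) (M : forall t, Omega t -> nat).
Variables (lam q k : R -> R).
Hypothesis mM : forall t : R, 0 < t -> measurable_fun setT (@M t).
Hypothesis lam_gt0 : forall t, 0 < t -> 0 < lam t.
Hypothesis q_gt0 : forall t, 0 < t -> 0 < q t.
Hypothesis k_gt0 : \forall t \near +oo, 0 < k t.

(** The rate [lam t] is meant to be that of the number of points in a small ball, and [q t] the
    order of the number of disjoint such balls in the window. *)
Hypothesis union_bound : forall d : R, 0 < d -> exists2 C : R, 0 < C &
  \forall t \near +oo, forall (n : nat) (th : R), (0 < n)%N -> 0 <= th ->
    (P t [set w | (n <= M w)%N] <=
      (C * q t * expR ((1 + d) * lam t * (expR th - 1) - th * n%:R))%:E)%E.
Hypothesis independent_balls : exists2 c : R, 0 < c &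
  \forall t \near +oo, exists2 N : nat, c * q t <= N%:R & forall n : nat,
    (P t [set w | (M w < n)%N] <=
      ((fine (poisson_prob (lam t) 0%N [set j | (j < n)%N])) ^+ N)%:E)%E.

Definition scaled_dim t (w : Omega t) : R := ((M w)%:Z - 1)%:~R / k t.

Lemma scaled_dimE t (w : Omega t) : scaled_dim w = ((M w)%:R - 1) / k t.
Proof. by rewrite /scaled_dim rmorphB. Qed.

Lemma measurable_scaled_dim t : 0 < t -> measurable_fun setT (@scaled_dim t).
Proof.
move=> t0; rewrite (_ : @scaled_dim t = (fun m : nat => (m%:Z - 1)%:~R / k t) \o @M t)//.
exact: measurableT_comp (mM t0).
Qed.

Lemma le_scaled_dim t (w : Omega t) x : 0 < k t ->
  (x <= scaled_dim w) = (x * k t + 1 <= (M w)%:R).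
Proof. by move=> k0; rewrite scaled_dimE ler_pdivlMr// lerBrDr. Qed.

Lemma ge_scaled_dim t (w : Omega t) x : 0 < k t ->
  (scaled_dim w <= x) = ((M w)%:R <= x * k t + 1).
Proof. by move=> k0; rewrite scaled_dimE ler_pdivrMr// lerBlDr. Qed.

Lemma measurable_count t (S : set nat) : 0 < t -> measurable [set w : Omega t | S (M w)].
Proof. by move=> t0; have := mM t0 measurableT (I : measurable S); rewrite setTI. Qed.

Lemma measurable_scaled_dim_tails t x : 0 < t -> 0 < k t ->
  measurable [set w : Omega t | (x <= scaled_dim w)%R] /\
  measurable [set w : Omega t | (scaled_dim w <= x)%R].
Proof.
move=> t0 k0; split.
  rewrite (_ : mkset _ = [set w : Omega t | [set m : nat | x * k t + 1 <= m%:R] (M w)]).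
    exact: measurable_count.
  by apply/seteqP; split=> w /=; rewrite le_scaled_dim.
rewrite (_ : mkset _ = [set w : Omega t | [set m : nat | m%:R <= x * k t + 1] (M w)]).
  exact: measurable_count.
by apply/seteqP; split=> w /=; rewrite ge_scaled_dim.
Qed.

(** [th] is the parameter of the Chernoff bound, to be chosen for each regime. *)
Lemma upper_tail_of (x d : R) (th b : R -> R) : 0 < x -> 0 < d ->
  (\forall t \near +oo, 0 <= th t) ->
  (forall C, 0 < C -> \forall t \near +oo,
    ln C + ln (q t) + ((1 + d) * lam t * (expR (th t) - 1) - th t * (x * k t)) <= b t) ->
  \forall t \near +oo, (P t [set w | (x <= scaled_dim w)%R] <= (expR (b t))%:E)%E.
Proof.
move=> x0 d0 th0 hb; have [C C0 U] := union_bound d0; have {}hb := hb _ C0.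
near=> t.
have t0 : 0 < t by near: t; exact: nbhs_pinfty_gt.
have k0 : 0 < k t by near: t.
have q0 := q_gt0 t0.
pose n := (Num.truncn (x * k t)).+1.
have nk : x * k t < n%:R by exact: truncnS_gt.
apply: (@le_trans _ _ (P t [set w | (n <= M w)%N])).
  apply: le_measure; rewrite ?inE; first exact: (measurable_scaled_dim_tails x t0 k0).1.
    exact: (@measurable_count t [set j | (n <= j)%N]).
  move=> w /=; rewrite le_scaled_dim// => xM.
  have /andP[nk' _] := truncn_itv (ltW (mulr_gt0 x0 k0)).
  by rewrite -(ltr_nat R) (le_lt_trans nk')//; lra.
have Ut : forall (n : nat) (th : R), (0 < n)%N -> 0 <= th ->
    (P t [set w | (n <= M w)%N] <=
      (C * q t * expR ((1 + d) * lam t * (expR th - 1) - th * n%:R))%:E)%E by near: t.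
have th0t : 0 <= th t by near: t.
apply: le_trans (Ut n (th t) isT th0t) _; rewrite lee_fin.
have -> : C * q t = expR (ln C + ln (q t)) by rewrite expRD !lnK.
rewrite -expRD ler_expR; apply: (@le_trans _ _ (ln C + ln (q t) +
  ((1 + d) * lam t * (expR (th t) - 1) - th t * (x * k t)))); last by near: t.
by rewrite lerD2l lerD2l lerN2 ler_wpM2l// ltW.
Unshelve. all: by end_near.
Qed.

(** A face of dimension [x * k t] has [x * k t + 1] points. *)
Definition level x t : nat := (Num.truncn (x * k t + 1)).+1.

(** A lower bound for the logarithm of the expected number of balls with at least [level x
    t] points, from [poisson_tail_ge]. *)
Definition log_expected c x t : R :=
  ln c + ln (q t) + (- lam t + (level x t)%:R * ln (lam t) -
    (level x t).+1%:R * ln (level x t)%:R + (level x t)%:R - 1).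

Let one_sub_pow_le (p : R) N : 0 <= p <= 1 -> (1 - p) ^+ N <= expR (- (N%:R * p)).
Proof.
move=> /andP[p0 p1]; rewrite -mulrN expRM_natl lerXn2r ?nnegrE ?subr_ge0 ?expR_ge0//.
exact: expR_ge1Dx.
Qed.

Let few_points x b :
  (forall c, 0 < c -> \forall t \near +oo, b t <= log_expected c x t) ->
  \forall t \near +oo, (P t [set w | (M w < level x t)%N] <= (expR (- expR (b t)))%:E)%E.
Proof.
move=> hb; have [c c0 L] := independent_balls; have {}hb := hb _ c0.
near=> t.
have t0 : 0 < t by near: t; exact: nbhs_pinfty_gt.
have lam0 := lam_gt0 t0; have q0 := q_gt0 t0.
have [N cN LN] : exists2 N : nat, c * q t <= N%:R & forall n : nat,
    (P t [set w | (M w < n)%N] <=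
      ((fine (poisson_prob (lam t) 0%N [set j | (j < n)%N])) ^+ N)%:E)%E by near: t.
apply: le_trans (LN (level x t)) _; rewrite lee_fin; set n := level x t.
pose pr : probability _ R := poisson_prob (lam t) 0%N.
pose p := fine (pr [set j | (n <= j)%N]).
have pE : fine (poisson_prob (lam t) 0%N [set j | (j < n)%N]) = 1 - p.
  rewrite (_ : [set j | (j < n)%N] = ~` [set j | (n <= j)%N]); last first.
    by apply/seteqP; split=> j /=; rewrite ltnNge => /negP.
  rewrite [X in fine X](_ : _ = 1 - pr [set j | (n <= j)%N])%E.
    by rewrite fineB// fin_num_measure.
  exact: (@probability_setC _ _ _ pr).
have p01 : 0 <= p <= 1.
  rewrite fine_ge0 ?measure_ge0//= -lee_fin fineK ?fin_num_measure//.
  exact: probability_le1.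
rewrite pE; apply: le_trans (one_sub_pow_le _ p01) _.
rewrite ler_expR lerN2.
apply: (@le_trans _ _ (expR (log_expected c x t))); first by rewrite ler_expR; near: t.
have -> : log_expected c x t = ln c + ln (q t) + (- lam t + n%:R * ln (lam t) -
    n.+1%:R * ln n%:R + n%:R - 1) by [].
rewrite expRD expRD !lnK ?posrE//.
apply: ler_pM => //; first by rewrite mulr_ge0 ?ltW.
rewrite -lee_fin /p fineK ?fin_num_measure//.
exact: poisson_tail_ge.
Unshelve. all: by end_near.
Qed.

(** When the expected number [v] of successful balls is at most one, the probability of a
    success is at least [v / 2], because [1 - expR (- v) >= v / 2]. *)
Lemma lower_tail_of x b : 0 < x ->
  (forall c, 0 < c -> \forall t \near +oo, b t <= log_expected c x t) ->
  (\forall t \near +oo, b t <= 0) ->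
  \forall t \near +oo, ((expR (b t) / 2)%:E <= P t [set w | (x <= scaled_dim w)%R])%E.
Proof.
move=> x0 hb b0; have F := few_points hb; near=> t.
have t0 : 0 < t by near: t; exact: nbhs_pinfty_gt.
have k0 : 0 < k t by near: t.
have Ft : (P t [set w | (M w < level x t)%N] <= (expR (- expR (b t)))%:E)%E by near: t.
apply: (@le_trans _ _ (P t (~` [set w | (M w < level x t)%N]))); last first.
  apply: le_measure; rewrite ?inE; last 2 first.
  - exact: (measurable_scaled_dim_tails x t0 k0).1.
  - move=> w /= /negP; rewrite -leqNgt le_scaled_dim// -(ler_nat R); apply: le_trans.
    exact/ltW/truncnS_gt.
  by apply: measurableC; exact: (@measurable_count t [set j | (j < level x t)%N]).
rewrite probability_setC; last exact: (@measurable_count t [set j | (j < level x t)%N]).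
apply: (@le_trans _ _ (1 - (expR (- expR (b t)))%:E)%E); last exact: leeB.
have b01 : expR (b t) <= 1 by rewrite -expR0 ler_expR; near: t.
rewrite -EFinB lee_fin expRN; move: (expR_gt0 (b t)) b01; set u := expR (b t) => u0 u1.
have v0 : 0 < 1 + u by lra.
have : (expR u)^-1 <= (1 + u)^-1 by rewrite lef_pV2 ?posrE ?expR_gt0// expR_ge1Dx.
have : (1 + u)^-1 <= 1 - u / 2.
  by rewrite -[leLHS]mul1r ler_pdivrMr//; nra.
lra.
Unshelve. all: by end_near.
Qed.

Lemma below_tail_of x b :
  (forall c, 0 < c -> \forall t \near +oo, b t <= log_expected c x t) ->
  \forall t \near +oo,
    (P t [set w | (scaled_dim w <= x)%R] <= (expR (- expR (b t)))%:E)%E.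
Proof.
move=> hb; have F := few_points hb; near=> t.
have t0 : 0 < t by near: t; exact: nbhs_pinfty_gt.
have k0 : 0 < k t by near: t.
apply: (@le_trans _ _ (P t [set w | (M w < level x t)%N])); last by near: t.
apply: le_measure; rewrite ?inE; first exact: (measurable_scaled_dim_tails x t0 k0).2.
  exact: (@measurable_count t [set j | (j < level x t)%N]).
move=> w /=; rewrite ge_scaled_dim// -(ltr_nat R) => /le_lt_trans; apply.
exact: truncnS_gt.
Unshelve. all: by end_near.
Qed.

End tails_of_counts.

(** * The entropy function and elementary asymptotics *)

Section entropy.
Variable R : realType.

Lemma H_gt0 (x : R) : 0 < x -> x != 1 -> 0 < H x.
Proof.
move=> x0 x1; have lx : ln x^-1 != 0 by rewrite ln_eq0 ?invr_gt0// invr_eq1.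
have := expR_gt1Dx lx; rewrite lnK ?posrE ?invr_gt0// lnV ?posrE//.
rewrite -(ltr_pM2l x0) divff ?gt_eqF// /H; lra.
Qed.

Lemma H1 : H (1 : R) = 0. Proof. by rewrite /H ln1; ring. Qed.

(** [H y - H x] is the sum of [x * H (y / x)] and [(y - x) * ln x]. *)
Lemma H_incr (x y : R) : 1 <= x -> x < y -> H x < H y.
Proof.
move=> x1 xy; have x0 : 0 < x by exact: lt_le_trans x1.
have y0 : 0 < y by exact: lt_trans xy.
have s1 : 1 < y / x by rewrite ltr_pdivlMr// mul1r.
have s0 : 0 < y / x by exact: lt_trans s1.
have := H_gt0 s0 (negbT (gt_eqF s1)); rewrite -(pmulr_rgt0 _ x0) /H ln_div ?posrE//.
have -> : x * (1 + y / x * (ln y - ln x) - y / x) = x + y * (ln y - ln x) - y.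
  by field; rewrite gt_eqF.
have : 0 <= (y - x) * ln x by rewrite mulr_ge0 ?ln_ge0// subr_ge0 ltW.
lra.
Qed.

Lemma H_le (x y : R) : 1 <= x -> x <= y -> H x <= H y.
Proof. by move=> x1; rewrite le_eqVlt => /predU1P[->//|xy]; exact/ltW/H_incr. Qed.

Lemma H_unbounded (M : R) : exists2 y, 1 <= y & M <= H y.
Proof.
pose y := Num.max (expR 2) M; have y0 : 0 < y by rewrite lt_max expR_gt0.
have y2 : expR 2 <= y by rewrite le_max lexx.
have My : M <= y by rewrite le_max lexx orbT.
exists y; first by apply: le_trans y2; rewrite -expR0 ler_expR.
have l2 : 2 <= ln y by rewrite -(expRK 2) ler_ln ?posrE ?expR_gt0.
apply: le_trans My _; rewrite /H.
have : y * 2 <= y * ln y by rewrite ler_pM2l.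
lra.
Qed.

Lemma H_continuous (x : R) : 0 < x -> {for x, continuous (@H R)}.
Proof.
move=> x0; apply: cvgB; last exact: cvg_id.
apply: cvgD; first exact: cvg_cst.
by apply: cvgM; [exact: cvg_id|exact: continuous_ln].
Qed.

Lemma H_surj (c : R) : 0 < c -> exists2 b, 1 < b & H b = c.
Proof.
move=> c0; have [y y1 cy] := H_unbounded c.
have cont : {within `[1, y], continuous (@H R)}.
  apply: continuous_in_subspaceT => x; rewrite inE/= in_itv/= => /andP[x1 _].
  by apply: H_continuous; exact: lt_le_trans x1.
have cH : Num.min (H 1) (H y) <= c <= Num.max (H 1) (H y).
  by rewrite H1 ge_min le_max cy orbT (ltW c0).
have [b] := IVT y1 cont cH; rewrite in_itv/= => /andP[b1 _] Hb.
exists b => //; rewrite lt_neqAle b1 andbT; apply/eqP => E.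
by move: c0; rewrite -Hb -E H1 ltxx.
Qed.

End entropy.

Section asymptotics.
Variable R : realType.
Implicit Types f g : R -> R.

Lemma cvg_near_eq f g (l : set_system R) : (\forall t \near +oo, f t = g t) ->
  g t @[t --> +oo] --> l -> f t @[t --> +oo] --> l.
Proof. by move=> fg; apply: cvg_trans; apply: near_eq_cvg; apply: filterS fg => t. Qed.

Lemma cvgr_nearM f (s : R -> R) (l b : R) : (\forall t \near +oo, 0 < s t) ->
  f t / s t @[t --> +oo] --> l -> b < l -> \forall t \near +oo, s t * b <= f t.
Proof.
move=> s0 fl bl; near=> t; have st0 : 0 < s t by near: t.
have : b <= f t / s t by near: t; exact: (cvgr_ge _ fl).
by rewrite ler_pdivlMr// mulrC.
Unshelve. all: by end_near.
Qed.

Lemma cvgr_nearM_le f (s : R -> R) (l b : R) : (\forall t \near +oo, 0 < s t) ->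
  f t / s t @[t --> +oo] --> l -> l < b -> \forall t \near +oo, f t <= s t * b.
Proof.
move=> s0 fl bl; near=> t; have st0 : 0 < s t by near: t.
have : f t / s t <= b by near: t; exact: (cvgr_le _ fl).
by rewrite ler_pdivrMr// mulrC.
Unshelve. all: by end_near.
Qed.

Lemma cvg_cstV (c : R) f : f t @[t --> +oo] --> +oo -> c / f t @[t --> +oo] --> 0.
Proof.
move=> foo; rewrite -[X in _ --> X](mulr0 c); apply: cvgMr.
by apply/gtr0_cvgV0 => //; exact: cvgry_gt.
Qed.

Lemma ln_div_cvg0 f : f t @[t --> +oo] --> +oo -> ln (f t) / f t @[t --> +oo] --> 0.
Proof.
move=> foo; apply/cvgr0Pnorm_le => e e0; near=> t.
have f1 : 1 <= f t by near: t; exact: cvgry_ge.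
have f0 : 0 < f t by exact: lt_le_trans f1.
have f2 : - ln (e / 2) / (e / 2) <= f t by near: t; exact: cvgry_ge.
have e20 : 0 < e / 2 by rewrite divr_gt0.
rewrite ger0_norm ?divr_ge0 ?ln_ge0 ?(ltW f0)// ler_pdivrMr//.
have : ln (e / 2 * f t) < e / 2 * f t by apply: ln_sublinear; rewrite mulr_gt0.
rewrite lnM ?posrE//; move: f2; rewrite ler_pdivrMr//; lra.
Unshelve. all: by end_near.
Qed.

Lemma ln_cvgy f : f t @[t --> +oo] --> +oo -> ln (f t) @[t --> +oo] --> +oo.
Proof.
move=> foo; apply/cvgryPge => A; near=> t.
have fA : expR A <= f t by near: t; exact: cvgry_ge.
by rewrite -(expRK A) ler_ln ?posrE ?expR_gt0// (lt_le_trans _ fA)// expR_gt0.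
Unshelve. all: by end_near.
Qed.

Lemma cvg_ln f (l : R) : 0 < l -> f t @[t --> +oo] --> l -> ln (f t) @[t --> +oo] --> ln l.
Proof. by move=> l0 fl; apply: continuous_cvg => //; exact: continuous_ln. Qed.

Lemma level_ratio (k : R -> R) x : 0 <= x -> k t @[t --> +oo] --> +oo ->
  (level k x t)%:R / k t @[t --> +oo] --> x.
Proof.
move=> x0 koo; apply: (@squeeze_cvgr _ _ _ _ (fun=> x) (fun t => x + 2 / k t)).
- near=> t.
  have k0 : 0 < k t by near: t; exact: cvgry_gt.
  have y0 : 0 <= x * k t + 1 by rewrite addr_ge0// mulr_ge0// ltW.
  have /andP[l1 _] := truncn_itv y0.
  have l2 : x * k t + 1 < (level k x t)%:R by exact: truncnS_gt.
  rewrite ler_pdivlMr// ler_pdivrMr// mulrDl divfK ?gt_eqF//; apply/andP; split; first lra.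
  by rewrite /level -natr1; lra.
- exact: cvg_cst.
- by rewrite -[X in _ --> X]addr0; apply: cvgD; [exact: cvg_cst|exact: cvg_cstV].
Unshelve. all: by end_near.
Qed.

Lemma level_gt0 (k : R -> R) x t : 0 < (level k x t)%:R :> R.
Proof. by rewrite ltr0n. Qed.

End asymptotics.

(** * The three regimes *)

Section regimes.
Variable R : realType.
Variables (disp : measure_display) (Omega : R -> measurableType disp).
Variables (P : forall t, probability (Omega t) R) (M : forall t, Omega t -> nat).
Variables (c0 : R) (rho : R -> R).
Hypothesis mM : forall t : R, 0 < t -> measurable_fun setT (@M t).
Hypothesis c0_gt0 : 0 < c0.
Hypothesis rho_gt0 : forall t, 0 < t -> 0 < rho t.

Let lam t := c0 * rho t.
Let q t := t / rho t.

Hypothesis q_oo : q t @[t --> +oo] --> +oo.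
Hypothesis union_bound : forall d : R, 0 < d -> exists2 C : R, 0 < C &
  \forall t \near +oo, forall (n : nat) (th : R), (0 < n)%N -> 0 <= th ->
    (P t [set w | (n <= M w)%N] <=
      (C * q t * expR ((1 + d) * lam t * (expR th - 1) - th * n%:R))%:E)%E.
Hypothesis independent_balls : exists2 c : R, 0 < c &
  \forall t \near +oo, exists2 N : nat, c * q t <= N%:R & forall n : nat,
    (P t [set w | (M w < n)%N] <=
      ((fine (poisson_prob (lam t) 0%N [set j | (j < n)%N])) ^+ N)%:E)%E.

Let lam_gt0 t : 0 < t -> 0 < lam t.
Proof. by move=> t0; rewrite mulr_gt0// rho_gt0. Qed.

Let q_gt0 t : 0 < t -> 0 < q t.
Proof. by move=> t0; rewrite divr_gt0// rho_gt0. Qed.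

Lemma log_expectedE (k : R -> R) c x t : 0 < t ->
  log_expected lam q k c x t = ln c + ln (q t) - lam t
    - (level k x t)%:R * ln ((level k x t)%:R / lam t) + (level k x t)%:R - 1 - ln (level k x t)%:R.
Proof.
move=> t0; have -> : ln ((level k x t)%:R / lam t) = ln (level k x t)%:R - ln (lam t).
  by rewrite ln_div ?posrE ?level_gt0 ?lam_gt0.
by rewrite /log_expected -[(level k x t).+1]addn1 natrD; ring.
Qed.

(** The regimes in which [ln t / rho t] has a finite limit. Then [H b] is the limit [l] of
    [ln (q t) / lam t], so that [b * lam t] is the largest number of points to be expected in
    one of [q t] balls; [b] is one when [rho t] outgrows [ln t]. *)
Section dense.
Variables (b l : R).
Hypothesis b_gt0 : 0 < b.
Hypothesis lam_oo : lam t @[t --> +oo] --> +oo.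
Hypothesis lnq_lam : ln (q t) / lam t @[t --> +oo] --> l.

Let k t := b * lam t.

Let k_oo : k t @[t --> +oo] --> +oo.
Proof.
apply/cvgryPge => A; near=> t.
have h : A / b <= lam t by near: t; exact: cvgry_ge.
by move: h; rewrite ler_pdivrMr// mulrC.
Unshelve. all: by end_near.
Qed.

Lemma dense_log_expected c x : 0 < x ->
  log_expected lam q k c x t / lam t @[t --> +oo] --> l - H (b * x).
Proof.
move=> x0; pose N t := (level k x t)%:R : R; set y := b * x.
have y0 : 0 < y by rewrite mulr_gt0.
have Ny : N t / lam t @[t --> +oo] --> y.
  apply: (@cvg_near_eq _ _ (fun t => b * (N t / k t))).
    near=> t; have t0 : 0 < t by near: t; exact: nbhs_pinfty_gt.
    have l0 := lam_gt0 t0; rewrite /k; field; apply/andP; split; exact/lt0r_neq0.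
  by apply: cvgMr; apply: level_ratio; [exact: ltW|exact: k_oo].
have lnNy := cvg_ln y0 Ny.
have i_lam : (lam t)^-1 @[t --> +oo] --> 0.
  by apply: (@cvg_near_eq _ _ (fun t => 1 / lam t)); [near=> t; rewrite div1r|exact: cvg_cstV].
apply: (@cvg_near_eq _ _ (fun t => ln c / lam t + ln (q t) / lam t - 1
    - N t / lam t * ln (N t / lam t) + N t / lam t - 1 / lam t
    - (ln (N t / lam t) * (lam t)^-1 + ln (lam t) / lam t))).
  near=> t; have t0 : 0 < t by near: t; exact: nbhs_pinfty_gt.
  have l0 := lam_gt0 t0; rewrite log_expectedE// -/(N t).
  have -> : ln (N t / lam t) = ln (N t) - ln (lam t) by rewrite ln_div ?posrE ?level_gt0.
  by field; exact: lt0r_neq0.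
rewrite (_ : l - H y = 0 + l - 1 - y * ln y + y - 0 - (ln y * 0 + 0)); last by rewrite /H; ring.
apply: cvgB; last by apply: cvgD; [exact: cvgM|exact: ln_div_cvg0].
apply: cvgB; last exact: cvg_cstV.
apply: cvgD => //; apply: cvgB; last exact: cvgM.
apply: cvgB; last exact: cvg_cst.
by apply: cvgD => //; exact: cvg_cstV.
Unshelve. all: by end_near.
Qed.

(** [ln (b * x)] is the optimal Chernoff parameter for the value [b * x * lam t]. *)
Lemma dense_exponent (C d x : R) : 0 < x ->
  (ln C + ln (q t) + ((1 + d) * lam t * (expR (ln (b * x)) - 1) - ln (b * x) * (x * k t))) / lam t
    @[t --> +oo] --> l - H (b * x) + d * (b * x - 1).
Proof.
move=> x0; have y0 : 0 < b * x by rewrite mulr_gt0.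
apply: (@cvg_near_eq _ _ (fun t => ln C / lam t + ln (q t) / lam t +
   ((1 + d) * (b * x - 1) - ln (b * x) * (b * x)))).
  near=> t; have t0 : 0 < t by near: t; exact: nbhs_pinfty_gt.
  have l0 := lam_gt0 t0; rewrite lnK// /k; field; exact: lt0r_neq0.
rewrite (_ : l - _ + _ = 0 + l + ((1 + d) * (b * x - 1) - ln (b * x) * (b * x))); last first.
  by rewrite /H; ring.
apply: cvgD; last exact: cvg_cst.
by apply: cvgD => //; exact: cvg_cstV.
Unshelve. all: by end_near.
Qed.

Hypothesis b_ge1 : 1 <= b.
Hypothesis lE : l = H b.
(** The reasons for this differ between [b > 1] and [b = 1]: see [dense_below] and
    [concentrated_below]. *)
Hypothesis below : forall x K, x < 1 -> \forall t \near +oo,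
  (P t [set w | (scaled_dim M k w <= x)%R] <= (expR (- (lam t * K)))%:E)%E.

Lemma dense_ldp : ldp_rv P (fun t w => scaled_dim M k w) lam (rate_from1 (fun x => H (b * x) - H b)).
Proof.
have k0 : \forall t \near +oo, 0 < k t by exact: cvgry_gt.
have lam0 : \forall t \near +oo, 0 < lam t by exact: cvgry_gt.
have bx1 x : 1 <= x -> 1 <= b * x by move=> x1; apply: le_trans b_ge1 _; rewrite ler_peMr// ltW.
have J_incr x y : 1 <= x -> x < y -> H (b * x) - H b < H (b * y) - H b.
  by move=> x1 xy; rewrite ltrD2r; apply: H_incr; [exact: bx1|rewrite ltr_pM2l].
apply: ldp_rv_of_tails => //.
- by move=> t t0; exact: measurable_scaled_dim.
- by rewrite mulr1 subrr.
- move=> x x0; apply: cvgB; last exact: cvg_cst.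
  apply: (@continuous_comp _ _ _ (fun x => b * x) (@H R)).
    by apply: cvgMr; exact: cvg_id.
  by apply: H_continuous; rewrite mulr_gt0.
- move=> K; have [y y1 Ky] := H_unbounded (K + H b).
  exists (Num.max 1 (y / b)); first by rewrite le_max lexx.
  rewrite lerBrDr; apply: le_trans Ky _; apply: H_le => //.
  by rewrite mulrC -ler_pdivrMr// le_max lexx orbT.
- move=> x e x1 e0; have x0 : 0 < x by exact: lt_trans x1.
  have y1 := bx1 _ (ltW x1); have y0 : 0 < b * x by exact: lt_le_trans y1.
  (* small enough for the error [d * (b * x - 1)] of the union bound to stay below [e] *)
  pose d := e / (2 * (b * x)).
  have d0 : 0 < d by rewrite divr_gt0// mulr_gt0.
  have de : d * (b * x - 1) < e.
    have -> : d * (b * x - 1) = e / 2 - d.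
      by rewrite /d; move: (b * x) y0 => y y0; field; exact: lt0r_neq0.
    lra.
  apply: (upper_tail_of mM q_gt0 k0 union_bound (d := d) (th := fun=> ln (b * x))) => //.
    by near=> t; rewrite ln_ge0.
  move=> C C0.
  have hlt : l - H (b * x) + d * (b * x - 1) < - (H (b * x) - H b - e) by rewrite lE; lra.
  have := cvgr_nearM_le lam0 (@dense_exponent C d x x0) hlt.
  by apply: filterS => t; rewrite mulrN.
- move=> x e x1 e0; have x0 : 0 < x by exact: lt_trans x1.
  have J0 : 0 < H (b * x) - H b by have := J_incr 1 x (lexx _) x1; rewrite mulr1 subrr.
  have e20 : 0 < e / 2 by rewrite divr_gt0.
  have : \forall t \near +oo, ((expR (- (lam t * (H (b * x) - H b + e / 2))) / 2)%:E
      <= P t [set w | (x <= scaled_dim M k w)%R])%E.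
    apply: (lower_tail_of mM lam_gt0 q_gt0 k0 independent_balls) => //.
      move=> c c1.
      have hlt : - (H (b * x) - H b + e / 2) < l - H (b * x) by rewrite lE; lra.
      have := cvgr_nearM lam0 (@dense_log_expected c x x0) hlt.
      by apply: filterS => t; rewrite mulrN.
    near=> t; have l0 : 0 < lam t by near: t.
    by rewrite oppr_le0 mulr_ge0 ?ltW// addr_gt0.
  move=> L; near=> t; apply: le_trans (_ : (expR (- (lam t * (H (b * x) - H b + e / 2))) / 2)%:E <= _)%E;
    last by near: t.
  have l2 : 2 / e <= lam t by near: t; exact: cvgry_ge.
  have le2 : 1 <= lam t * (e / 2) by rewrite -ler_pdivrMr// invf_div mul1r.
  rewrite lee_fin (_ : - (lam t * (H (b * x) - H b + e)) =
    - (lam t * (H (b * x) - H b + e / 2)) - lam t * (e / 2)); last by field.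
  rewrite expRD ler_wpM2l ?expR_ge0//; apply: le_trans (expRN1_le_half R).
  by rewrite ler_expR lerN2.
Unshelve. all: by end_near.
Qed.

End dense.

Let expR_ge_sqr (z : R) : 0 <= z -> (z / 2) ^+ 2 <= expR z.
Proof.
move=> z0; rewrite [in leRHS](splitr z) expRD -expr2 lerXn2r ?nnegrE ?expR_ge0 ?divr_ge0//.
by apply: le_trans (expR_ge1Dx _); rewrite lerDr.
Qed.

(** When the expected number of balls with enough points grows exponentially in [s], having
    none of them has a doubly exponentially small probability. *)
Lemma below_of_log_expected (k s : R -> R) x x' g :
  (\forall t \near +oo, 0 < k t) -> s t @[t --> +oo] --> +oo -> 0 < g -> x <= x' ->
  (forall c, 0 < c -> \forall t \near +oo, s t * g <= log_expected lam q k c x' t) ->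
  forall K, \forall t \near +oo, (P t [set w | (scaled_dim M k w <= x)%R] <= (expR (- (s t * K)))%:E)%E.
Proof.
move=> k0 soo g0 xx' hg K.
have B := @below_tail_of R disp Omega P M lam q k mM lam_gt0 q_gt0 k0 independent_balls x' (fun t => s t * g) hg.
near=> t.
have t0 : 0 < t by near: t; exact: nbhs_pinfty_gt.
have kt : 0 < k t by near: t.
have st : 0 < s t by near: t; exact: cvgry_gt.
have sK : 4 * K / g ^+ 2 <= s t by near: t; exact: cvgry_ge.
apply: (@le_trans _ _ (P t [set w | (scaled_dim M k w <= x')%R])).
  apply: le_measure; rewrite ?inE; [exact: (measurable_scaled_dim_tails mM x t0 kt).2
    |exact: (measurable_scaled_dim_tails mM x' t0 kt).2|].
  by move=> w /= /le_trans; apply.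
apply: le_trans (_ : (expR (- expR (s t * g)))%:E <= _)%E; first by near: t.
rewrite lee_fin ler_expR lerN2; apply: le_trans (expR_ge_sqr _); last by rewrite mulr_ge0// ltW.
rewrite (_ : (s t * g / 2) ^+ 2 = s t * (s t * (g ^+ 2 / 4))); last by field.
rewrite ler_pM2l// -ler_pdivrMr ?divr_gt0 ?exprn_gt0// (_ : K / _ = 4 * K / g ^+ 2)//.
by field; exact: lt0r_neq0.
Unshelve. all: by end_near.
Qed.

(** For [x'] slightly below one, the value [b * x'] stays above one, and [l - H (b * x')] is
    positive: the expected number of balls with enough points grows exponentially. *)
Lemma dense_below b l x K : 1 < b -> lam t @[t --> +oo] --> +oo ->
  ln (q t) / lam t @[t --> +oo] --> l -> l = H b -> x < 1 ->
  \forall t \near +oo,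
    (P t [set w | (scaled_dim M (fun t => b * lam t) w <= x)%R] <= (expR (- (lam t * K)))%:E)%E.
Proof.
move=> b1 lam_oo lq lE x1; have b0 : 0 < b by exact: lt_trans b1.
have bi1 : b^-1 < 1 by rewrite invf_lt1.
pose x' := Num.max x ((b^-1 + 1) / 2).
have xx' : x <= x' by rewrite le_max lexx.
have x'1 : x' < 1 by rewrite gt_max x1/=; lra.
have bx' : b^-1 < x' by rewrite lt_max; apply/orP; right; lra.
have x'0 : 0 < x' by apply: lt_trans bx'; rewrite invr_gt0.
have y1 : 1 < b * x' by rewrite -ltr_pdivrMl// mulr1.
have yb : b * x' < b by rewrite gtr_pMr.
pose g := (H b - H (b * x')) / 2.
have Hlt := H_incr (ltW y1) yb.
have g0 : 0 < g by rewrite divr_gt0// subr_gt0.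
apply: (@below_of_log_expected _ _ _ x' g) => // [|c c1].
  near=> t; rewrite mulr_gt0//; near: t; exact: cvgry_gt.
apply: cvgr_nearM (@dense_log_expected b l b0 lam_oo lq c x' x'0) _.
  exact: cvgry_gt.
by rewrite lE /g ltr_pdivrMr//; lra.
Unshelve. all: by end_near.
Qed.

(** The level lies below the mean [lam t], so one ball has too few points with a probability
    exponentially small in [lam t]. This has to happen in all of the about [q t] independent
    balls, which multiplies the exponent by [q t], and [q t] tends to infinity. *)
Lemma concentrated_below x K : lam t @[t --> +oo] --> +oo -> x < 1 ->
  \forall t \near +oo,
    (P t [set w | (scaled_dim M (fun t => 1 * lam t) w <= x)%R] <= (expR (- (lam t * K)))%:E)%E.
Proof.
move=> lam_oo x1; pose k t := 1 * lam t.
pose z := Num.max x (1 / 2); pose x' := (z + 1) / 2.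
have xz : x <= z by rewrite le_max lexx.
have z2 : 1 / 2 <= z by rewrite le_max lexx orbT.
have z1 : z < 1 by rewrite gt_max x1/=; lra.
have x'1 : x' < 1 by rewrite /x'; lra.
have x'0 : 0 < x' by rewrite /x'; lra.
have Hx' : 0 < H x' by apply: H_gt0 => //; rewrite lt_eqF.
have [c c1 L] := independent_balls.
near=> t.
have t0 : 0 < t by near: t; exact: nbhs_pinfty_gt.
have l0 := lam_gt0 t0; have kt : 0 < k t by rewrite /k mul1r.
have lx : 1 / (x' - z) <= lam t by near: t; exact: cvgry_ge.
have qK : K / (c * H x') <= q t by near: t; exact: cvgry_ge.
have [N cN LN] : exists2 N : nat, c * q t <= N%:R & forall n : nat,
    (P t [set w | (M w < n)%N] <=
      ((fine (poisson_prob (lam t) 0%N [set j | (j < n)%N])) ^+ N)%:E)%E by near: t.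
have x'z : 0 < x' - z by rewrite /x'; lra.
set n := level k x t.
apply: (@le_trans _ _ (P t [set w | (M w < n)%N])).
  apply: le_measure; rewrite ?inE; first exact: (measurable_scaled_dim_tails mM x t0 kt).2.
    exact: (@measurable_count _ _ _ _ mM t [set j | (j < n)%N]).
  move=> w /=; rewrite ge_scaled_dim// -(ltr_nat R) => /le_lt_trans; apply.
  exact: truncnS_gt.
apply: le_trans (LN n) _; rewrite lee_fin.
set p := fine _.
have p0 : 0 <= p by rewrite fine_ge0// measure_ge0.
have pe : p <= expR (- (lam t * H x')).
  rewrite -lee_fin /p fineK ?fin_num_measure//.
  apply: le_trans (poisson_lower_tail (ltW l0) x'0 (ltW x'1)).
  apply: le_measure; rewrite ?inE// => j /=; rewrite ltnS => jn.
  have [y0|y0] := leP 0 (x * k t + 1); last first.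
    have E : Num.truncn (x * k t + 1) = 0%N by rewrite truncn_floor leNgt y0.
    move: jn; rewrite E leqn0 => /eqP ->.
    by rewrite mulr_ge0// ltW.
  have /andP[jy _] := truncn_itv y0.
  apply: (@le_trans _ _ (x * k t + 1)).
    by apply: le_trans jy; rewrite ler_nat.
  have : 1 <= lam t * (x' - z) by rewrite -ler_pdivrMr.
  have : x * lam t <= z * lam t by rewrite ler_pM2r.
  by rewrite /k mul1r; lra.
apply: (@le_trans _ _ (expR (- (lam t * H x')) ^+ N)).
  by rewrite lerXn2r ?nnegrE ?expR_ge0.
rewrite -expRM_natr ler_expR (_ : - (lam t * H x') * N%:R = - (lam t * (H x' * N%:R))); last by ring.
rewrite lerN2 ler_pM2l//.
apply: (@le_trans _ _ (H x' * (c * q t))); last by rewrite ler_pM2l.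
rewrite (_ : H x' * (c * q t) = q t * (c * H x')); last by ring.
by move: qK; rewrite ler_pdivrMr ?mulr_gt0.
Unshelve. all: by end_near.
Qed.

(** The regime in which [rho t] is small compared with [ln t]. The number [n] of points in one
    ball then costs about [n * ln (n / lam t)], and [u t] is the leading term of the logarithm
    for [n = x * k t], so that the cost is [x * ln t]; it competes with the gain [ln t] from
    the number of balls. *)
Section sparse.
Hypothesis rho_small : rho t / ln t @[t --> +oo] --> 0.
Hypothesis rho_subpoly : forall a, 0 < a -> rho t / t `^ (- a) @[t --> +oo] --> +oo.

Let u t := ln (ln t / rho t).
Let k t := ln t / u t.

Let id_oo : (t : R) @[t --> +oo] --> +oo.
Proof. exact: cvg_id. Qed.

Let ln_oo : ln (t : R) @[t --> +oo] --> +oo.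
Proof. exact: ln_cvgy id_oo. Qed.

Let ln_gt0 : \forall t \near +oo, 0 < ln (t : R).
Proof. exact: cvgry_gt. Qed.

Let ratio_oo : ln t / rho t @[t --> +oo] --> +oo.
Proof.
apply: (@cvg_near_eq _ _ (fun t => (rho t / ln t)^-1)); first by near=> t; rewrite invf_div.
apply/cvgrVy => //; near=> t.
have t0 : 0 < t by near: t; exact: nbhs_pinfty_gt.
by rewrite divr_gt0 ?rho_gt0//; near: t.
Unshelve. all: by end_near.
Qed.

Let u_oo : u t @[t --> +oo] --> +oo.
Proof. exact: ln_cvgy. Qed.

Let u_gt0 : \forall t \near +oo, 0 < u t.
Proof. exact: cvgry_gt. Qed.

(** [rho t] lies between every negative power of [t] and [ln t]. *)
Let lnrho_ln : ln (rho t) / ln t @[t --> +oo] --> 0.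
Proof.
apply/cvgr0Pnorm_le => e e0; near=> t.
have t0 : 0 < t by near: t; exact: nbhs_pinfty_gt.
have lt0 : 0 < ln t by near: t.
have r0 := rho_gt0 t0.
have h1 : 1 <= rho t / t `^ (- e) by near: t; apply: cvgry_ge; exact: rho_subpoly.
have h2 : 1 <= ln t / rho t by near: t; exact: cvgry_ge.
have h3 : `|ln (ln t) / ln t| <= e by near: t; apply: cvgr0_norm_le => //; exact: ln_div_cvg0.
have h4 : ln (rho t) <= ln (ln t).
  by rewrite ler_ln ?posrE//; move: h2; rewrite ler_pdivlMr// mul1r.
have h5 : - (e * ln t) <= ln (rho t).
  have p0 : 0 < t `^ (- e) by exact: powR_gt0.
  move: h1; rewrite ler_pdivlMr// mul1r -ler_ln ?posrE// ln_powR; lra.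
have h6 : ln (ln t) <= e * ln t.
  by rewrite -ler_pdivrMr//; exact: le_trans (ler_norm _) h3.
rewrite ler_norml ler_pdivlMr// ler_pdivrMr// mulNr h5 /=.
exact: le_trans h4 h6.
Unshelve. all: by end_near.
Qed.

Let u_ln : u t / ln t @[t --> +oo] --> 0.
Proof.
rewrite -[X in _ --> X](subr0 0); apply: (@cvg_near_eq _ _ (fun t => ln (ln t) / ln t - ln (rho t) / ln t)).
  near=> t; have t0 : 0 < t by near: t; exact: nbhs_pinfty_gt.
  have lt0 : 0 < ln t by near: t.
  by rewrite -mulrBl /u ln_div ?posrE ?rho_gt0.
by apply: cvgB => //; exact: ln_div_cvg0.
Unshelve. all: by end_near.
Qed.

Let k_oo : k t @[t --> +oo] --> +oo.
Proof.
apply: (@cvg_near_eq _ _ (fun t => (u t / ln t)^-1)); first by near=> t; rewrite invf_div.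
apply/cvgrVy => //; near=> t.
by rewrite divr_gt0//; near: t.
Unshelve. all: by end_near.
Qed.

Let k_gt0 : \forall t \near +oo, 0 < k t.
Proof. exact: cvgry_gt. Qed.

Let lam_ln : lam t / ln t @[t --> +oo] --> 0.
Proof.
rewrite -[X in _ --> X](mulr0 c0).
apply: (@cvg_near_eq _ _ (fun t => c0 * (rho t / ln t))); first by near=> t; rewrite mulrA.
exact: cvgMr.
Unshelve. all: by end_near.
Qed.

Let lnq_ln : ln (q t) / ln t @[t --> +oo] --> (1 : R).
Proof.
rewrite -[X in _ --> X](subr0 1); apply: (@cvg_near_eq _ _ (fun t => 1 - ln (rho t) / ln t)).
  near=> t; have t0 : 0 < t by near: t; exact: nbhs_pinfty_gt.
  have lt0 : 0 < ln t by near: t.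
  have -> : ln (q t) = ln t - ln (rho t) by rewrite /q ln_div ?posrE ?rho_gt0.
  by rewrite mulrBl divff ?gt_eqF.
by apply: cvgB => //; exact: cvg_cst.
Unshelve. all: by end_near.
Qed.

Let inv_u : (u t)^-1 @[t --> +oo] --> 0.
Proof.
by apply: (@cvg_near_eq _ _ (fun t => 1 / u t)); [near=> t; rewrite div1r|exact: cvg_cstV].
Unshelve. all: by end_near.
Qed.

Lemma sparse_log_expected c x : 0 < x ->
  log_expected lam q k c x t / ln t @[t --> +oo] --> 1 - x.
Proof.
move=> x0; pose N t := (level k x t)%:R : R.
have Nk : N t / k t @[t --> +oo] --> x by apply: level_ratio; [exact: ltW|].
have N_ln : N t / ln t @[t --> +oo] --> 0.
  rewrite -[X in _ --> X](mulr0 x); apply: (@cvg_near_eq _ _ (fun t => N t / k t * (u t)^-1)).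
    near=> t; have lt0 : 0 < ln t by near: t.
    have ut0 : 0 < u t by near: t.
    by rewrite /k; field; apply/andP; split; exact: lt0r_neq0.
  exact: cvgM.
have lnN_ln : ln (N t) / ln t @[t --> +oo] --> 0.
  apply: (@squeeze_cvgr _ _ _ _ (fun=> 0) (fun t => ln (ln t) / ln t)).
  - near=> t; have lt0 : 0 < ln t by near: t.
    have N1 : 1 <= N t by rewrite /N ler1n.
    rewrite divr_ge0 ?ln_ge0 ?(ltW lt0)//= ler_pM2r ?invr_gt0// ler_ln ?posrE ?level_gt0//.
    have : N t / ln t <= 1 by near: t; apply: cvgr_le N_ln _ _.
    by rewrite ler_pdivrMr// mul1r.
  - exact: cvg_cst.
  - exact: ln_div_cvg0.
have NlnN : N t * ln (N t / lam t) / ln t @[t --> +oo] --> x.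
  rewrite -[X in _ --> X]mulr1.
  apply: (@cvg_near_eq _ _ (fun t => N t / k t *
     (ln (N t / k t) * (u t)^-1 + 1 - ln (u t) / u t - ln c0 / u t))).
    near=> t; have t0 : 0 < t by near: t; exact: nbhs_pinfty_gt.
    have lt0 : 0 < ln t by near: t.
    have ut0 : 0 < u t by near: t.
    have kt0 : 0 < k t by near: t.
    have r0 := rho_gt0 t0; have l0 := lam_gt0 t0.
    have -> : ln (N t / lam t) = ln (N t / k t) + u t - ln (u t) - ln c0.
      have -> : ln (N t / lam t) = ln (N t) - ln (lam t) by rewrite ln_div ?posrE ?level_gt0.
      have -> : ln (N t / k t) = ln (N t) - ln (k t) by rewrite ln_div ?posrE ?level_gt0.
      have -> : ln (k t) = ln (ln t) - ln (u t) by rewrite /k ln_div ?posrE.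
      have -> : ln (lam t) = ln c0 + ln (rho t) by rewrite /lam lnM ?posrE.
      have -> : u t = ln (ln t) - ln (rho t) by rewrite /u ln_div ?posrE.
      ring.
    move: (ln (N t / k t)) (ln (u t)) => v w.
    by rewrite /k; field; apply/andP; split; exact: lt0r_neq0.
  apply: cvgM => //.
  rewrite [X in _ --> X](_ : 1 = ln x * 0 + 1 - 0 - 0); last by ring.
  apply: cvgB; last exact: cvg_cstV.
  apply: cvgB; last exact: ln_div_cvg0.
  apply: cvgD; last exact: cvg_cst.
  by apply: cvgM => //; exact: cvg_ln.
apply: (@cvg_near_eq _ _ (fun t => ln c / ln t + ln (q t) / ln t - lam t / ln t
    - N t * ln (N t / lam t) / ln t + N t / ln t - 1 / ln t - ln (N t) / ln t)).
  near=> t; have t0 : 0 < t by near: t; exact: nbhs_pinfty_gt.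
  by rewrite log_expectedE// -/(N t); ring.
rewrite (_ : 1 - x = 0 + 1 - 0 - x + 0 - 0 - 0); last by ring.
apply: cvgB => //; apply: cvgB; last exact: cvg_cstV.
apply: cvgD => //; apply: cvgB => //; apply: cvgB => //.
by apply: cvgD => //; exact: cvg_cstV.
Unshelve. all: by end_near.
Qed.

(** With the Chernoff parameter [(1 - h) * u t] the term of order [lam t * expR ((1 - h) * u
    t)] is [ln t] divided by a power of [ln t / rho t], hence negligible. The parameter [u
    t] itself would leave a term of order [ln t]. *)
Lemma sparse_exponent (C h x : R) : 0 < h -> h < 1 ->
  (ln C + ln (q t) + ((1 + 1) * lam t * (expR ((1 - h) * u t) - 1) - (1 - h) * u t * (x * k t)))
    / ln t @[t --> +oo] --> 1 - (1 - h) * x.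
Proof.
move=> h0 h1.
apply: (@cvg_near_eq _ _ (fun t => ln C / ln t + ln (q t) / ln t +
   (2 * c0 / expR (h * u t) - 2 * (lam t / ln t)) - (1 - h) * x)).
  near=> t; have t0 : 0 < t by near: t; exact: nbhs_pinfty_gt.
  have lt0 : 0 < ln t by near: t.
  have ut0 : 0 < u t by near: t.
  have r0 := rho_gt0 t0.
  have -> : expR ((1 - h) * u t) = ln t / rho t / expR (h * u t).
    by rewrite mulrBl mul1r expRD expRN /u lnK// posrE divr_gt0.
  have e0 := expR_gt0 (h * u t); move: (expR (h * u t)) e0 => E e0.
  rewrite /k /lam; field.
  by rewrite !lt0r_neq0.
rewrite (_ : 1 - (1 - h) * x = 0 + 1 + (0 - 2 * 0) - (1 - h) * x); last by ring.
apply: cvgB; last exact: cvg_cst.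
apply: cvgD; first by apply: cvgD => //; exact: cvg_cstV.
apply: cvgB; last exact: cvgMr.
apply: cvg_cstV; apply/cvgryPge => A; near=> t.
apply: le_trans (expR_ge1Dx _); rewrite -lerBlDl -ler_pdivrMl//.
near: t; exact: cvgry_ge.
Unshelve. all: by end_near.
Qed.

Lemma sparse_ldp : ldp_rv P (fun t w => scaled_dim M k w) (@ln R) (rate_from1 (fun x => x - 1)).
Proof.
apply: ldp_rv_of_tails.
- by move=> t t0; exact: measurable_scaled_dim.
- exact: ln_oo.
- by move=> x y _ xy; rewrite ltrD2r.
- by rewrite subrr.
- by move=> x _; apply: cvgB; [exact: cvg_id|exact: cvg_cst].
- by move=> K; exists (Num.max 1 (K + 1)); rewrite ?le_max ?lexx// lerBrDr le_max lexx orbT.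
- move=> x e x1 e0; have x0 : 0 < x by exact: lt_trans x1.
  pose h := Num.min (1 / 2) (e / (2 * x)).
  have h0 : 0 < h by rewrite lt_min !divr_gt0// mulr_gt0.
  have h2 : h <= 1 / 2 by rewrite ge_min lexx.
  have hx : h * x <= e / 2.
    have : h <= e / (2 * x) by rewrite ge_min lexx orbT.
    by rewrite invfM mulrA ler_pdivlMr.
  have h1 : h < 1 by lra.
  apply: (upper_tail_of mM q_gt0 k_gt0 union_bound (d := 1) (th := fun t => (1 - h) * u t)) => //.
    near=> t; have ut0 : 0 < u t by near: t.
    by rewrite mulr_ge0 ?(ltW ut0)//; lra.
  move=> C C0.
  have hlt : 1 - (1 - h) * x < - (x - 1 - e) by lra.
  have := cvgr_nearM_le ln_gt0 (@sparse_exponent C h x h0 h1) hlt.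
  by apply: filterS => t; rewrite mulrN.
- move=> x e x1 e0; have x0 : 0 < x by exact: lt_trans x1.
  have e20 : 0 < e / 2 by rewrite divr_gt0.
  have L : \forall t \near +oo, ((expR (- (ln t * (x - 1 + e / 2))) / 2)%:E
      <= P t [set w | (x <= scaled_dim M k w)%R])%E.
    apply: (lower_tail_of mM lam_gt0 q_gt0 k_gt0 independent_balls) => //.
      move=> c c1.
      have hlt : - (x - 1 + e / 2) < 1 - x by lra.
      have := cvgr_nearM ln_gt0 (@sparse_log_expected c x x0) hlt.
      by apply: filterS => t; rewrite mulrN.
    near=> t; have l0 : 0 < ln t by near: t.
    by rewrite oppr_le0 mulr_ge0 ?(ltW l0)//; lra.
  near=> t; apply: le_trans (_ : (expR (- (ln t * (x - 1 + e / 2))) / 2)%:E <= _)%E;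
    last by near: t.
  have l2 : 2 / e <= ln t by near: t; exact: cvgry_ge.
  have le2 : 1 <= ln t * (e / 2) by rewrite -ler_pdivrMr// invf_div mul1r.
  rewrite lee_fin (_ : - (ln t * (x - 1 + e)) = - (ln t * (x - 1 + e / 2)) - ln t * (e / 2)); last by field.
  rewrite expRD ler_wpM2l ?expR_ge0//; apply: le_trans (expRN1_le_half R).
  by rewrite ler_expR lerN2.
- move=> x K x1.
  pose x' := Num.max x (1 / 2).
  have xx' : x <= x' by rewrite le_max lexx.
  have x'0 : 0 < x' by rewrite lt_max; apply/orP; right; lra.
  have x'1 : x' < 1 by rewrite gt_max x1/=; lra.
  have g0 : 0 < (1 - x') / 2 by lra.
  apply: (@below_of_log_expected _ _ _ x' ((1 - x') / 2)) => // c c1.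
  by apply: cvgr_nearM (@sparse_log_expected c x' x'0) _ => //; lra.
Unshelve. all: by end_near.
Qed.

End sparse.
End regimes.

(** * Poisson processes on a convex window *)

Lemma compact_sub_box (R : realType) d (W : set 'rV[R]_d) : compact W -> exists L : nat, W `<=` box L.
Proof.
move=> cW; have h i : exists L : nat, forall x, W x -> `|x ord0 i| <= L%:R.
  have cc : {within W, continuous (fun x : 'rV[R]_d => x ord0 i)}.
    by apply: continuous_subspaceT => x; exact: coord_continuous.
  have /compact_bounded [M [_ bM]] := continuous_compact cc cW.
  exists (Num.truncn (M + 1)).+1 => x Wx; apply: le_trans (ltW (truncnS_gt _)).
  by apply: bM; [rewrite ltrDl|exists x].
have [L LP] := choice h; exists (\max_i L i) => x Wx i.
by apply: le_trans (LP i x Wx) _; rewrite ler_nat leq_bigmax.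
Qed.

(** By [1 + y <= expR y] with [y] a small multiple of [ln (1 + e)]. *)
Lemma fine_mesh (R : realType) (d : nat) (e : R) : 0 < e ->
  exists2 m : nat, (0 < m)%N & (1 + 2 * d%:R / m%:R) ^+ d <= 1 + e.
Proof.
move=> e0; have l0 : 0 < ln (1 + e) by rewrite ln_gt0 ?ltrDl.
pose m := (Num.truncn (2 * d%:R * d%:R / ln (1 + e))).+1; exists m => //.
have m0 : 0 < m%:R :> R by rewrite ltr0n.
apply: (@le_trans _ _ (expR (2 * d%:R / m%:R) ^+ d)).
  rewrite lerXn2r ?nnegrE ?expR_ge0 ?expR_ge1Dx// addr_ge0// divr_ge0 ?mulr_ge0//.
rewrite -expRM_natl -[leRHS]lnK ?posrE ?addr_gt0// ler_expR.
rewrite mulrA (mulrC d%:R).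
by rewrite ler_pdivrMr// [leRHS]mulrC -ler_pdivrMr//; exact: ltW (truncnS_gt _).
Qed.

Section poisson_family.
Variables (R : realType) (d : nat) (W : set 'rV[R]_d).
Hypotheses (d_gt0 : (0 < d)%N) (W_compact : compact W) (W_convex : convex_set W).
Hypothesis (W_vol : vol W = 1%E).
Variables (disp : measure_display) (Omega : R -> measurableType disp).
Variables (P : forall t : R, probability (Omega t) R).
Variables (eta : forall t : R, Omega t -> {fset 'rV[R]_d}).
Hypothesis eta_poisson : forall t : R, 0 < t -> poisson_process (P t) W t (@eta t).
Variables (r : R -> R) (c : complex_kind).
Hypotheses (r_gt0 : forall t, 0 < t -> 0 < r t) (r_cvg0 : r t @[t --> +oo] --> 0).

Let rho t := t * r t ^+ d.
Let c0 := unit_ball_volume R d / 2 ^+ d.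
Let M t (w : Omega t) := max_face c (eta w) (r t).

Let borel_W : borel W.
Proof. by apply: closed_borel; apply: compact_closed => //; exact: norm_hausdorff. Qed.

Let rhoE t : 0 < t -> t / rho t = (r t ^+ d)^-1.
Proof.
by move=> t0; rewrite /rho; field; rewrite !gt_eqF// ?exprn_gt0// r_gt0.
Qed.

Lemma rho_gt0 t : 0 < t -> 0 < rho t.
Proof. by move=> t0; rewrite mulr_gt0// exprn_gt0// r_gt0. Qed.

Lemma ball_rate_gt0 : 0 < c0.
Proof. by rewrite divr_gt0 ?exprn_gt0// unit_ball_volume_gt0. Qed.

Lemma measurable_face_size t : 0 < t -> measurable_fun setT (@M t).
Proof. by move=> t0; exact: (measurable_max_face borel_W (eta_poisson t0)). Qed.

Let measurable_face_event t k (S : set nat) : 0 < t ->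
  measurable [set w | S (max_face k (@eta t w) (r t))].
Proof.
move=> t0; have := measurable_max_face borel_W (eta_poisson t0) k (r t) measurableT (I : measurable S).
by rewrite setTI.
Qed.

Let le_face_event t k k' (S S' : set nat) : 0 < t ->
  (forall w, S (max_face k (@eta t w) (r t)) -> S' (max_face k' (eta w) (r t))) ->
  (P t [set w | S (max_face k (eta w) (r t))] <= P t [set w | S' (max_face k' (eta w) (r t))])%E.
Proof. by move=> t0 h; apply: le_measure => //; rewrite inE; exact: measurable_face_event. Qed.

Lemma radius_small e : 0 < e -> \forall t \near +oo, r t <= e.
Proof. by move=> e0; exact: (cvgr_le 0 r_cvg0). Qed.

Lemma ball_count_cvgy : t / rho t @[t --> +oo] --> +oo.
Proof.
apply: (cvg_near_eq (g := fun t => (r t ^+ d)^-1)).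
  by near=> t; apply: rhoE; near: t; exact: nbhs_pinfty_gt.
apply/cvgryPge => A.
pose B := Num.max A 1; have B0 : 0 < B by rewrite lt_max ltr01 orbT.
near=> t; have t0 : 0 < t by near: t; exact: nbhs_pinfty_gt.
have r0 := r_gt0 t0; have r1 : r t <= 1 by near: t; exact: radius_small.
apply: (@le_trans _ _ B); first by rewrite le_max lexx.
rewrite -[B]invrK lef_pV2 ?posrE ?invr_gt0 ?exprn_gt0//.
have rB : r t <= B^-1 by near: t; apply: radius_small; rewrite invr_gt0.
by apply: le_trans rB; apply: ler_iXnr; rewrite // ltW.
Unshelve. all: by end_near.
Qed.

Let lamE t : c0 * rho t = t * (unit_ball_volume R d * (r t / 2) ^+ d).
Proof. by rewrite /c0 /rho expr_div_n; field; rewrite expf_neq0. Qed.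

(** A mesh that is a small fraction of [r t] inflates the rate of a ball by a factor of at
    most [1 + e], and there are about [(r t) ^- d] anchors, which is [t / rho t]. *)
Lemma face_size_union_bound (e : R) : 0 < e -> exists2 C : R, 0 < C &
  \forall t \near +oo, forall (n : nat) (th : R), (0 < n)%N -> 0 <= th ->
    (P t [set w | (n <= M w)%N] <=
      (C * (t / rho t) * expR ((1 + e) * (c0 * rho t) * (expR th - 1) - th * n%:R))%:E)%E.
Proof.
move=> e0; have [L WL] := compact_sub_box W_compact; have [m m0 me] := fine_mesh d e0.
have m0' : 0 < m%:R :> R by rewrite ltr0n.
exists ((2 * L%:R * m%:R + 3) ^+ d * (2 ^ m.+1.*2.+1 ^ d)%N%:R).
  by rewrite mulr_gt0 ?ltr0n ?expn_gt0// exprn_gt0// ltr_wpDl// !mulr_ge0.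
near=> t; have t0 : 0 < t by near: t; exact: nbhs_pinfty_gt.
have r0 := r_gt0 t0; have r1 : r t <= 1 by near: t; exact: radius_small.
move=> n th n0 th0; have pp := eta_poisson t0.
apply: (@le_trans _ _ (P t [set w | (n <= max_face VietorisRips (eta w) (r t))%N])).
  apply: (le_face_event (S := [set j | (n <= j)%N]) (S' := [set j | (n <= j)%N])) => //=.
  by case: c => // w h; exact: leq_trans h (max_face_Cech_le _ _).
apply: (le_trans (max_face_tail_le borel_W pp WL (ltW t0) r0 m0 n0 th0)).
have u0 := unit_ball_volume_gt0 R d.
rewrite lee_fin; apply: ler_pM; [exact: ler0n|exact: expR_ge0| |].
  rewrite natrM natrX rhoE// mulrAC ler_wpM2r// -exprVn -exprMn lerXn2r ?nnegrE//.
    by rewrite mulr_ge0 ?invr_ge0 ?(ltW r0)// addr_ge0// !mulr_ge0.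
  rewrite -addnn -[_.+1]addn1 !natrD.
  have tr : (Num.truncn (L%:R / (r t / m%:R)))%:R <= L%:R / (r t / m%:R) :> R.
    by rewrite truncn_le// divr_ge0// divr_ge0// ltW.
  rewrite ler_pdivlMr//; move: tr; rewrite invf_div mulrA ler_pdivlMr//.
  by rewrite -[_.+1]addn1 natrD; nra.
rewrite ler_expR lerB// ler_wpM2r ?subr_ge0 ?expR_ge1//.
  by rewrite -expR0 ler_expR.
rewrite lamE [leRHS]mulrCA ler_wpM2l ?(ltW t0)// [leRHS]mulrCA ler_wpM2l ?(ltW u0)//.
rewrite (_ : _ / 2 = (1 + 2 * d%:R / m%:R) * (r t / 2)); last by field; rewrite gt_eqF.
by rewrite exprMn ler_wpM2r// exprn_ge0// divr_ge0 ?(ltW r0).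
Unshelve. all: by end_near.
Qed.

(** The cube inside [W] contains of the order of [(r t) ^- d] disjoint balls. *)
Lemma face_size_independent_balls : exists2 e : R, 0 < e & \forall t \near +oo,
  exists2 N : nat, e * (t / rho t) <= N%:R & forall n : nat,
    (P t [set w | (M w < n)%N] <=
      ((fine (poisson_prob (c0 * rho t) 0%N [set j | (j < n)%N])) ^+ N)%:E)%E.
Proof.
have vol0 : (0 < vol W)%E by rewrite W_vol lte_fin.
have [a [l [l0 lW]]] := convex_contains_cube borel_W W_convex vol0.
have l20 : 0 < l / 2 by rewrite divr_gt0.
exists ((l / 2) ^+ d); first exact: exprn_gt0.
near=> t; have t0 : 0 < t by near: t; exact: nbhs_pinfty_gt.
have r0 := r_gt0 t0; have rl : r t <= l / 2 by near: t; exact: radius_small.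
pose N := Num.truncn (l / r t).
have Nl : N%:R <= l / r t by rewrite truncn_le// divr_ge0 ?ltW.
exists (N ^ d)%N => [|n].
  rewrite rhoE// natrX -exprVn -exprMn lerXn2r ?nnegrE ?mulr_ge0 ?invr_ge0 ?(ltW r0) ?(ltW l0)//.
  have : l / r t < N%:R + 1 by rewrite natr1; exact: truncnS_gt.
  have : 2 <= l / r t by rewrite ler_pdivlMr//; lra.
  by rewrite mulrAC; lra.
apply: (@le_trans _ _ (P t [set w | (max_face Cech (eta w) (r t) < n)%N])).
  apply: (le_face_event (S := [set j | (j < n)%N]) (S' := [set j | (j < n)%N])) => //=.
  by case: c => // w; apply: leq_ltn_trans; exact: max_face_Cech_le.
rewrite lamE; apply: (max_face_lt_le borel_W (eta_poisson t0) n r0 _ lW).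
by rewrite -ler_pdivlMr.
Unshelve. all: by end_near.
Qed.

End poisson_family.

Section rates.
Variables (R : realType) (c0 : R) (rho : R -> R).
Hypotheses (c0_gt0 : 0 < c0) (rho_gt0 : forall t, 0 < t -> 0 < rho t).

Lemma rate_cvgy (b : R) : 0 < b -> (\forall t \near +oo, b <= rho t / ln t) ->
  c0 * rho t @[t --> +oo] --> +oo.
Proof.
move=> b0 h; apply/cvgryPge => A; near=> t.
have t1 : 1 < t by near: t; exact: nbhs_pinfty_gt.
have l0 : 0 < ln t by exact: ln_gt0.
have bh : b <= rho t / ln t by near: t.
have lA : A / (c0 * b) <= ln t by near: t; apply: cvgry_ge; apply: ln_cvgy; exact: cvg_id.
move: bh lA; rewrite ler_pdivlMr// ler_pdivrMr ?mulr_gt0// => bh lA.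
by apply: le_trans lA _; rewrite mulrC -mulrA ler_wpM2l// ltW.
Unshelve. all: by end_near.
Qed.

(** [ln (t / rho t)] and [ln t] differ by [ln (c0 * rho t)] and a constant, which are
    negligible against [c0 * rho t]. *)
Lemma ln_balls_ratio (l : R) : c0 * rho t @[t --> +oo] --> +oo ->
  ln t / (c0 * rho t) @[t --> +oo] --> l -> ln (t / rho t) / (c0 * rho t) @[t --> +oo] --> l.
Proof.
move=> lam_oo lnlam; rewrite (_ : l = l + 0 - 0); last by rewrite subr0 addr0.
apply: (cvg_near_eq (g := fun t => ln t / (c0 * rho t) + ln c0 / (c0 * rho t)
   - ln (c0 * rho t) / (c0 * rho t))).
  near=> t; have t0 : 0 < t by near: t; exact: nbhs_pinfty_gt.
  have r0 := rho_gt0 t0.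
  by rewrite ln_div ?lnM ?posrE// -mulrDl -mulrBl; congr (_ * _); ring.
by apply: cvgB; [apply: cvgD => //; exact: cvg_cstV|exact: ln_div_cvg0].
Unshelve. all: by end_near.
Qed.

End rates.

Theorem theorem1p2 (R : realType) (d : nat) (d_gt0 : (0 < d)%N)
  (W : set 'rV[R]_d) (W_compact : compact W) (W_convex : convex_set W)
  (W_vol : vol W = 1%E)
  (disp : measure_display) (Omega : R -> measurableType disp)
  (P : forall t : R, probability (Omega t) R)
  (eta : forall t : R, Omega t -> {fset 'rV[R]_d})
  (eta_poisson : forall t : R, 0 < t -> poisson_process (P t) W t (eta t))
  (r : R -> R) (r_gt0 : forall t, 0 < t -> 0 < r t)
  (r_decr : forall s t, 0 < s -> s <= t -> r t <= r s)
  (r_cvg0 : r t @[t --> +oo] --> 0)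
  (c : complex_kind) :
  let rho := fun t : R => t * r t ^+ d in
  let kappa := unit_ball_volume R d in
  let D := fun (t : R) (w : Omega t) => complex_dim (eta t w) (complex c (eta t w) (r t)) in
  (forall alpha : R, 0 < alpha -> rho t / t `^ (- alpha) @[t --> +oo] --> +oo) ->
  [/\ rho t / ln t @[t --> +oo] --> 0 ->
        ldp_rv P (fun t w => (D t w)%:~R / (ln t / ln (ln t / rho t)))
          (fun t => ln t)
          (rate_from1 (fun x => x - 1)),
      forall B : R, 0 < B -> rho t / ln t @[t --> +oo] --> B ->
        exists beta : R,
          unique (fun b : R => 1 < b /\ H b = (B * (kappa / 2 ^+ d))^-1) beta /\
          ldp_rv P (fun t w => (D t w)%:~R / (beta * (kappa / 2 ^+ d * rho t)))
            (fun t => kappa / 2 ^+ d * rho t)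
            (rate_from1 (fun x => H (beta * x) - H beta))
    & rho t / ln t @[t --> +oo] --> +oo ->
        ldp_rv P (fun t w => (D t w)%:~R / (kappa / 2 ^+ d * rho t))
          (fun t => kappa / 2 ^+ d * rho t)
          (rate_from1 (fun x => H x))].
Proof.
move=> rho kappa D rho_subpoly.
pose M t w := max_face c (eta t w) (r t); pose c0 := kappa / 2 ^+ d.
have mM := measurable_face_size W_compact eta_poisson r c.
have c00 : 0 < c0 := ball_rate_gt0 R d.
have rho0 : forall t, 0 < t -> 0 < rho t := rho_gt0 d r_gt0.
have q_oo := ball_count_cvgy d_gt0 r_gt0 r_cvg0.
have tail := face_size_union_bound W_compact eta_poisson c r_gt0 r_cvg0.
have head := face_size_independent_balls W_compact W_convex W_vol eta_poisson c r_gt0 r_cvg0.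
split.
- by move=> rho_small; exact: (sparse_ldp mM c00 rho0 tail head rho_small rho_subpoly).
- move=> B B0 rhoB; have c0B : 0 < (B * c0)^-1 by rewrite invr_gt0 mulr_gt0.
  have [b b1 Hb] := H_surj c0B.
  have lam_oo : c0 * rho t @[t --> +oo] --> +oo.
    have B2 : 0 < B / 2 by rewrite divr_gt0.
    apply: (rate_cvgy c00 B2); apply: (cvgr_ge B rhoB); lra.
  have lq : ln (t / rho t) / (c0 * rho t) @[t --> +oo] --> (B * c0)^-1.
    apply: ln_balls_ratio => //.
    apply: (cvg_near_eq (g := fun t => (rho t / ln t * c0)^-1)).
      near=> t; have t1 : 1 < t by near: t; exact: nbhs_pinfty_gt.
      have t0 : 0 < t by exact: lt_trans t1.
      have l0 : 0 < ln t by exact: ln_gt0.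
      have r0 := rho0 t t0.
      by field; rewrite !gt_eqF.
    apply: cvgV; first by rewrite gt_eqF// mulr_gt0.
    exact: cvgMl.
  exists b; split.
    split; first by split.
    move=> b' [b'1 Hb']; case: (ltgtP b b') => // lt.
      by have := H_incr (ltW b1) lt; rewrite Hb Hb' ltxx.
    by have := H_incr (ltW b'1) lt; rewrite Hb Hb' ltxx.
  apply: (dense_ldp mM c00 rho0 tail head _ lam_oo lq (ltW b1) (esym Hb)).
    exact: lt_trans b1.
  move=> x K x1; exact: (dense_below mM c00 rho0 head K b1 lam_oo lq (esym Hb) x1).
- move=> rhoy.
  have lam_oo : c0 * rho t @[t --> +oo] --> +oo.
    by apply: (rate_cvgy c00 ltr01); exact: cvgry_ge.
  have lq : ln (t / rho t) / (c0 * rho t) @[t --> +oo] --> 0.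
    apply: ln_balls_ratio => //.
    apply: (cvg_near_eq (g := fun t => c0^-1 / (rho t / ln t))); last exact: cvg_cstV.
    near=> t; have t1 : 1 < t by near: t; exact: nbhs_pinfty_gt.
    have t0 : 0 < t by exact: lt_trans t1.
    have l0 : 0 < ln t by exact: ln_gt0.
    have r0 := rho0 t t0.
    by field; rewrite !gt_eqF.
  have below (x K : R) (x1 : x < 1) := concentrated_below mM c00 rho0 q_oo head K lam_oo x1.
  have := dense_ldp mM c00 rho0 tail head ltr01 lam_oo lq (lexx 1) (esym (H1 R)) below.
  rewrite (_ : (fun t w => scaled_dim M _ w) = (fun t w => (D t w)%:~R / (c0 * rho t))).
    rewrite (_ : (fun x => H (1 * x) - H 1) = (fun x => H x))//.
    by apply/funext => x; rewrite mul1r H1 subr0.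
  apply: functional_extensionality_dep => t; apply/funext => w.
  by rewrite /scaled_dim mul1r.
Unshelve. all: by end_near.
Qed.
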